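(* Let $\Omega\subset\mathbb{R}^d$ be a nonempty open set. Then: 1. $M(\Omega)$ is a closed subalgebra of $L_b(C^\infty(\Omega))$. 2. $T\mapsto M_T$ is an algebra isomorphism from $(\mathscr{E}'(V(\Omega)),\star)$ onto $M(\Omega)$.
   Context: For $x,y\in\mathbb{R}^d$, $xy=(x_1y_1,\dots,x_dy_d)$. $L_b(C^\infty(\Omega))$ is the algebra (under composition) of continuous linear operators on the Fréchet space $C^\infty(\Omega)$, with the topology of uniform convergence on bounded sets. An operator $M\in L(C^\infty(\Omega))$ is a Hadamard operator (operator of Hadamard type) if every monomial $x^\alpha$, $\alpha\in\mathbb{N}_0^d$, is an eigenvector, i.e. $Mx^\alpha=m_\alpha x^\alpha$ on $\Omega$ with $m_\alpha\in\mathbb{C}$; $M(\Omega)$ is the set of all Hadamard operators in $L(C^\infty(\Omega))$. $V(\Omega)=\{\eta\in\mathbb{R}^d:\eta\Omega\subset\Omega\}$, and $\mathscr{E}'(V(\Omega))$ is the set of distributions on $\mathbb{R}^d$ with compact support contained in $V(\Omega)$, equipped with the multiplication $(T\star S)f=T_x(S_yf(xy))$, $f\in C^\infty(\mathbb{R}^d)$. For $T\in\mathscr{E}'(V(\Omega))$, $(M_Tf)(x)=T_yf(xy)$ for $f\in C^\infty(\Omega)$, $x\in\Omega$. *)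

(* Defs.v *)
From HB Require Import structures.
From mathcomp Require Import all_boot all_order all_algebra.
From mathcomp Require Import all_classical all_reals all_analysis.
From mathcomp Require Import complex.

Set Implicit Arguments.
Unset Strict Implicit.
Unset Printing Implicit Defensive.

Import Order.TTheory GRing.Theory Num.Theory.
Import numFieldNormedType.Exports.

Local Open Scope classical_set_scope.
Local Open Scope ring_scope.

Lemma near0_differentiable (K : numFieldType) (U W : normedModType K) (k : U -> W) (x : U) :
  (\forall y \near x, k y = 0) -> differentiable k x.
Proof.
move=> k0; have kx : k x = 0 by exact: nbhs_singleton k0.
have E : k \o shift x = cst (k x) + (\0 : {linear U -> W}) +o_ 0 id.
  apply/eqaddoP => e e0; rewrite near_simpl.
  move: k0; rewrite (near_shift 0 x) subr0 => h; near=> y.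
  rewrite /= !fctE /= kx.
  have -> : k (y + x) = 0 by near: y; exact: h.
  by rewrite addr0 subr0 normr0 mulr_ge0 // ltW.
have c0 : continuous (\0 : {linear U -> W}) by move=> y; exact: cvg_cst.
apply/diff_locallyP; rewrite (diff_unique c0 E); split => //.
Unshelve. all: by end_near. Qed.

(* R^d is 'rV[R]_d and the complex scalars are R[i].  R[i]^o is the library's
   name for R[i] as a normed space over itself.  The library has no derivative
   for R[i]-valued maps of a real variable, so differentiation acts on the real
   and imaginary parts. *)
Section Smooth.
Variables (R : realType) (d : nat).
Local Notation V := 'rV[R]_d.
Local Notation C := R[i].
Implicit Types (f g : V -> C) (Omega : set V).

Definition cdifferentiable f (x : V) : Prop :=
  differentiable (fun y => complex.Re (f y)) x /\
  differentiable (fun y => complex.Im (f y)) x.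

Definition pderiv (i : 'I_d) f : V -> C := fun x =>
  ('D_(delta_mx 0 i) (fun y => complex.Re (f y)) x
     +i* 'D_(delta_mx 0 i) (fun y => complex.Im (f y)) x)%C.

(* Iterated partial derivatives are indexed by words s rather than by
   multi-indices; for smooth f the order of the letters is irrelevant. *)
Definition mpderiv (s : seq 'I_d) f : V -> C := foldr pderiv f s.

(* f is C^oo on an open set iff it is smooth_at every point of it: all iterated
   partial derivatives exist and are (totally) differentiable there.  The
   neighbourhood of x may depend on s. *)
Definition smooth_at (x : V) f : Prop :=
  forall s, \forall y \near x, cdifferentiable (mpderiv s f) y.

(* A function on Omega is encoded by its extension by 0 to R^d, so that equality
   of elements of C^oo(Omega) is Leibniz equality. *)
Definition smooth0 Omega : set (V -> C) :=
  [set f | (forall x, Omega x -> smooth_at x f) /\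
           (forall x, ~ Omega x -> f x = 0)].

Lemma near_eq_pderiv i f g (y : V) : (\forall z \near y, f z = g z) ->
  pderiv i f y = pderiv i g y.
Proof.
by move=> h; rewrite /pderiv; congr (_ +i* _)%C; apply: near_eq_derive;
  apply: filterS h => z ->.
Qed.

Lemma near_eq_mpderiv f g (x : V) : (\forall y \near x, f y = g y) ->
  forall s, \forall y \near x, mpderiv s f y = mpderiv s g y.
Proof.
move=> fg; elim=> //= i s /near_join IH.
by apply: filterS IH => y; apply: near_eq_pderiv.
Qed.

Lemma near_eq_differentiable (h k : V -> R) (x : V) :
  (\forall y \near x, h y = k y) -> differentiable h x -> differentiable k x.
Proof.
move=> hk dh.
have -> : k = h + (k - h) by apply/funext => y; rewrite !fctE addrC subrK.
apply: differentiableD => //; apply: near0_differentiable.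
by apply: filterS hk => y hky; rewrite !fctE hky subrr.
Qed.

Lemma near_eq_cdifferentiable f g (x : V) :
  (\forall y \near x, f y = g y) -> cdifferentiable f x -> cdifferentiable g x.
Proof.
move=> fg [df1 df2]; split; [move: df1|move: df2];
  by apply: near_eq_differentiable; apply: filterS fg => y ->.
Qed.

Lemma cdifferentiable_lin (a : C) f g (x : V) :
  cdifferentiable f x -> cdifferentiable g x -> cdifferentiable (a *: f + g) x.
Proof.
case: a => ar ai [f1 f2] [g1 g2]; split.
  rewrite (_ : (fun _ => _) = (ar *: (fun y => complex.Re (f y)))
     - (ai *: (fun y => complex.Im (f y))) + (fun y => complex.Re (g y))); last first.
    by apply/funext => y; rewrite !fctE /=; case: (f y) (g y) => [? ?] [? ?].
  exact: differentiableD (differentiableB (differentiableZ ar f1) (differentiableZ ai f2)) g1.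
rewrite (_ : (fun _ => _) = (ar *: (fun y => complex.Im (f y)))
   + (ai *: (fun y => complex.Re (f y))) + (fun y => complex.Im (g y))); last first.
  by apply/funext => y; rewrite !fctE /=; case: (f y) (g y) => [? ?] [? ?].
exact: differentiableD (differentiableD (differentiableZ ar f2) (differentiableZ ai f1)) g2.
Qed.

Lemma pderiv_lin i (a : C) f g (x : V) :
  cdifferentiable f x -> cdifferentiable g x ->
  pderiv i (a *: f + g) x = a * pderiv i f x + pderiv i g x.
Proof.
case: a => ar ai [f1 f2] [g1 g2].
rewrite /pderiv.
rewrite (_ : (fun _ => complex.Re _) = (ar \*: (fun y => complex.Re (f y)))
     - (ai \*: (fun y => complex.Im (f y))) + (fun y => complex.Re (g y))); last first.
    by apply/funext => y; rewrite !fctE /=; case: (f y) (g y) => [? ?] [? ?].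
rewrite (_ : (fun _ => complex.Im ((_ +i* _)%C *: _ + _)) = (ar \*: (fun y => complex.Im (f y)))
   + (ai \*: (fun y => complex.Re (f y))) + (fun y => complex.Im (g y))); last first.
  by apply/funext => y; rewrite !fctE /=; case: (f y) (g y) => [? ?] [? ?].
set v := delta_mx 0 i.
have F1 := derivableP (@diff_derivable _ _ _ _ _ v f1).
have F2 := derivableP (@diff_derivable _ _ _ _ _ v f2).
have G1 := derivableP (@diff_derivable _ _ _ _ _ v g1).
have G2 := derivableP (@diff_derivable _ _ _ _ _ v g2).
have H1 := is_deriveD (is_deriveB (is_deriveZ ar F1) (is_deriveZ ai F2)) G1.
have H2 := is_deriveD (is_deriveD (is_deriveZ ar F2) (is_deriveZ ai F1)) G2.
by rewrite (@derive_val _ _ _ _ _ _ _ H1) (@derive_val _ _ _ _ _ _ _ H2).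
Qed.

Lemma mpderiv_lin (a : C) f g (x : V) : smooth_at x f -> smooth_at x g ->
  forall s, \forall y \near x,
    mpderiv s (a *: f + g) y = (a *: mpderiv s f + mpderiv s g) y.
Proof.
move=> sf sg; elim => [|i s /near_join IH]; first by near=> y.
near=> y.
rewrite /= (@near_eq_pderiv _ _ (a *: mpderiv s f + mpderiv s g)); last by near: y.
rewrite pderiv_lin //; near: y; [exact: sf|exact: sg].
Unshelve. all: by end_near. Qed.

Lemma smooth_at_lin (a : C) f g (x : V) : smooth_at x f -> smooth_at x g ->
  smooth_at x (a *: f + g).
Proof.
move=> sf sg s; have /near_join h := mpderiv_lin a sf sg s.
near=> y; apply: (@near_eq_cdifferentiable (a *: mpderiv s f + mpderiv s g)).
  near: y; apply: filterS h => y; exact: filterS.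
apply: cdifferentiable_lin; near: y; [exact: sf|exact: sg].
Unshelve. all: by end_near. Qed.

Lemma smooth_at0 (x : V) : smooth_at x 0.
Proof.
have E s : mpderiv s 0 = 0.
  elim: s => //= i s ->; apply/funext => y; rewrite /pderiv /=.
  by rewrite [X in (X +i* _)%C]derive_cst [X in (_ +i* X)%C]derive_cst.
by move=> s; near=> y; rewrite E; split; apply: differentiable_cst.
Unshelve. all: by end_near. Qed.

Definition Cinf_pred Omega : {pred V -> C} := mem (smooth0 Omega).

Lemma Cinf_pred_submod Omega : submod_closed (Cinf_pred Omega).
Proof.
split=> [|a f g]; rewrite !inE.
  by split => // x _; exact: smooth_at0.
move=> [sf f0] [sg g0]; split=> x Ox; first exact: smooth_at_lin (sf x Ox) (sg x Ox).
by rewrite !fctE f0// g0// scaler0 addr0.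
Qed.

HB.instance Definition _ Omega := GRing.isSubmodClosed.Build C (V -> C)
  (Cinf_pred Omega) (Cinf_pred_submod Omega).

Record Cinf Omega := MkCinf {
  Cinf_fun :> V -> C;
  _ : Cinf_fun \in Cinf_pred Omega }.

HB.instance Definition _ Omega := [isSub of Cinf Omega for @Cinf_fun Omega].
HB.instance Definition _ Omega := [Choice of Cinf Omega by <:].
HB.instance Definition _ Omega :=
  [SubChoice_isSubLmodule of Cinf Omega by <:].

(* The Frechet topology of C^oo(Omega): uniform convergence of every iterated
   partial derivative on every compact subset of Omega. *)
Definition jet Omega (f : Cinf Omega) : prod_topology (fun _ : seq 'I_d =>
    {family [set K : set V | compact K /\ K `<=` Omega], V -> C^o}) :=
  fun s => mpderiv s f.

HB.instance Definition _ Omega :=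
  Uniform.copy (Cinf Omega) (initial_topology (@jet Omega)).

(* The element of C^oo(Omega) given by the values of h on Omega.  It is 0 if h is
   not smooth on Omega; see Cinf_ofE. *)
Definition Cinf_of Omega (h : V -> C) : Cinf Omega :=
  insubd 0 (patch (fun=> 0) Omega h).

Lemma near_eq_smooth_at f g (x : V) :
  (\forall y \near x, f y = g y) -> smooth_at x f -> smooth_at x g.
Proof.
move=> /near_eq_mpderiv fg sf s; have /near_join h := fg s.
near=> y; apply: (@near_eq_cdifferentiable (mpderiv s f)); near: y => //.
exact: sf.
Unshelve. all: by end_near. Qed.

Lemma Cinf_ofE Omega (h : V -> C) : open Omega ->
  (forall x, Omega x -> smooth_at x h) ->
  forall x, Omega x -> Cinf_of Omega h x = h x.
Proof.
move=> oO sh x Ox; rewrite /Cinf_of /=.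
have hin : patch (fun=> 0) Omega h \in Cinf_pred Omega.
  rewrite inE; split=> [y Oy|y Oy]; last by rewrite /patch memNset.
  apply: (near_eq_smooth_at _ (sh y Oy)).
  have : \forall z \near y, Omega z by exact: open_nbhs_nbhs.
  by apply: filterS => z Oz; rewrite /patch mem_set.
by rewrite (insubdK _ hin) /patch mem_set.
Qed.

Lemma Cinf_smooth Omega (f : Cinf Omega) x : Omega x -> smooth_at x f.
Proof. by case: f => f /=; rewrite inE => -[+ _]; apply. Qed.

Definition monomial (alpha : 'I_d -> nat) (x : V) : C :=
  (\prod_(i < d) (x 0 i) ^+ (alpha i))%:C%C.

Section monomial_smooth.

Inductive polyfun : (V -> R) -> Prop :=
| polyfun_cst (r : R) : polyfun (cst r)
| polyfun_coord (j : 'I_d) : polyfun (fun x => x 0 j)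
| polyfunD (p q : V -> R) : polyfun p -> polyfun q -> polyfun (p + q)
| polyfunM (p q : V -> R) : polyfun p -> polyfun q -> polyfun (p * q).

Let polyfun_diff p x : polyfun p -> differentiable p x.
Proof.
elim=> {p} [r|j|p q _ dp _ dq|p q _ dp _ dq].
- exact: differentiable_cst.
- exact: differentiable_coord.
- exact: differentiableD.
- exact: differentiableM.
Qed.

Let polyfun_derive p v : polyfun p -> polyfun ('D_v p).
Proof.
elim=> {p} [r|j|p q pp dp pq dq|p q pp dp pq dq].
- rewrite (_ : 'D_v _ = cst 0); first exact: polyfun_cst.
  by apply/funext => x; rewrite derive_cst.
- rewrite (_ : 'D_v _ = cst (v 0 j)); first exact: polyfun_cst.
  apply/funext => x; rewrite /derive; apply: cvg_lim => //.
  apply: cvg_near_cst; near=> t.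
  rewrite /= !mxE addrK /GRing.scale /= mulrA mulVf ?mul1r//.
  by near: t; exact: nbhs_dnbhs_neq.
- rewrite (_ : 'D_v _ = 'D_v p + 'D_v q); first exact: polyfunD.
  by apply/funext => x; rewrite deriveD //; exact/diff_derivable/polyfun_diff.
- rewrite (_ : 'D_v _ = p * 'D_v q + q * 'D_v p).
    by apply: polyfunD; apply: polyfunM.
  by apply/funext => x; rewrite deriveM //; exact/diff_derivable/polyfun_diff.
Unshelve. all: by end_near. Qed.

Let polyfun_smooth p x : polyfun p -> smooth_at x (fun y => (p y)%:C%C).
Proof.
move=> pp s.
have [q pq ->] : exists2 q, polyfun q &
    mpderiv s (fun y => (p y)%:C%C) = (fun y => (q y)%:C%C).
  elim: s => [|i s [q pq /= ->]]; first by exists p.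
  exists ('D_(delta_mx 0 i) q); first exact: polyfun_derive.
  apply/funext => y; rewrite /pderiv /=; congr (_ +i* _)%C.
  exact: (@derive_cst _ _ _ 0).
near=> y; split; first exact: polyfun_diff.
exact: differentiable_cst.
Unshelve. all: by end_near. Qed.

Lemma smooth_monomial alpha x : smooth_at x (monomial alpha).
Proof.
apply: polyfun_smooth.
rewrite (_ : (fun _ => _) = \prod_(i < d) (fun y : V => y 0 i ^+ alpha i)).
  elim/big_ind: _ => [|p q|i _]; [exact: polyfun_cst|exact: polyfunM|].
  elim: (alpha i) => [|n IH]; first exact: polyfun_cst.
  rewrite (_ : (fun _ => _) = (fun y : V => y 0 i) * (fun y : V => y 0 i ^+ n)).
    by apply: polyfunM => //; exact: polyfun_coord.
  by apply/funext => y; rewrite exprS.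
apply/funext => y.
by elim/big_ind2: _ => // f1 x1 f2 x2 -> ->.
Qed.

End monomial_smooth.

Definition hprod (x y : V) : V := \row_i (x 0 i * y 0 i).

Lemma hprod_diff x y : differentiable (hprod x) y.
Proof.
rewrite (_ : hprod x = \sum_(i < d) (fun y : V => y 0 i *: (x 0 i *: delta_mx 0 i : V))).
  apply: differentiable_sum => i.
  apply: differentiableZl; exact: differentiable_coord.
apply/funext => z; rewrite fct_sumE; apply/rowP => j.
rewrite !mxE summxE (bigD1 j) //= !mxE !eqxx mulr1 big1 ?addr0 1?mulrC//.
by move=> k kj; rewrite !mxE eq_sym (negbTE kj) andbF !mulr0.
Qed.

Lemma derive_hprod (W : normedModType R) (h : V -> W) x y i :
  differentiable h (hprod x y) ->
  'D_(delta_mx 0 i) (fun z => h (hprod x z)) y =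
  x 0 i *: 'D_(delta_mx 0 i) h (hprod x y).
Proof.
move=> dh; rewrite [in RHS]deriveE // -linearZ -[RHS]deriveE // /derive.
set g1 := fun t => t^-1 *: _; set g2 := fun t => t^-1 *: _.
suff -> : g1 = g2 by [].
apply/funext => t; rewrite /g1 /g2 /=.
congr (_ *: (h _ - _)); apply/rowP => j; rewrite !mxE mulrDr.
congr (_ + _); rewrite mulrCA; congr (_ * _).
by case: (eqVneq j i) => [->|_]; rewrite ?andbT ?andbF // !mulr0.
Qed.

Lemma smooth_hprod (f : Cinf setT) x y : smooth_at y (fun z => f (hprod x z)).
Proof.
have df t z : cdifferentiable (mpderiv t f) z.
  by have := Cinf_smooth f (I : setT z) t; exact: nbhs_singleton.
have dfh t z : cdifferentiable (fun z => mpderiv t f (hprod x z)) z.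
  have [d1 d2] := df t (hprod x z).
  by split; [apply: (differentiable_comp (hprod_diff x z) d1)|apply: (differentiable_comp (hprod_diff x z) d2)].
have d0 z : cdifferentiable 0 z by split; exact: differentiable_cst.
move=> s.
have [r ->] : exists r : R, mpderiv s (fun z => f (hprod x z)) =
    r%:C%C *: (fun z => mpderiv s f (hprod x z)) + 0.
  elim: s => [|i s [r /= ->]]; first by exists 1; rewrite scale1r addr0.
  exists (r * x 0 i); apply/funext => z; rewrite pderiv_lin //.
  have -> : pderiv i 0 z = 0.
    by rewrite /pderiv [X in (X +i* _)%C]derive_cst [X in (_ +i* X)%C]derive_cst.
  rewrite !fctE !addr0 rmorphM /= -[RHS]/(_ * _) -mulrA; congr (_ * _).
  have [d1 d2] := df s (hprod x z).
  rewrite /pderiv (derive_hprod _ d1) (derive_hprod _ d2) /=.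
  by rewrite /GRing.scale /=; simpc.
by near=> z; exact: cdifferentiable_lin.
Unshelve. all: by end_near. Qed.

End Smooth.

Section Hadamard.
Variables (R : realType) (d : nat).
Local Notation V := 'rV[R]_d.
Local Notation C := R[i].
Implicit Types (Omega A U : set V).

(* von Neumann boundedness: every neighbourhood of 0 absorbs B. *)
Definition tvs_bounded (K : numFieldType) (E : preTopologicalLmodType K)
    (B : set E) : Prop :=
  forall W : set E, nbhs 0 W ->
    exists2 r : K, 0 < r &
      forall c : K, r <= `|c| -> B `<=` [set c *: w | w in W].

Definition Lcont Omega : set (Cinf Omega -> Cinf Omega) :=
  [set M | linear M /\ continuous M].
Arguments Lcont Omega _ : clear implicits.

(* All maps of C^oo(Omega) into itself with the topology of uniform convergence
   on bounded sets; L_b(C^oo(Omega)) is its subspace Lcont Omega. *)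
Definition Lb_ambient Omega :=
  {family (@tvs_bounded C (Cinf Omega)), Cinf Omega -> Cinf Omega}.

Definition closed_in_Lb Omega (A : set (Cinf Omega -> Cinf Omega)) : Prop :=
  closed (A : set (subspace (Lcont Omega : set (Lb_ambient Omega)))).

Definition subalgebra_of_L Omega (A : set (Cinf Omega -> Cinf Omega)) : Prop :=
  [/\ A `<=` Lcont Omega,
      A idfun,
      (forall (a : C) M N, A M -> A N -> A (a *: M + N)) &
      (forall M N, A M -> A N -> A (M \o N))].

Definition Hadamard Omega : set (Cinf Omega -> Cinf Omega) :=
  [set M | Lcont Omega M /\
    forall alpha : 'I_d -> nat, exists m : C,
      M (Cinf_of Omega (monomial alpha)) = m *: Cinf_of Omega (monomial alpha)].
Arguments Hadamard Omega _ : clear implicits.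

Definition dilation_set Omega : set V :=
  [set eta | forall x, Omega x -> Omega (hprod eta x)].

(* A compactly supported distribution on R^d is a continuous linear form on
   C^oo(R^d) = Cinf setT; dsupp is its support in the sense of distributions. *)
Local Notation form := (Cinf [set: V] -> C^o).
Implicit Types T S : form.

Definition fsupp (f : V -> C) : set V := closure [set x | f x != 0].

Definition vanishes_on T U : Prop :=
  forall phi : Cinf [set: V], compact (fsupp phi) -> fsupp phi `<=` U ->
    T phi = 0.

Definition dsupp T : set V :=
  ~` \bigcup_(U in [set U | open U /\ vanishes_on T U]) U.

Definition Edist A : set form :=
  [set T : form | [/\ linear T, continuous T, compact (dsupp T) & dsupp T `<=` A]].

(* g is an element of C^oo(R^d) equal to h on a neighbourhood of supp T. *)
Definition germ_ext T (h : V -> C) : set (Cinf [set: V]) :=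
  [set g | set_nbhs (dsupp T) [set y | g y = h y]].

(* T_y h(y) for h smooth on a neighbourhood of supp T only: the common value
   T g for all g in germ_ext T h. *)
Definition pairing T (h : V -> C) : C := xget 0 [set T g | g in germ_ext T h].

Definition star T S : form := fun f =>
  T (Cinf_of setT (fun x => S (Cinf_of setT (fun y => f (hprod x y))))).

Definition Mop Omega T : Cinf Omega -> Cinf Omega := fun f =>
  Cinf_of Omega (fun x => pairing T (fun y => f (hprod x y))).
Arguments Mop Omega T _ : clear implicits.

(* star and Mop take junk values when x |-> S_y f(xy) or x |-> T_y f(xy) is not
   smooth; the next two predicates say that this does not occur.  The inner
   function y |-> f(xy) of star is smooth by smooth_hprod. *)
Definition star_well_defined T S : Prop :=
  forall f : Cinf [set: V], exists2 g : Cinf [set: V],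
    (forall x, g x = S (Cinf_of setT (fun y => f (hprod x y)))) &
    star T S f = T g.

Definition Mop_well_defined Omega T : Prop :=
  forall (f : Cinf Omega) x, Omega x ->
    germ_ext T (fun y => f (hprod x y)) !=set0 /\
    forall g, germ_ext T (fun y => f (hprod x y)) g -> Mop Omega T f x = T g.

End Hadamard.

Arguments Lcont {R d} Omega _.
Arguments Hadamard {R d} Omega _.
Arguments Mop {R d} Omega T _.

(* Main.v *)
Require Import Defs.
From HB Require Import structures.
From mathcomp Require Import all_boot all_order all_algebra.
From mathcomp Require Import all_classical all_reals all_analysis.
From mathcomp Require Import complex.
From mathcomp Require Import ring lra.

Set Implicit Arguments.
Unset Strict Implicit.
Unset Printing Implicit Defensive.

Import Order.TTheory GRing.Theory Num.Theory.
Import numFieldNormedType.Exports.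

Local Open Scope classical_set_scope.
Local Open Scope ring_scope.

(** The Frechet topology enters through one criterion: u_i tends to f iff every
    derivative of u_i converges continuously, that is, along nbhs x times the
    filter of i (cinf_cvgP).  Continuity of operators and forms becomes a matter
    of limits of finitely many derivatives at a point.  Functions vanishing near
    large compact sets tend to 0; hence every continuous operator and every
    continuous form has a compact carrier (operator_carrier, form_carrier).
    With smooth cutoffs (cutoff) it follows that T f depends only on the germ of
    f along supp T (form_vanish), so that T_y f(xy) has a meaning when f is
    given on Omega only.

    From distributions to operators.  Let T be supported in V(Omega).  For x in
    Omega, x supp T is a compact subset of Omega.  The remainder of the Taylor
    expansion in x of f(xy) is small together with its derivatives in y, so one
    may differentiate under T (form_slice_diff): x |-> T_y f(xy) is smooth, and
    its derivatives depend continuously on f (Mop_continuous).  Clearly M_T maps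
    x^alpha to T(y^alpha) x^alpha (Mop_monomial).  On R^d the product of T and S
    is T composed with M_S; its support lies in supp T supp S (dsupp_star), and
    x(yz) = (xy)z gives multiplicativity of T |-> M_T (Mop_star).

    Injectivity.  Operators with the same eigenvalues come from distributions
    that agree on monomials, and polynomials are dense in the smooth functions
    on R^d (polynomials_dense).  For the density, partial Bernstein operators
    make a function polynomial in one variable after the other; their
    derivatives converge because they are Bernstein polynomials of difference
    quotients (mpderiv_bernstein, bernstein_cvg).

    Surjectivity.  Let M be a Hadamard operator.  At a point x of Omega without
    zero coordinate put T f = M(f(./x))(x).  Then T(y^alpha) is the eigenvalue
    of x^alpha, so by density T does not depend on x (symbol_indep).  Near x0
    in Omega the operator M has one compact carrier K inside Omega; hence
    x supp T lies in K for x near x0, and in the limit x0 supp T lies in K.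
    So T is supported in V(Omega) (symbol_Edist), and M_T = M holds first at
    points without zero coordinate and then everywhere (Mop_symbol).

    Closedness.  The eigenvector equations only involve the values of M p, p a
    monomial, at points of Omega, and these are continuous on L_b because
    singletons are bounded (Hadamard_closed). *)

(** * Limits of complex-valued functions *)

Section ComplexLimits.
Variables (R : realType) (I : Type) (F : set_system I).
Context {FF : Filter F}.
Implicit Types (u v : I -> R[i]) (l : R[i]).

Lemma normc_le_ReIm l : complex.Re `|l| <= `|complex.Re l| + `|complex.Im l|.
Proof.
case: l => a b; rewrite normc_def /=.
rewrite -[leRHS]ger0_norm ?addr_ge0// -sqrtr_sqr ler_sqrt ?sqr_ge0//.
rewrite sqrrD !real_normK ?num_real// lerD2r lerDl.
by rewrite mulrn_wge0 // mulr_ge0.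
Qed.

Lemma ReIm_le_normc l : `|complex.Re l| <= complex.Re `|l| /\ `|complex.Im l| <= complex.Re `|l|.
Proof.
case: l => a b; rewrite normc_def /=; split; rewrite -sqrtr_sqr ler_sqrt ?addr_ge0 ?sqr_ge0//.
  by rewrite lerDl sqr_ge0.
by rewrite lerDr sqr_ge0.
Qed.

Lemma normcR l : `|l| = (complex.Re `|l|)%:C%C.
Proof. by rewrite normc_def. Qed.

Lemma cvgc_distP u l : (u : I -> R[i]^o) @ F --> (l : R[i]^o) <->
  forall e : R, 0 < e -> \forall i \near F, complex.Re `|l - u i| < e.
Proof.
split=> [/cvgrPdist_lt ul e e0|ul].
  have := ul e%:C%C; rewrite ltcR => /(_ e0).
  by apply: filterS => i; rewrite normcR ltcR.
apply/cvgrPdist_lt => -[e e'].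
rewrite ltcE /= => /andP[/eqP -> e0]; rewrite -/(real_complex R e).
by apply: filterS (ul e e0) => i; rewrite normcR ltcR.
Qed.

Lemma cvg_complex u l :
  (u : I -> R[i]^o) @ F --> (l : R[i]^o) <->
  ((fun i => complex.Re (u i)) @ F --> complex.Re l) /\
  ((fun i => complex.Im (u i)) @ F --> complex.Im l).
Proof.
split=> [ul|[ul1 ul2]].
  split; apply/cvgrPdist_lt => e e0.
    move/cvgrPdist_lt: ul => /(_ e%:C%C).
    rewrite ltcR => /(_ e0); apply: filterS => i.
    rewrite normcR ltcR; apply: le_lt_trans.
    have [+ _] := ReIm_le_normc (l - u i).
    by case: (l) (u i) => [? ?] [? ?].
  move/cvgrPdist_lt: ul => /(_ e%:C%C).
  rewrite ltcR => /(_ e0); apply: filterS => i.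
  rewrite normcR ltcR; apply: le_lt_trans.
  have [_ +] := ReIm_le_normc (l - u i).
  by case: (l) (u i) => [? ?] [? ?].
apply/cvgrPdist_lt => -[e e'].
rewrite ltcE /= => /andP[/eqP -> e0]; rewrite -/(real_complex R e).
have e20 : 0 < e / 2 by apply: divr_gt0 => //; exact: ltr0Sn.
near=> i; rewrite normcR ltcR; apply: le_lt_trans (normc_le_ReIm _) _.
rewrite [ltRHS]splitr; apply: ltrD.
  have : `|complex.Re l - complex.Re (u i)| < e / 2 by near: i; apply: cvgr_dist_lt.
  by case: (l) (u i) => [? ?] [? ?].
have : `|complex.Im l - complex.Im (u i)| < e / 2 by near: i; apply: cvgr_dist_lt.
by case: (l) (u i) => [? ?] [? ?].
Unshelve. all: by end_near. Qed.

Lemma cvgcM u v (l m : R[i]) : (u : I -> R[i]^o) @ F --> (l : R[i]^o) ->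
  (v : I -> R[i]^o) @ F --> (m : R[i]^o) ->
  ((fun i => u i * v i) : I -> R[i]^o) @ F --> (l * m : R[i]^o).
Proof.
move=> /cvg_complex[u1 u2] /cvg_complex[v1 v2]; apply/cvg_complex; split.
  rewrite (_ : (fun _ => _) = (fun i => complex.Re (u i) * complex.Re (v i)
     - complex.Im (u i) * complex.Im (v i))); last first.
    by apply/funext => i; case: (u i) (v i) => [? ?] [? ?].
  rewrite (_ : complex.Re _ = complex.Re l * complex.Re m - complex.Im l * complex.Im m).
    by apply: cvgB; apply: cvgM.
  by case: (l) (m) => [? ?] [? ?].
rewrite (_ : (fun _ => _) = (fun i => complex.Re (u i) * complex.Im (v i)
   + complex.Im (u i) * complex.Re (v i))); last first.
  by apply/funext => i; case: (u i) (v i) => [? ?] [? ?].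
rewrite (_ : complex.Im _ = complex.Re l * complex.Im m + complex.Im l * complex.Re m).
  by apply: cvgD; apply: cvgM.
by case: (l) (m) => [? ?] [? ?].
Qed.

Lemma cvgcD u v (l m : R[i]) : (u : I -> R[i]^o) @ F --> (l : R[i]^o) ->
  (v : I -> R[i]^o) @ F --> (m : R[i]^o) ->
  ((fun i => u i + v i) : I -> R[i]^o) @ F --> (l + m : R[i]^o).
Proof. exact: (@cvgD R[i] R[i]^o). Qed.

Lemma cvgc_sum (J : Type) (r : seq J) (P : pred J) (u : J -> I -> R[i]) (l : J -> R[i]) :
  (forall j, (u j : I -> R[i]^o) @ F --> (l j : R[i]^o)) ->
  ((fun i => \sum_(j <- r | P j) u j i) : I -> R[i]^o) @ F -->
    (\sum_(j <- r | P j) l j : R[i]^o).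
Proof.
move=> ul; elim: r => [|j r IH].
  rewrite big_nil; under eq_fun do rewrite big_nil.
  exact: cvg_cst.
rewrite big_cons; under eq_fun do rewrite big_cons.
case: (P j); last exact: IH.
exact: (cvgcD (ul j) IH).
Qed.

End ComplexLimits.

(** * Calculus of smooth complex-valued functions *)

Section SmoothCalculus.
Variables (R : realType) (d : nat).
Local Notation V := 'rV[R]_d.
Local Notation C := R[i].
Implicit Types (f g : V -> C) (U : set V).

Definition smooth_on U f := forall s x, U x -> cdifferentiable (mpderiv s f) x.

Lemma smooth_onP U f : open U ->
  smooth_on U f <-> (forall x, U x -> smooth_at x f).
Proof.
move=> oU; split=> [sf x Ux s|sf s x Ux]; last exact: nbhs_singleton (sf x Ux s).
have : \forall y \near x, U y by exact: open_nbhs_nbhs.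
by apply: filterS => y Uy; exact: sf.
Qed.

Lemma open_near U (P : V -> Prop) x : open U -> U x -> (forall y, U y -> P y) ->
  \forall y \near x, P y.
Proof.
move=> oU Ux UP; have : \forall y \near x, U y by exact: open_nbhs_nbhs.
exact: filterS.
Qed.

Lemma eq_on_mpderiv U f g : open U -> (forall x, U x -> f x = g x) ->
  forall s x, U x -> mpderiv s f x = mpderiv s g x.
Proof.
move=> oU fg s x Ux.
exact: nbhs_singleton (near_eq_mpderiv (open_near oU Ux fg) s).
Qed.

Lemma eq_on_cdiff U f g x : open U -> U x -> (forall x, U x -> f x = g x) ->
  cdifferentiable f x -> cdifferentiable g x.
Proof. by move=> oU Ux fg; exact: near_eq_cdifferentiable (open_near oU Ux fg). Qed.

Lemma eq_smooth_on U f g : open U -> (forall x, U x -> f x = g x) ->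
  smooth_on U f -> smooth_on U g.
Proof.
move=> oU fg sf s x Ux; apply: (eq_on_cdiff oU Ux); last exact: sf.
exact: eq_on_mpderiv.
Qed.

Lemma smooth_onS U W f : W `<=` U -> smooth_on U f -> smooth_on W f.
Proof. by move=> WU sf s x /WU; exact: sf. Qed.

Lemma mpderiv_cat s t f : mpderiv (s ++ t) f = mpderiv s (mpderiv t f).
Proof. by rewrite /mpderiv foldr_cat. Qed.

Lemma smooth_on_mpderiv U t f : smooth_on U f -> smooth_on U (mpderiv t f).
Proof. by move=> sf s x Ux; rewrite -mpderiv_cat; exact: sf. Qed.

(** Iterated derivatives of products and composites have no formula worth
    writing; to prove smoothness it is enough to find a class of differentiable
    functions that is stable under partial derivatives. *)
Lemma smooth_on_ind U (Q : (V -> C) -> Prop) : open U ->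
  (forall f, Q f -> forall x, U x -> cdifferentiable f x) ->
  (forall f i, Q f -> exists2 g, Q g & forall x, U x -> pderiv i f x = g x) ->
  forall f, Q f -> smooth_on U f.
Proof.
move=> oU Qd QD f Qf s x Ux.
have [g Qg fg] : exists2 g, Q g & forall x, U x -> mpderiv s f x = g x.
  elim: s => [|i s [g Qg fg]]; first by exists f.
  have [h Qh gh] := QD g i Qg; exists h => // y Uy.
  rewrite /= -gh//; apply: near_eq_pderiv.
  exact: (open_near oU Uy).
apply: (eq_on_cdiff oU Ux _ (Qd _ Qg _ Ux)) => y Uy.
by rewrite fg.
Qed.

Lemma cdiff_cst (a : C) x : cdifferentiable (fun _ : V => a) x.
Proof. by split; exact: differentiable_cst. Qed.

Lemma pderiv_cst i (a : C) x : pderiv i (fun _ : V => a) x = 0.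
Proof. by rewrite /pderiv !derive_cst. Qed.

Lemma mpderiv_cst s (a : C) x : s != [::] -> mpderiv s (fun _ : V => a) x = 0.
Proof.
case: s => // i s _ /=; have [b ->] : exists b, mpderiv s (fun _ : V => a) = fun=> b.
  elim: s => [|j s [b /= ->]]; first by exists a.
  by exists 0; apply/funext => y; rewrite pderiv_cst.
by rewrite pderiv_cst.
Qed.

Lemma smooth_cst U (a : C) : smooth_on U (fun=> a).
Proof.
move=> s x _; have [b ->] : exists b, mpderiv s (fun _ : V => a) = fun=> b.
  elim: s => [|j s [b /= ->]]; first by exists a.
  by exists 0; apply/funext => y; rewrite pderiv_cst.
exact: cdiff_cst.
Qed.

Lemma cdiffM f g x : cdifferentiable f x -> cdifferentiable g x ->
  cdifferentiable (fun y => f y * g y) x.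
Proof.
move=> [f1 f2] [g1 g2]; split.
  rewrite (_ : (fun _ => _) = (fun y => complex.Re (f y)) * (fun y => complex.Re (g y))
     - (fun y => complex.Im (f y)) * (fun y => complex.Im (g y))); last first.
    by apply/funext => y; rewrite !fctE /=; case: (f y) (g y) => [? ?] [? ?].
  by apply: differentiableB; apply: differentiableM.
rewrite (_ : (fun _ => _) = (fun y => complex.Re (f y)) * (fun y => complex.Im (g y))
     + (fun y => complex.Im (f y)) * (fun y => complex.Re (g y))); last first.
  by apply/funext => y; rewrite !fctE /=; case: (f y) (g y) => [? ?] [? ?].
by apply: differentiableD; apply: differentiableM.
Qed.

Lemma cdiffD f g x : cdifferentiable f x -> cdifferentiable g x ->
  cdifferentiable (fun y => f y + g y) x.
Proof.
move=> df dg; have -> : (fun y => f y + g y) = 1 *: f + g.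
  by apply/funext => y; rewrite !fctE scale1r.
exact: cdifferentiable_lin.
Qed.

Lemma pderivM i f g x : cdifferentiable f x -> cdifferentiable g x ->
  pderiv i (fun y => f y * g y) x = pderiv i f x * g x + f x * pderiv i g x.
Proof.
move=> [f1 f2] [g1 g2]; rewrite /pderiv.
rewrite (_ : (fun _ => complex.Re _) = (fun y => complex.Re (f y)) * (fun y => complex.Re (g y))
     - (fun y => complex.Im (f y)) * (fun y => complex.Im (g y))); last first.
  by apply/funext => y; rewrite !fctE /=; case: (f y) (g y) => [? ?] [? ?].
rewrite (_ : (fun _ => complex.Im (_ * _)) = (fun y => complex.Re (f y)) * (fun y => complex.Im (g y))
     + (fun y => complex.Im (f y)) * (fun y => complex.Re (g y))); last first.
  by apply/funext => y; rewrite !fctE /=; case: (f y) (g y) => [? ?] [? ?].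
set v := delta_mx 0 i.
have F1 := derivableP (@diff_derivable _ _ _ _ _ v f1).
have F2 := derivableP (@diff_derivable _ _ _ _ _ v f2).
have G1 := derivableP (@diff_derivable _ _ _ _ _ v g1).
have G2 := derivableP (@diff_derivable _ _ _ _ _ v g2).
have H1 := is_deriveB (is_deriveM F1 G1) (is_deriveM F2 G2).
have H2 := is_deriveD (is_deriveM F1 G2) (is_deriveM F2 G1).
rewrite (@derive_val _ _ _ _ _ _ _ H1) (@derive_val _ _ _ _ _ _ _ H2).
case: (f x) (g x) => [a b] [a' b'] /=.
apply/eqP; rewrite eq_complex /= /GRing.scale /=.
by apply/andP; split; apply/eqP; ring.
Qed.

Lemma pderivD i f g x : cdifferentiable f x -> cdifferentiable g x ->
  pderiv i (fun y => f y + g y) x = pderiv i f x + pderiv i g x.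
Proof.
move=> df dg; have -> : (fun y => f y + g y) = 1 *: f + g.
  by apply/funext => y; rewrite !fctE scale1r.
by rewrite pderiv_lin// mul1r.
Qed.

Lemma pderivZ i (a : C) f x : cdifferentiable f x ->
  pderiv i (fun y => a * f y) x = a * pderiv i f x.
Proof.
by move=> df; rewrite pderivM ?pderiv_cst ?mul0r ?add0r//; exact: cdiff_cst.
Qed.

Lemma smooth_onM U f g : open U -> smooth_on U f -> smooth_on U g ->
  smooth_on U (fun y => f y * g y).
Proof.
move=> oU sf sg.
(* The stable class: finite sums of products of smooth functions.  Functions
   have no decidable equality, hence List.In. *)
pose Q h := exists r : seq ((V -> C) * (V -> C)),
  (forall p, List.In p r -> smooth_on U p.1 /\ smooth_on U p.2) /\
  h = fun y => \sum_(p <- r) p.1 y * p.2 y.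
have Qd r x : (forall p, List.In p r -> smooth_on U p.1 /\ smooth_on U p.2) ->
    U x -> cdifferentiable (fun y => \sum_(p <- r) p.1 y * p.2 y) x.
  move=> + Ux; elim: r => [|p r IH] rs.
    by under eq_fun do rewrite big_nil; exact: cdiff_cst.
  under eq_fun do rewrite big_cons.
  apply: cdiffD; last by apply: IH => q qr; apply: rs; right.
  have [s1 s2] := rs p (or_introl erefl).
  by apply: cdiffM; [exact: (s1 [::])|exact: (s2 [::])].
apply: (@smooth_on_ind U Q) => //.
- by move=> _ [r [rs ->]] x Ux; exact: Qd.
- move=> _ i [r [rs ->]].
  exists (fun y => \sum_(p <- flatten [seq [:: (pderiv i p.1, p.2); (p.1, pderiv i p.2)] | p <- r]) p.1 y * p.2 y).
    exists (flatten [seq [:: (pderiv i p.1, p.2); (p.1, pderiv i p.2)] | p <- r]); split => // p.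
    elim: r rs => //= q r IH rs.
    have [s1 s2] := rs q (or_introl erefl).
    case=> [<-|[<-|]] /=.
    + by split => //; exact: (smooth_on_mpderiv [:: i] s1).
    + by split => //; exact: (smooth_on_mpderiv [:: i] s2).
    + by apply: IH => p' pr; apply: rs; right.
  move=> x Ux; elim: r rs => [|p r IH] rs.
    under eq_fun do rewrite big_nil.
    by rewrite pderiv_cst big_nil.
  under eq_fun do rewrite big_cons.
  have rs' q : List.In q r -> smooth_on U q.1 /\ smooth_on U q.2.
    by move=> qr; apply: rs; right.
  have [s1 s2] := rs p (or_introl erefl).
  have d1 := s1 [::] x Ux; have d2 := s2 [::] x Ux.
  rewrite pderivD; [|exact: cdiffM|exact: Qd].
  by rewrite /= !big_cons /= IH// pderivM// addrA.
- exists [:: (f, g)]; split => [p [<-|[]]//|].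
  by apply/funext => y; rewrite big_seq1.
Qed.

Lemma smooth_onD U f g : open U -> smooth_on U f -> smooth_on U g ->
  smooth_on U (fun y => f y + g y).
Proof.
move=> oU /(smooth_onP _ oU) sf /(smooth_onP _ oU) sg; apply/smooth_onP => // x Ux.
have -> : (fun y => f y + g y) = 1 *: f + g.
  by apply/funext => y; rewrite !fctE scale1r.
exact: smooth_at_lin (sf x Ux) (sg x Ux).
Qed.

Lemma smooth_onZ U (a : C) f : open U -> smooth_on U f ->
  smooth_on U (fun y => a * f y).
Proof. by move=> oU sf; apply: smooth_onM => //; exact: smooth_cst. Qed.

Lemma smooth_on_sum U (I : Type) (r : seq I) (P : pred I) (F : I -> V -> C) :
  open U -> (forall i, P i -> smooth_on U (F i)) ->
  smooth_on U (fun y => \sum_(i <- r | P i) F i y).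
Proof.
move=> oU sF; elim: r => [|j r IH].
  by under eq_fun do rewrite big_nil; exact: smooth_cst.
under eq_fun do rewrite big_cons.
by case Pj: (P j) => //; apply: smooth_onD => //; exact: sF.
Qed.

Lemma mpderivD U f g s x : open U -> smooth_on U f -> smooth_on U g -> U x ->
  mpderiv s (fun y => f y + g y) x = mpderiv s f x + mpderiv s g x.
Proof.
move=> oU sf sg; elim: s x => //= i s IH x Ux.
rewrite -pderivD; [|exact: sf|exact: sg].
by apply: near_eq_pderiv; exact: (open_near oU Ux).
Qed.

Lemma mpderivZ U a f s x : open U -> smooth_on U f -> U x ->
  mpderiv s (fun y => a * f y) x = a * mpderiv s f x.
Proof.
move=> oU sf; elim: s x => //= i s IH x Ux.
rewrite -pderivZ; last exact: sf.
by apply: near_eq_pderiv; exact: (open_near oU Ux).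
Qed.

Lemma mpderiv_sum U (I : Type) (r : seq I) (P : pred I) (F : I -> V -> C) s x :
  open U -> (forall i, P i -> smooth_on U (F i)) -> U x ->
  mpderiv s (fun y => \sum_(i <- r | P i) F i y) x =
  \sum_(i <- r | P i) mpderiv s (F i) x.
Proof.
move=> oU sF Ux; elim: r => [|j r IH].
  under eq_fun do rewrite big_nil; rewrite big_nil.
  case: s => [//|i s]; exact: mpderiv_cst.
under eq_fun do rewrite big_cons.
rewrite big_cons; case Pj: (P j) => //; rewrite -IH; apply: mpderivD Ux => //.
  exact: sF.
exact: smooth_on_sum.
Qed.

(** All ways of sending each letter of a word to one of two subwords: the index
    set of the Leibniz rule for words. *)
Fixpoint splits (s : seq 'I_d) : seq (seq 'I_d * seq 'I_d) :=
  if s is i :: s' then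
    [seq (i :: p.1, p.2) | p <- splits s'] ++ [seq (p.1, i :: p.2) | p <- splits s']
  else [:: ([::], [::])].

Lemma mpderivM U f g s x : open U -> smooth_on U f -> smooth_on U g -> U x ->
  mpderiv s (fun y => f y * g y) x =
  \sum_(p <- splits s) mpderiv p.1 f x * mpderiv p.2 g x.
Proof.
move=> oU sf sg; elim: s x => [|i s IH] x Ux /=; first by rewrite big_seq1.
rewrite (@near_eq_pderiv _ _ _ _
  (fun x => \sum_(p <- splits s) mpderiv p.1 f x * mpderiv p.2 g x)); last first.
  exact: (open_near oU Ux).
rewrite big_cat !big_map /= -big_split /=.
rewrite -[LHS]/(mpderiv [:: i] _ x) (mpderiv_sum _ _ oU) //.
  by apply: eq_bigr => p _; rewrite /= pderivM//; [exact: sf|exact: sg].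
by move=> p _; apply: smooth_onM => //; exact: smooth_on_mpderiv.
Qed.

Lemma cdiff_continuous f x : cdifferentiable f x ->
  (f y : R[i]^o) @[y --> x] --> (f x : R[i]^o).
Proof.
move=> [/differentiable_continuous d1 /differentiable_continuous d2].
apply/(@cvg_complex _ _ (nbhs x) _ f (f x)); split; [exact: d1|exact: d2].
Qed.

Lemma smooth_coord U i : open U -> smooth_on U (fun x : V => (x 0 i)%:C%C).
Proof.
move=> oU; apply/smooth_onP => // x Ux.
have -> : (fun x : V => (x 0 i)%:C%C) = monomial (fun j => (j == i) : nat).
  apply/funext => y; rewrite /monomial (bigD1 i)//= eqxx expr1.
  by rewrite big1 ?mulr1// => j ji; rewrite (negbTE ji) expr0.
exact: smooth_monomial.
Qed.

Lemma pderiv_coord i j x :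
  pderiv i (fun x : V => (x 0 j)%:C%C) x = ((i == j)%:R)%:C%C.
Proof.
rewrite /pderiv /= derive_cst; congr (_ +i* _)%C.
rewrite /derive; apply: cvg_lim => //.
apply: cvg_near_cst; near=> t.
rewrite /= !mxE addrK /GRing.scale /= eq_sym; case: eqP => _.
  by rewrite mulr1 mulVf //; near: t; exact: nbhs_dnbhs_neq.
by rewrite !mulr0.
Unshelve. all: by end_near. Qed.

End SmoothCalculus.

(** * Convergence of smooth functions *)

Section CinfTopology.
Variables (R : realType) (d : nat) (Omega : set 'rV[R]_d).
Local Notation V := 'rV[R]_d.
Local Notation C := R[i].
Implicit Types (f g : Cinf Omega).

(** The initial, product and compact-convergence layers of the topology,
    unfolded once and for all. *)
Lemma cinf_cvg_unif (I : Type) (F : set_system I) {FF : Filter F}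
    (u : I -> Cinf Omega) f :
  u @ F --> f <->
  forall s (K : set V), compact K -> K `<=` Omega -> forall e : R, 0 < e ->
    \forall i \near F, forall x, K x ->
      complex.Re `|mpderiv s f x - mpderiv s (u i) x| < e.
Proof.
split=> [uf s K cK KO e e0|uf].
  pose E : set (C^o * C^o) := [set p | ball p.1 e%:C%C p.2].
  have entE : entourage E by exists e%:C%C => //=; rewrite ltcR.
  have n1 : nbhs (jet f s) [set g : {family [set K : set V | compact K /\ K `<=` Omega], V -> C^o} |
      forall y, K y -> E (jet f s y, g y)].
    by apply: fam_nbhs.
  have n2 := @proj_continuous _ (fun _ : seq 'I_d =>
    {family [set K : set V | compact K /\ K `<=` Omega], V -> C^o}) s (jet f) _ n1.
  have n3 := @initial_continuous _ _ (@jet R d Omega) f _ n2.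
  apply: (@filterS _ F FF _ _ _ (uf _ n3)) => i /= h x Kx.
  have := h x Kx; rewrite /E /= -ball_normE /= /ball_ /= /proj /jet.
  by rewrite normcR ltcR.
move=> A /= [_ [[B Bop <-] Bfs sBfA]].
have jetcv : (fun i => jet (u i)) @ F --> jet f.
  apply/cvg_sup => s U /= [_ [[W oW <-] Wfs] sub].
  have nW : nbhs (jet f s) W by exact: open_nbhs_nbhs.
  have cvs : (fun i => jet (u i) s) @ F --> jet f s.
    apply/fam_cvgP => K [cK KO] P /uniform_nbhs[E [/= entE EP]].
    have /= [[e e'] /=] : exists2 e : C, 0 < e & [set p : C^o * C^o | ball p.1 e p.2] `<=` E.
      by case: entE => e /= e0 h; exists e.
    rewrite ltcE /= => /andP[/eqP -> e0] eE.
    near=> i; apply: EP => x Kx; apply: eE => /=.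
    rewrite -ball_normE /= /ball_ /= /jet normcR ltcR.
    move: x Kx; near: i; exact: uf.
  by apply: (@filterS _ F FF _ _ _ (cvs _ nW)) => i; exact: sub.
have nB : nbhs (jet f) B by exact: open_nbhs_nbhs.
by apply: (@filterS _ F FF _ _ _ (jetcv _ nB)) => i; exact: sBfA.
Unshelve. all: by end_near. Qed.

Lemma compact_closed_ball a (r : R) : 0 < r -> compact [set x : V | `|x - a| <= r].
Proof.
move=> r0; have -> : [set x : V | `|x - a| <= r] = closed_ball a r.
  by rewrite closed_ballE//; apply/seteqP; split => x /=; rewrite distrC.
apply: bounded_closed_compact; last exact: closed_ball_closed.
exists (`|a| + r); split; first exact: num_real.
move=> M MM y; rewrite closed_ballE//= => xy.
apply/ltW/(le_lt_trans _ MM).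
by rewrite -[y](subrK a) addrC (le_trans (ler_normD _ _))// lerD2l distrC.
Qed.

Lemma compact_nbhs (U : set V) x : open U -> U x ->
  exists K : set V, [/\ compact K, nbhs x K & K `<=` U].
Proof.
move=> oU Ux; have : nbhs x U by exact: open_nbhs_nbhs.
move=> /nbhs_closedballP[e eU]; have e0 : 0 < e%:num by [].
have E : closed_ball x e%:num = [set y | `|y - x| <= e%:num].
  by rewrite closed_ballE//; apply/seteqP; split => y /=; rewrite distrC.
exists (closed_ball x e%:num); split => //; first by rewrite E; exact: compact_closed_ball.
by apply/nbhs_closedballP; exists e.
Qed.

Hypothesis oO : open Omega.

Lemma smooth_Cinf f : smooth_on Omega f.
Proof. by apply/smooth_onP => // x Ox; exact: Cinf_smooth. Qed.

(** Convergence in the Frechet space is continuous convergence of every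
    derivative: compactness is absorbed into a limit along nbhs x times F. *)
Lemma cinf_cvgP (I : Type) (F : set_system I) {FF : Filter F}
    (u : I -> Cinf Omega) f :
  u @ F --> f <->
  forall s x, Omega x ->
    (fun p : V * I => mpderiv s (u p.2) p.1 : R[i]^o) @ filter_prod (nbhs x) F -->
      (mpderiv s f x : R[i]^o).
Proof.
split=> [/cinf_cvg_unif uf s x Ox|uf].
  have [K [cK nK KO]] := compact_nbhs oO Ox.
  rewrite (_ : (fun p => _) = fun p : V * I =>
    (mpderiv s (u p.2) p.1 - mpderiv s f p.1) + mpderiv s f p.1); last first.
    by apply/funext => p; rewrite subrK.
  rewrite -[X in _ --> X]add0r; apply: cvgcD.
    apply/cvgc_distP => e e0.
    exists (K, [set i | forall x, K x -> complex.Re `|mpderiv s f x - mpderiv s (u i) x| < e]).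
      by split => //; exact: uf.
    by move=> [y i] /= [Ky] /(_ y Ky); rewrite sub0r opprB.
  have c1 := cdiff_continuous (smooth_Cinf f s Ox).
  by apply: (cvg_comp _ _ _ c1); exact: cvg_fst.
apply/cinf_cvg_unif => s K cK KO e e0.
move/compact_near_coveringP : cK; apply => x Kx.
have Ox := KO x Kx.
have c1 := cdiff_continuous (smooth_Cinf f s Ox).
have c2 : (fun p : V * I => mpderiv s f p.1 : R[i]^o) @ filter_prod (nbhs x) F -->
   (mpderiv s f x : R[i]^o).
  by apply: (cvg_comp _ _ _ c1); exact: cvg_fst.
have c3 := uf s x Ox.
have e20 : 0 < e / 2 by apply: divr_gt0 => //; exact: ltr0Sn.
have /cvgc_distP/(_ _ e20) h2 := c2.
have /cvgc_distP/(_ _ e20) h3 := c3.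
apply: filterS2 h2 h3 => -[y i] /= h2 h3.
rewrite [ltRHS]splitr; apply: le_lt_trans (ltrD h2 h3).
have -> : mpderiv s f y - mpderiv s (u i) y =
    - (mpderiv s f x - mpderiv s f y) + (mpderiv s f x - mpderiv s (u i) y) by ring.
by rewrite -lecR rmorphD /= -!normcR (le_trans (ler_normD _ _))// normrN.
Qed.

End CinfTopology.

(** * Compact carriers of continuous operators and forms *)

Section LinearForms.
Variables (R : realType) (E : lmodType R[i]).

Lemma linear_map0 (W : lmodType R[i]) (T : E -> W) : linear T -> T 0 = 0.
Proof. by move=> lT; have := lT (-1) 0 0; rewrite scaler0 addr0 scaleN1r addNr. Qed.

Lemma linear_mapD (W : lmodType R[i]) (T : E -> W) : linear T -> {morph T : f g / f + g}.
Proof. by move=> lT f g; have := lT 1 f g; rewrite !scale1r. Qed.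

Lemma linear_mapZ (W : lmodType R[i]) (T : E -> W) : linear T ->
  forall a f, T (a *: f) = a *: T f.
Proof. by move=> lT a f; have := lT a f 0; rewrite (linear_map0 lT) !addr0. Qed.

Lemma linear_mapB (W : lmodType R[i]) (T : E -> W) : linear T -> {morph T : f g / f - g}.
Proof.
by move=> lT f g; rewrite addrC -scaleN1r lT scaleN1r addrC.
Qed.

Lemma linear_map_sum (W : lmodType R[i]) (T : E -> W) : linear T ->
  forall (I : Type) (r : seq I) (P : pred I) (F : I -> E),
  T (\sum_(i <- r | P i) F i) = \sum_(i <- r | P i) T (F i).
Proof.
move=> lT I r P F; elim/big_rec2: _ => [|i y1 y2 Pi <-]; first exact: linear_map0.
exact: linear_mapD.
Qed.

End LinearForms.

Section Carriers.
Variables (R : realType) (d : nat) (Omega : set 'rV[R]_d).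
Local Notation V := 'rV[R]_d.
Local Notation C := R[i].
Implicit Types (f g h : Cinf Omega).
Hypothesis oO : open Omega.

Lemma CinfD f g x : (f + g : Cinf Omega) x = f x + g x. Proof. by []. Qed.
Lemma CinfB f g x : (f - g : Cinf Omega) x = f x - g x. Proof. by []. Qed.
Lemma CinfZ a f x : (a *: f : Cinf Omega) x = a * f x. Proof. by []. Qed.
Lemma Cinf_sum (I : Type) (r : seq I) (P : pred I) (F : I -> Cinf Omega) x :
  (\sum_(i <- r | P i) F i) x = \sum_(i <- r | P i) F i x.
Proof. by elim/big_rec2: _ => // i y1 y2 _ <-. Qed.

Lemma Cinf_out f x : ~ Omega x -> f x = 0.
Proof. by case: f => f /=; rewrite inE => -[_]; apply. Qed.

Lemma Cinf_ext f g : (forall x, Omega x -> f x = g x) -> f = g.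
Proof.
move=> fg; apply/val_inj/funext => x /=.
by have [/fg//|nO] := pselect (Omega x); rewrite !Cinf_out.
Qed.

Lemma Cinf_ofS (k : V -> C) x : smooth_on Omega k -> Omega x ->
  Cinf_of Omega k x = k x.
Proof. by move=> /(smooth_onP _ oO) sk; exact: Cinf_ofE. Qed.

Lemma mpderiv_Cinf_of (k : V -> C) s x : smooth_on Omega k -> Omega x ->
  mpderiv s (Cinf_of Omega k) x = mpderiv s k x.
Proof. by move=> sk Ox; apply: (eq_on_mpderiv oO) => // y Oy; exact: Cinf_ofS. Qed.

Lemma cinf_cvg_eval (I : Type) (F : set_system I) {FF : Filter F}
    (u : I -> Cinf Omega) f x : u @ F --> f -> Omega x ->
  (fun i => u i x : R[i]^o) @ F --> (f x : R[i]^o).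
Proof.
move=> /(cinf_cvgP oO) uf Ox; have := uf [::] x Ox.
move=> h; apply: (cvg_comp (fun i => (x, i)) _ _ h).
move=> A [[N W] /= [nN FW] sub]; apply: filterS FW => i Wi.
by apply: sub; split => //=; exact: nbhs_singleton.
Qed.

Lemma mpderiv_joint s x f : Omega x ->
  (fun p : V * Cinf Omega => mpderiv s p.2 p.1 : R[i]^o) @ filter_prod (nbhs x) (nbhs f) -->
    (mpderiv s f x : R[i]^o).
Proof.
by move=> Ox; apply: (iffLR (@cinf_cvgP _ _ _ oO _ (nbhs f) (nbhs_filter f) id f)).
Qed.

Lemma cinf_cvg_lin (I : Type) (F : set_system I) {FF : Filter F}
    (u v : I -> Cinf Omega) f g (a : I -> C) (b : C) :
  (a : I -> R[i]^o) @ F --> (b : R[i]^o) -> u @ F --> f -> v @ F --> g ->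
  (fun i => a i *: u i + v i) @ F --> b *: f + g.
Proof.
move=> ab /(cinf_cvgP oO) uf /(cinf_cvgP oO) vg; apply/(cinf_cvgP oO) => s x Ox.
have E (c : C) (k l : Cinf Omega) y : Omega y ->
    mpderiv s (c *: k + l) y = c * mpderiv s k y + mpderiv s l y.
  move=> Oy; exact: nbhs_singleton (mpderiv_lin c (Cinf_smooth k Oy) (Cinf_smooth l Oy) s).
rewrite (E b f g x Ox).
have h : (fun p : V * I => a p.2 * mpderiv s (u p.2) p.1 + mpderiv s (v p.2) p.1 : R[i]^o)
   @ filter_prod (nbhs x) F --> (b * mpderiv s f x + mpderiv s g x : R[i]^o).
  apply: cvgcD; last exact: vg.
  apply: cvgcM; last exact: uf.
  exact: (cvg_comp _ _ cvg_snd ab).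
apply: cvg_trans h; apply: near_eq_cvg.
have : \forall y \near x, Omega y by exact: open_nbhs_nbhs.
move=> nO; exists (Omega, setT); first by split => //; exact: filterT.
move=> [y i] [/= Oy _]; exact: (esym (E _ _ _ _ Oy)).
Qed.

(** Functions vanishing near large compact sets form a filter converging to 0;
    this is what produces compact carriers. *)
Definition vanishing_near : set_system (Cinf Omega) :=
  filter_from [set K : set V | compact K /\ K `<=` Omega]
    (fun K => [set h : Cinf Omega | set_nbhs K [set y | h y = 0]]).

Global Instance vanishing_near_filter : Filter vanishing_near.
Proof.
apply: filter_from_filter.
  by exists set0; split; [exact: compact0|].
move=> K L [cK KO] [cL LO]; exists (K `|` L).
  by split; [exact: compactU|move=> x [/KO|/LO]].
by move=> h hKL; split=> x Kx; apply: hKL; [left|right].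
Qed.

Lemma vanishing_near_cvg : vanishing_near --> (0 : Cinf Omega).
Proof.
suff h : id @ vanishing_near --> (0 : Cinf Omega) by exact: h.
apply/(cinf_cvgP oO) => s x Ox.
have z : mpderiv s (0 : Cinf Omega) x = 0.
  by case: s => [//|i s]; rewrite (@mpderiv_cst _ _ (i :: s) 0).
rewrite z; apply: cvg_near_cst.
have [K [cK nK KO]] := compact_nbhs oO Ox.
exists (K°, [set h : Cinf Omega | set_nbhs K [set y | h y = 0]]).
  split; first by rewrite /= /interior; apply: nbhs_interior.
  by exists K.
move=> [y h] /= [Ky hK].
have /near_eq_mpderiv/(_ s)/nbhs_singleton -> : \forall z \near y, h z = (fun=> 0) z.
  by have := hK y (nbhs_singleton Ky).
by case: (s) => [//|i t]; rewrite mpderiv_cst.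
Qed.

Lemma small_multiples_0 (z : C) : (forall c : C, complex.Re `|c * z| < 1) -> z = 0.
Proof.
move=> h; apply/eqP/negP => /negP z0; have := h z^-1.
by rewrite mulVf// normr1 /= ltxx.
Qed.

Lemma set_nbhsZ (K : set V) (c : C) h : set_nbhs K [set y | h y = 0] ->
  set_nbhs K [set y | (c *: h : Cinf Omega) y = 0].
Proof. by apply: filterS => y hy; rewrite /mkset CinfZ hy mulr0. Qed.

(** By continuity at 0 there is a compact K such that M maps every function
    vanishing near K to one of modulus less than 1 near x.  Such functions form
    a linear subspace, so their images are 0 near x, on a neighbourhood that
    does not depend on the function. *)
Lemma operator_carrier (M : Cinf Omega -> Cinf Omega) x : linear M -> continuous M ->
  Omega x -> exists K : set V, [/\ compact K, K `<=` Omega &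
    \forall y \near x, forall h, set_nbhs K [set z | h z = 0] -> M h y = 0].
Proof.
move=> lM cM Ox.
have c0 : M @ vanishing_near --> (0 : Cinf Omega).
  rewrite -(linear_map0 lM); apply: (cvg_comp _ _ vanishing_near_cvg); exact: cM.
have /(cinf_cvgP oO)/(_ [::] x Ox)/cvgc_distP/(_ 1 ltr01) := c0.
case=> -[N W] /= [nN [K [cK KO] KW]] NW; exists K; split => //.
apply: filterS nN => y Ny h hK; apply: small_multiples_0 => c.
have h1 : complex.Re `|0 - M (c *: h) y| < 1.
  by apply: (NW (y, c *: h)); split => //; apply: KW; exact: set_nbhsZ.
by move: h1; rewrite sub0r normrN (linear_mapZ lM).
Qed.

Lemma form_carrier (T : Cinf Omega -> R[i]^o) : linear T -> continuous T ->
  exists K : set V, [/\ compact K, K `<=` Omega &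
    forall h, set_nbhs K [set z | h z = 0] -> T h = 0].
Proof.
move=> lT cT.
have c0 : T @ vanishing_near --> (0 : R[i]^o).
  rewrite -(linear_map0 lT); apply: (cvg_comp _ _ vanishing_near_cvg); exact: cT.
have /cvgc_distP/(_ 1 ltr01) := c0.
case=> K [cK KO] KW; exists K; split => // h hK; apply: small_multiples_0 => c.
have h1 : complex.Re `|0 - (T (c *: h) : C)| < 1 by apply: KW; exact: set_nbhsZ.
by move: h1; rewrite sub0r normrN (linear_mapZ lT).
Qed.

End Carriers.

Lemma cinf_continuous (R : realType) (d : nat) (Omega Omega' : set 'rV[R]_d)
    (M : Cinf Omega -> Cinf Omega') : open Omega' ->
  (forall f s x, Omega' x ->
    (fun p : 'rV[R]_d * Cinf Omega => mpderiv s (M p.2) p.1 : R[i]^o) @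
      filter_prod (nbhs x) (nbhs f) --> (mpderiv s (M f) x : R[i]^o)) ->
  continuous M.
Proof.
move=> oO' h f; apply: (iffRL (@cinf_cvgP _ _ _ oO' _ (nbhs f) (nbhs_filter f) M (M f))).
exact: h.
Qed.

(** * Composition with smooth maps and dilations *)

Section Coordinates.
Variables (R : realType) (d : nat).

Lemma rV_norm_lt (v : 'rV[R]_d) (e : R) : 0 < e -> (forall j, `|v 0 j| < e) -> `|v| < e.
Proof.
move=> e0 ve; rewrite [ltLHS]/Num.norm /= mx_normrE; apply/bigmax_ltP; split => //.
by move=> -[i j] _ /=; rewrite ord1.
Qed.

Lemma rV_norm_ge (v : 'rV[R]_d) j : `|v 0 j| <= `|v|.
Proof.
by rewrite [leRHS]/Num.norm /= mx_normrE; apply: (le_bigmax _ (fun x => `|v x.1 x.2|) (0, j)).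
Qed.

Lemma cvg_coords (I : Type) (F : set_system I) {FF : Filter F} (u : I -> 'rV[R]_d) (x : 'rV[R]_d) :
  (forall j, (fun i => u i 0 j) @ F --> x 0 j) -> u @ F --> x.
Proof.
move=> ux; apply/cvgrPdist_lt => e e0.
have : \forall i \near F, forall j, `|x 0 j - u i 0 j| < e.
  by apply: filter_forall => j; apply: cvgr_dist_lt.
by apply: filterS => i h; apply: rV_norm_lt => // j; rewrite !mxE.
Qed.

End Coordinates.

Section ChainRule.
Variables (R : realType) (m d : nat).
Local Notation C := R[i].
Implicit Types (P : 'rV[R]_m -> 'rV[R]_d).

Lemma diff_coords P z : (forall j, differentiable (fun z => P z 0 j) z) ->
  differentiable P z.
Proof.
move=> dP.
rewrite (_ : P = \sum_(j < d) (fun z => P z 0 j *: (delta_mx 0 j : 'rV[R]_d))).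
  by apply: differentiable_sum => j; exact: differentiableZl.
apply/funext => y; rewrite fct_sumE; apply/rowP => j.
rewrite summxE (bigD1 j) //= !mxE !eqxx mulr1 big1 ?addr0//.
by move=> k kj; rewrite !mxE eq_sym (negbTE kj) mulr0.
Qed.

Lemma derive_coords P z v j : differentiable P z ->
  ('D_v P z) 0 j = 'D_v (fun z => P z 0 j) z.
Proof.
move=> dP; have := @diff_derivable _ _ _ _ _ v dP => /derivableP PD.
symmetry; apply: cvg_lim => //.
have /cvg_ex[l Pl] := @diff_derivable _ _ _ _ _ v dP.
have -> : 'D_v P z = l by exact: cvg_lim Pl.
rewrite (_ : (fun h => _) = (fun A : 'rV[R]_d => A 0 j) \o
  (fun h : R => h^-1 *: ((P \o shift z) (h *: v) - P z))); last first.
  by apply/funext => h /=; rewrite !mxE.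
by apply: (cvg_comp _ _ Pl); exact: coord_continuous.
Qed.

Lemma derive_comp P (h : 'rV[R]_d -> R) z v :
  (forall j, differentiable (fun z => P z 0 j) z) -> differentiable h (P z) ->
  'D_v (fun z => h (P z)) z =
  \sum_j 'D_v (fun z => P z 0 j) z * 'D_(delta_mx 0 j) h (P z).
Proof.
move=> dPj dh; have dP := diff_coords dPj.
have dhP : differentiable (h \o P) z by exact: differentiable_comp.
rewrite -[LHS]/('D_v (h \o P) z) deriveE // diff_comp //=.
rewrite -[X in 'd h _ X]deriveE //.
rewrite (row_sum_delta ('D_v P z)) linear_sum; apply: eq_bigr => j _.
by rewrite linearZ /= derive_coords // -deriveE.
Qed.

Lemma pderiv_comp P (f : 'rV[R]_d -> C) z i :
  (forall j, cdifferentiable (fun z => (P z 0 j)%:C%C) z) -> cdifferentiable f (P z) ->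
  pderiv i (fun z => f (P z)) z =
  \sum_j pderiv i (fun z => (P z 0 j)%:C%C) z * pderiv j f (P z).
Proof.
move=> dP [f1 f2]; have dPj j : differentiable (fun z => P z 0 j) z by case: (dP j).
rewrite /pderiv (derive_comp _ dPj f1) (derive_comp _ dPj f2) /=.
elim/big_rec3: _ => [//|j x y w _ <-].
by rewrite derive_cst; simpc.
Qed.

Lemma cdiff_comp P (f : 'rV[R]_d -> C) z :
  (forall j, cdifferentiable (fun z => (P z 0 j)%:C%C) z) -> cdifferentiable f (P z) ->
  cdifferentiable (fun z => f (P z)) z.
Proof.
move=> dP [f1 f2]; have dPj j : differentiable (fun z => P z 0 j) z by case: (dP j).
have dP' := diff_coords dPj.
split; [exact: (differentiable_comp dP' f1)|exact: (differentiable_comp dP' f2)].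
Qed.

Lemma smooth_comp P (f : 'rV[R]_d -> C) (W : set 'rV[R]_m) (U : set 'rV[R]_d) :
  open W -> (forall j, smooth_on W (fun z => (P z 0 j)%:C%C)) ->
  (forall z, W z -> U (P z)) -> smooth_on U f -> smooth_on W (fun z => f (P z)).
Proof.
move=> oW sP WU sf.
(* The stable class: finite sums of products p1 z * p2 (P z), p1 and p2 smooth.
   *)
pose ok (p : ('rV[R]_m -> C) * ('rV[R]_d -> C)) := smooth_on W p.1 /\ smooth_on U p.2.
pose ev (r : seq (('rV[R]_m -> C) * ('rV[R]_d -> C))) := fun z => \sum_(p <- r) p.1 z * p.2 (P z).
have dP z : W z -> forall j, cdifferentiable (fun z => (P z 0 j)%:C%C) z.
  by move=> Wz j; exact: (sP j [::]).
have Qd r x : (forall p, List.In p r -> ok p) -> W x -> cdifferentiable (ev r) x.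
  move=> + Wx; rewrite /ev; elim: r => [|p r IH] rs.
    by under eq_fun do rewrite big_nil; exact: cdiff_cst.
  under eq_fun do rewrite big_cons.
  apply: cdiffD; last by apply: IH => q qr; apply: rs; right.
  have [s1 s2] := rs p (or_introl erefl).
  apply: cdiffM; first exact: (s1 [::]).
  by apply: cdiff_comp; [exact: dP|exact/(s2 [::])/WU].
apply: (@smooth_on_ind _ _ _ (fun h => exists2 r, (forall p, List.In p r -> ok p) & h = ev r)) => //.
- by move=> _ [r rs ->] x Wx; exact: Qd.
- move=> _ i [r rs ->].
  pose D (p : ('rV[R]_m -> C) * ('rV[R]_d -> C)) := (pderiv i p.1, p.2) ::
    [seq ((fun z => p.1 z * pderiv i (fun z => (P z 0 j)%:C%C) z), pderiv j p.2) | j <- enum 'I_d].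
  exists (ev (flatten [seq D p | p <- r])).
    exists (flatten [seq D p | p <- r]) => // p.
    elim: r rs => //= q r IH rs.
    have [s1 s2] := rs q (or_introl erefl).
    case=> [<-|]; first by split => //; exact: (smooth_on_mpderiv [:: i] s1).
    move=> pD; have [|] := List.in_app_or _ _ _ pD; last first.
      by move=> pr; apply: IH => // q' qr; apply: rs; right.
    elim: (enum _) => //= j js IHj [<-|//]; split => /=.
      by apply: smooth_onM => //; exact: (smooth_on_mpderiv [:: i] (sP j)).
    exact: (smooth_on_mpderiv [:: j] s2).
  move=> x Wx; rewrite /ev; elim: r rs => [|p r IH] rs.
    under eq_fun do rewrite big_nil.
    by rewrite pderiv_cst big_nil.
  under eq_fun do rewrite big_cons.
  have rs' q : List.In q r -> ok q by move=> qr; apply: rs; right.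
  have [s1 s2] := rs p (or_introl erefl).
  have d1 := s1 [::] x Wx; have d2 := s2 [::] (P x) (WU x Wx).
  have d3 := cdiff_comp (dP x Wx) d2.
  rewrite pderivD; [|exact: cdiffM|exact: Qd].
  rewrite /= big_cons big_cat /= IH// big_map big_enum /= addrA; congr (_ + _).
  rewrite pderivM// (pderiv_comp _ (dP x Wx) d2).
  by rewrite mulr_sumr; congr (_ + _); apply: eq_bigr => j _; rewrite mulrA.
- exists [:: ((fun=> 1), f)] => [p [<-|[]]|].
    by split => //; exact: smooth_cst.
  by rewrite /ev; apply/funext => y; rewrite big_seq1 mul1r.
Qed.

End ChainRule.

Section Dilations.
Variables (R : realType) (d : nat).
Local Notation V := 'rV[R]_d.
Local Notation C := R[i].
Implicit Types (x y : V) (f : V -> C) (U : set V).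

Lemma hprodC x y : hprod x y = hprod y x.
Proof. by apply/rowP => i; rewrite !mxE mulrC. Qed.

Lemma hprodA x y z : hprod x (hprod y z) = hprod (hprod x y) z.
Proof. by apply/rowP => i; rewrite !mxE mulrA. Qed.

Lemma cvg_hprod (I : Type) (F : set_system I) {FF : Filter F} (u v : I -> V) x y :
  u @ F --> x -> v @ F --> y -> (fun i => hprod (u i) (v i)) @ F --> hprod x y.
Proof.
move=> ux vy; apply: cvg_coords => j; rewrite mxE.
under eq_fun do rewrite mxE.
by apply: cvgM; [exact: (cvg_comp _ _ ux (@coord_continuous _ _ _ 0 j x))
  |exact: (cvg_comp _ _ vy (@coord_continuous _ _ _ 0 j y))].
Qed.

Lemma smooth_hprod_coord U x j : open U -> smooth_on U (fun y => (hprod x y 0 j)%:C%C).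
Proof.
move=> oU; have -> : (fun y => (hprod x y 0 j)%:C%C) = (fun y => (x 0 j)%:C%C * (y 0 j)%:C%C).
  by apply/funext => y; rewrite mxE rmorphM.
by apply: smooth_onZ => //; exact: smooth_coord.
Qed.

Lemma pderiv_hprod U x f y i : open U -> smooth_on U f -> U (hprod x y) ->
  pderiv i (fun y => f (hprod x y)) y = (x 0 i)%:C%C * pderiv i f (hprod x y).
Proof.
move=> oU sf Uxy; rewrite pderiv_comp; last exact: (sf [::]).
  rewrite (bigD1 i)//= big1 ?addr0 => [|j ji].
    under eq_fun do rewrite mxE rmorphM.
    rewrite pderivZ ?pderiv_coord ?eqxx ?mulr1//; exact: (@smooth_coord _ _ setT i openT [::]).
  under eq_fun do rewrite mxE rmorphM.
  rewrite pderivZ ?pderiv_coord; last exact: (@smooth_coord _ _ setT j openT [::]).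
  by rewrite eq_sym (negbTE ji) mulr0 mul0r.
by move=> j; exact: (@smooth_hprod_coord setT x j openT [::]).
Qed.

Definition wmono (x : V) (s : seq 'I_d) : C := (\prod_(i <- s) x 0 i)%:C%C.

Lemma open_hprod U x : open U -> open [set y | U (hprod x y)].
Proof.
move=> oU; apply: (open_comp _ oU) => y _.
exact/differentiable_continuous/hprod_diff.
Qed.

Lemma mpderiv_hprod U x f s y : open U -> smooth_on U f -> U (hprod x y) ->
  mpderiv s (fun y => f (hprod x y)) y = wmono x s * mpderiv s f (hprod x y).
Proof.
move=> oU sf; elim: s y => [|i s IH] y Uy /=; first by rewrite /wmono big_nil mul1r.
rewrite (@near_eq_pderiv _ _ _ _ (fun y => wmono x s * mpderiv s f (hprod x y))); last first.
  by apply: (@open_near _ _ [set y | U (hprod x y)]) => //; exact: open_hprod.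
have sfs := smooth_on_mpderiv s sf.
rewrite pderivZ; last first.
  apply: cdiff_comp; last exact: (sfs [::]).
  by move=> j; exact: (@smooth_hprod_coord setT x j openT [::]).
by rewrite (pderiv_hprod _ oU sfs Uy) /wmono big_cons rmorphM mulrA [in RHS](mulrC (x 0 i)%:C%C).
Qed.

Lemma smooth_on_hprod U x f : open U -> smooth_on U f ->
  smooth_on [set y | U (hprod x y)] (fun y => f (hprod x y)).
Proof.
move=> oU sf; apply: (smooth_comp (U := U)) => //; first exact: open_hprod.
by move=> j; apply: smooth_hprod_coord; exact: open_hprod.
Qed.

End Dilations.

(** * Iterated differences and symmetry of mixed partial derivatives *)

Section FiniteDifferences.
Variables (R : realType) (d : nat).
Local Notation V := 'rV[R]_d.
Local Notation C := R[i].
Local Notation e_ i := (delta_mx 0 i : 'rV[R]_d).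
Implicit Types (u w : V -> R) (x y : V) (U : set V) (h : R) (i j : 'I_d) (s : seq 'I_d).

Definition rderivs s u := foldr (fun i u => 'D_(e_ i) u) u s.

Lemma Re_mpderiv s (f : V -> C) :
  (fun y => complex.Re (mpderiv s f y)) = rderivs s (fun y => complex.Re (f y)).
Proof. by elim: s => [//|i s /= <-]. Qed.

Lemma Im_mpderiv s (f : V -> C) :
  (fun y => complex.Im (mpderiv s f y)) = rderivs s (fun y => complex.Im (f y)).
Proof. by elim: s => [//|i s /= <-]. Qed.

Definition rsmooth U u := forall s x, U x -> differentiable (rderivs s u) x.

Lemma smooth_Re U (f : V -> C) : smooth_on U f -> rsmooth U (fun y => complex.Re (f y)).
Proof.
by move=> sf s x Ux; rewrite -Re_mpderiv; have [+ _] := sf s x Ux.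
Qed.

Lemma smooth_Im U (f : V -> C) : smooth_on U f -> rsmooth U (fun y => complex.Im (f y)).
Proof.
by move=> sf s x Ux; rewrite -Im_mpderiv; have [_ +] := sf s x Ux.
Qed.

Lemma rderivs_rcons s i u : rderivs (rcons s i) u = rderivs s ('D_(e_ i) u).
Proof. by rewrite /rderivs foldr_rcons. Qed.

Lemma rsmoothD U u i : rsmooth U u -> rsmooth U ('D_(e_ i) u).
Proof. by move=> su s x Ux; rewrite -rderivs_rcons; exact: su. Qed.

Definition fdiff h i u : V -> R := fun x => h^-1 * (u (x + h *: e_ i) - u x).
Definition fdiffs h s u := foldr (fdiff h) u s.

Lemma fdiffC h i j u : fdiff h i (fdiff h j u) = fdiff h j (fdiff h i u).
Proof.
apply/funext => x; rewrite /fdiff addrAC; congr (_ * _).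
by rewrite -!mulrBr; congr (_ * _); ring.
Qed.

Lemma fdiffs_fdiff h s i u : fdiffs h s (fdiff h i u) = fdiff h i (fdiffs h s u).
Proof. by elim: s => [//|j s /= ->]; exact: fdiffC. Qed.

Lemma fdiffs_cat h s t u : fdiffs h (s ++ t) u = fdiffs h s (fdiffs h t u).
Proof. by rewrite /fdiffs foldr_cat. Qed.

Lemma fdiffs_catC h s t u : fdiffs h (s ++ t) u = fdiffs h (t ++ s) u.
Proof.
rewrite !fdiffs_cat; elim: t => [//|i t IH] /=.
by rewrite fdiffs_fdiff IH.
Qed.

Lemma fdiffs_perm h s t u : perm_eq s t -> fdiffs h s u = fdiffs h t u.
Proof.
move: s t; apply: catCA_perm_subst => s1 s2 s3.
by rewrite !catA fdiffs_cat fdiffs_catC -fdiffs_cat.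
Qed.

(** Keeps in U all nodes of an n-fold difference with step h at x, and all
    intermediate points of the mean value theorem. *)
Definition room U n h x := forall y, `|y - x| <= h *+ n -> U y.

Lemma norm_e i : `|e_ i| <= 1.
Proof.
rewrite /Num.norm /= mx_normrE; apply/bigmax_leP; split => //.
by move=> [k j] _; rewrite mxE; case: (_ && _); rewrite ?normr1 ?normr0.
Qed.

Lemma norm_shift n h x y i (t : R) : 0 <= t <= h ->
  `|y - (x + t *: e_ i)| <= h *+ n -> `|y - x| <= h *+ n.+1.
Proof.
move=> /andP[t0 th] yx.
have -> : y - x = t *: e_ i + (y - (x + t *: e_ i)) by rewrite [RHS]addrC opprD addrA subrK.
rewrite mulrS; apply: le_trans (ler_normD _ _) _; apply: lerD => //.
rewrite normrZ ger0_norm// -[leRHS]mulr1.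
by apply: ler_pM => //; exact: norm_e.
Qed.

Lemma room_shift U n h x i (t : R) : 0 <= t <= h -> room U n.+1 h x ->
  room U n h (x + t *: e_ i).
Proof.
by move=> th rx y yx; apply: rx; exact: norm_shift yx.
Qed.

Lemma roomS U n h x : 0 < h -> room U n.+1 h x -> room U n h x.
Proof.
move=> h0 rx y yx; apply: rx; apply: le_trans yx _.
by rewrite mulrS lerDr ltW.
Qed.

Lemma room0 U n h x : 0 < h -> room U n h x -> U x.
Proof. by move=> h0; apply; rewrite subrr normr0 mulrn_wge0// ltW. Qed.

Lemma derive_shift u c x v : 'D_v (fun z => u (z + c)) x = 'D_v u (x + c).
Proof.
rewrite /derive; set g1 := fun t => t^-1 *: _; set g2 := fun t => t^-1 *: _.
by suff -> : g1 = g2 by []; apply/funext => t; rewrite /g1 /g2 /= addrA.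
Qed.

Lemma diff_shift u c x : differentiable u (x + c) -> differentiable (fun z => u (z + c)) x.
Proof.
move=> du; apply: (@differentiable_comp _ _ _ _ (fun z : V => z + c) u) => //.
Qed.

Lemma fdiffs_diff U s u h x : rsmooth U u -> 0 < h -> room U (size s) h x ->
  differentiable (fdiffs h s u) x.
Proof.
move=> su h0; elim: s x => [|i s IH] x /= rx; first exact/(su [::])/(room0 h0 rx).
rewrite (_ : fdiff h i _ = h^-1 *: ((fun z => fdiffs h s u (z + h *: e_ i)) - fdiffs h s u)); last first.
  by apply/funext => y.
apply: differentiableZ; apply: differentiableB.
  have hh : 0 <= h <= h by rewrite (ltW h0) lexx.
  apply: diff_shift; apply: IH. exact: (room_shift hh rx).
by apply: IH; exact: (roomS h0 rx).
Qed.

Lemma fdiffs_derive U s u h x i : rsmooth U u -> 0 < h -> room U (size s) h x ->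
  'D_(e_ i) (fdiffs h s u) x = fdiffs h s ('D_(e_ i) u) x.
Proof.
move=> su h0; elim: s x => [//|j s IH] x /= rx.
have r1 : room U (size s) h (x + h *: e_ j) by apply: (room_shift _ rx); rewrite (ltW h0) lexx.
have r2 : room U (size s) h x by exact: (roomS h0 rx).
have d1 := diff_shift (fdiffs_diff su h0 r1).
have d2 := fdiffs_diff su h0 r2.
have D1 := derivableP (@diff_derivable _ _ _ _ _ (e_ i) d1).
have D2 := derivableP (@diff_derivable _ _ _ _ _ (e_ i) d2).
have H := is_deriveZ h^-1 (is_deriveB D1 D2).
rewrite (_ : fdiff h j _ = h^-1 \*: ((fun z => fdiffs h s u (z + h *: e_ j)) - fdiffs h s u)); last first.
  by apply/funext => y.
rewrite (@derive_val _ _ _ _ _ _ _ H) derive_shift !IH//.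
Qed.

Lemma line_mvt u h x v : 0 < h ->
  (forall t, 0 <= t <= h -> differentiable u (x + t *: v)) ->
  exists2 t, 0 <= t <= h & u (x + h *: v) - u x = 'D_v u (x + t *: v) * h.
Proof.
move=> h0 du; pose phi t := u (x + t *: v).
have dphi t : 0 <= t <= h -> is_derive t 1 phi ('D_v u (x + t *: v)).
  move=> th; have du' := du t th.
  have dl : differentiable (fun t : R => x + t *: v) t.
    by apply: differentiableD => //; apply: differentiableZl; exact: ex_diff.
  apply: DeriveDef.
    by apply/derivable1_diffP; exact: (differentiable_comp dl du').
  rewrite /derive; set g1 := fun t => t^-1 *: _; set g2 := fun t => t^-1 *: _.
  suff -> : g1 = g2 by []; apply/funext => k; rewrite /g1 /g2 /phi /=.
  by rewrite -[k%:A]/(k * 1) mulr1 scalerDl addrCA.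
have cphi : {within `[0, h], continuous phi}.
  apply: derivable_within_continuous => t; rewrite in_itv /= => th.
  by have [] := dphi t th.
have dphi' t : t \in `]0, h[%R -> is_derive t 1 phi ('D_v u (x + t *: v)).
  by rewrite in_itv /= => /andP[t0 th]; apply: dphi; rewrite (ltW t0) (ltW th).
have [c + E] := MVT_segment (ltW h0) dphi' cphi.
rewrite in_itv /= => ch; exists c => //.
by move: E; rewrite subr0 /phi scale0r addr0.
Qed.

Lemma fdiff_mvt u h x i : 0 < h ->
  (forall t, 0 <= t <= h -> differentiable u (x + t *: e_ i)) ->
  exists2 t, 0 <= t <= h & fdiff h i u x = 'D_(e_ i) u (x + t *: e_ i).
Proof.
move=> h0 /(line_mvt h0)[t th E]; exists t => //.
by rewrite /fdiff E mulrC mulfK// gt_eqF.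
Qed.

(** The mean value theorem for iterated differences: one intermediate point
    serves the whole word, which gives at once the convergence of difference
    quotients and the symmetry of mixed partial derivatives. *)
Lemma fdiffs_mvt U s u h x : rsmooth U u -> 0 < h -> room U (size s) h x ->
  exists2 y, `|y - x| <= h *+ size s & fdiffs h s u x = rderivs (rev s) u y.
Proof.
move=> + h0; elim: s u x => [|i s IH] u x su /= rx.
  by exists x => //; rewrite subrr normr0 mulr0n.
have [t th ->] : exists2 t, 0 <= t <= h &
    fdiff h i (fdiffs h s u) x = 'D_(e_ i) (fdiffs h s u) (x + t *: e_ i).
  by apply: fdiff_mvt => // t th; apply: (fdiffs_diff su h0); exact: room_shift.
have rt := room_shift (i := i) th rx.
rewrite (fdiffs_derive i su h0 rt).
have [y yx ->] := IH _ _ (@rsmoothD U u i su) rt.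
exists y; last by rewrite rev_cons rderivs_rcons.
exact: norm_shift yx.
Qed.

Lemma small_steps n (e : R) : 0 < e -> \forall h \near 0^'+, h *+ n < e.
Proof.
move=> e0; near=> h; apply: (@le_lt_trans _ _ (h *+ n.+1)).
  by rewrite mulrSr lerDl.
rewrite -mulr_natr -ltr_pdivlMr ?ltr0n//.
near: h; apply: nbhs_right_lt; exact: divr_gt0.
Unshelve. all: by end_near. Qed.

Lemma small_room U n x : open U -> U x -> \forall h \near 0^'+, room U n h x.
Proof.
move=> oU Ux; have : nbhs x U by exact: open_nbhs_nbhs.
move=> /nbhs_ballP[e /= e0 eU].
apply: filterS (small_steps n e0) => h hn y yx; apply: eU.
by rewrite -ball_normE /= distrC; apply: le_lt_trans yx _.
Qed.

(** Schwarz's theorem: both sides are limits of the same iterated difference,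
    which does not depend on the order of the letters. *)
Lemma rderivs_perm U s t u x : open U -> rsmooth U u -> U x -> perm_eq s t ->
  rderivs s u x = rderivs t u x.
Proof.
move=> oU su Ux st.
apply/eqP; rewrite -subr_eq0 -normr_le0; apply/ler_addgt0Pr => e e0; rewrite add0r.
have e20 : 0 < e / 2 by apply: divr_gt0.
have close w : {for x, continuous w} -> exists2 r, 0 < r &
    forall y, `|y - x| < r -> `|w x - w y| < e / 2.
  move=> /cvgrPdist_lt/(_ _ e20)/nbhs_ballP[r /= r0 rw]; exists r => // y yx.
  by apply: rw; rewrite -ball_normE /= distrC.
have [r r0 rs] := close _ (differentiable_continuous (su s x Ux)).
have [r' r0' rt] := close _ (differentiable_continuous (su t x Ux)).
have [h [h0 [hr [hr' hU]]]] : exists h : R, [/\ 0 < h, h *+ size s < r, h *+ size s < r' & room U (size s) h x].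
  near ((0 : R)^'+) => h; exists h; split.
  - by near: h; exact: nbhs_right_gt.
  - by near: h; exact: small_steps.
  - by near: h; exact: small_steps.
  - by near: h; exact: small_room.
have zs : size (rev s) = size s by rewrite size_rev.
have zt : size (rev t) = size s by rewrite size_rev (perm_size st).
have [y + Ey] := @fdiffs_mvt U (rev s) u h x su h0 (eq_ind_r (fun n => room U n h x) hU zs).
have [z + Ez] := @fdiffs_mvt U (rev t) u h x su h0 (eq_ind_r (fun n => room U n h x) hU zt).
rewrite zs zt !revK in Ey Ez * => zx yx.
have E : rderivs s u y = rderivs t u z.
  by rewrite -Ey -Ez (@fdiffs_perm h (rev s) (rev t))// perm_rev perm_sym perm_rev perm_sym.
have h1 := rs y (le_lt_trans yx hr).
have h2 := rt z (le_lt_trans zx hr').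
have -> : rderivs s u x - rderivs t u x =
    (rderivs s u x - rderivs s u y) - (rderivs t u x - rderivs t u z) by rewrite E; ring.
rewrite (le_trans (ler_normB _ _))// [leRHS]splitr lerD// ltW//.
Unshelve. all: by end_near. Qed.

Lemma mpderiv_perm U s t (f : V -> C) x : open U -> smooth_on U f -> U x ->
  perm_eq s t -> mpderiv s f x = mpderiv t f x.
Proof.
move=> oU sf Ux st; apply/eqP; rewrite eq_complex.
have re := rderivs_perm oU (smooth_Re sf) Ux st.
have im := rderivs_perm oU (smooth_Im sf) Ux st.
by rewrite -!Re_mpderiv in re; rewrite -!Im_mpderiv in im; rewrite re im !eqxx.
Qed.

End FiniteDifferences.

(** * Flat functions and cutoffs *)

Section FlatFunction.
Variable R : realType.
Implicit Types (t : R) (k : nat).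

(** The functions t^-k exp(-1/t), extended by 0: a family closed under
    differentiation and containing the classical flat function. *)
Definition flat k t : R := if 0 < t then t^-1 ^+ k * expR (- t^-1) else 0.

Lemma flat_ge0 k t : 0 <= flat k t.
Proof.
rewrite /flat; case: ifP => // t0.
by rewrite mulr_ge0 ?expR_ge0// exprn_ge0// invr_ge0 ltW.
Qed.

Lemma flat_gt0 t : (0 < flat 0 t) = (0 < t).
Proof. by rewrite /flat; case: ifP => // _; rewrite expr0 mul1r expR_gt0. Qed.

Lemma flat_le0 k t : t <= 0 -> flat k t = 0.
Proof. by move=> t0; rewrite /flat ltNge t0. Qed.

Lemma expr_le_expR n (y : R) : 0 <= y -> y ^+ n <= n`!%:R * expR y.
Proof.
move=> y0; case: n => [|n].
  by rewrite expr0 mul1r -[leLHS]expR0 ler_expR.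
rewrite mulrC -ler_pdivrMr ?ltr0n ?fact_gt0//.
by apply: le_trans (expR_ge1Dxn n y0); rewrite lerDr.
Qed.

(** Quadratic decay at 0 is what makes flat k differentiable there. *)
Lemma flat_le k t : flat k t <= k.+2`!%:R * t ^+ 2.
Proof.
rewrite /flat; case: ifP => t0; last by rewrite mulr_ge0 ?sqr_ge0.
have /(expr_le_expR k.+2) h : 0 <= t^-1 by rewrite invr_ge0 ltW.
rewrite expRN -ler_pdivlMr ?invr_gt0 ?expR_gt0// invrK.
have -> : t^-1 ^+ k = t^-1 ^+ k.+2 * t ^+ 2.
  by rewrite -addn2 exprD -mulrA -exprMn mulVf ?gt_eqF// expr1n mulr1.
rewrite [leRHS]mulrAC; apply: ler_wpM2r => //; exact: sqr_ge0.
Qed.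

Lemma is_derive_flat k t :
  is_derive t 1 (flat k) (flat k.+2 t - k%:R * flat k.+1 t).
Proof.
have [t0|t0|<-] := ltgtP 0 t.
- have E : \forall s \near t, s^-1 ^+ k * expR (- s^-1) = flat k s.
    have : \forall s \near t, 0 < s by exact: lt_nbhsr.
    by apply: filterS => s s0; rewrite /flat s0.
  apply: (near_eq_is_derive E).
  have tn : t != 0 by rewrite gt_eqF.
  have Di : is_derive t 1 (fun s : R => s^-1) (- t ^- 2).
    by have := @is_deriveV _ id t 1 1 tn (is_derive_id _ _); rewrite scaler1.
  have Dk := @is_deriveX _ _ _ k _ _ _ Di.
  have De := @is_derive1_comp _ expR (fun s => - s^-1) t _ _ (is_derive_expR _) (is_deriveN Di).
  rewrite (_ : (fun s => _) = (fun s : R => s^-1) ^+ k * (expR \o (fun s => - s^-1))); last first.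
    by apply/funext => s; rewrite !fctE.
  apply: (is_derive_eq (is_deriveM Dk De)); rewrite /flat t0.
  rewrite /= !fctE /GRing.scale /= exprVn.
  case: k {E Dk De} => [|k].
    by rewrite !expr0 !mul1r !mul0r mulr0 subr0 addr0 opprK mulrC.
  rewrite -(exprVn t 2) -(exprVn t k.+3) /= !exprS; ring.
- rewrite !(flat_le0 _ (ltW t0)) mulr0 subr0.
  apply: (@near_eq_is_derive _ _ _ (cst (0 : R)) (flat k) t 1 0).
    have : \forall s \near t, s < 0 by exact: lt_nbhsl.
    by apply: filterS => s s0; rewrite flat_le0// ltW.
- rewrite !(flat_le0 _ (lexx 0)) mulr0 subr0.
  have c0 : (fun h : R => h^-1 *: ((flat k \o shift 0) (h *: (1 : R)) - flat k 0)) @ 0^' --> (0 : R).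
    apply/cvgrPdist_le => e e0; near=> h.
    rewrite /= (flat_le0 k (lexx 0)) subr0 addr0 sub0r normrN [h%:A]mulr1 normrM.
    rewrite (ger0_norm (flat_ge0 _ _)) normfV.
    have h0 : 0 < `|h| by rewrite normr_gt0; near: h; exact: nbhs_dnbhs_neq.
    rewrite ler_pdivrMl//; apply: le_trans (flat_le _ _) _.
    rewrite -real_normK ?num_real// expr2 mulrA [leRHS]mulrC.
    apply: ler_wpM2r; first exact: ltW.
    rewrite -ler_pdivlMl ?ltr0n ?fact_gt0//.
    near: h; apply: (@dnbhs0_le _ R^o).
    by rewrite mulr_gt0// invr_gt0 ltr0n fact_gt0.
  apply: DeriveDef; first by apply/cvg_ex; exists 0.
  exact: cvg_lim c0.
Unshelve. all: by end_near. Qed.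
End FlatFunction.

Section Cutoff.
Variables (R : realType) (d : nat).
Local Notation V := 'rV[R]_d.
Local Notation C := R[i].
Implicit Types (x a : V) (p q w : V -> R) (K L U : set V).

(** Functions built from coordinates and flat functions: an explicit class that
    is stable under directional derivatives, hence made of smooth functions. *)
Inductive flatfun : (V -> R) -> Prop :=
| flatfun_cst (r : R) : flatfun (cst r)
| flatfun_coord (j : 'I_d) : flatfun (fun x => x 0 j)
| flatfunD p q : flatfun p -> flatfun q -> flatfun (p + q)
| flatfunM p q : flatfun p -> flatfun q -> flatfun (p * q)
| flatfun_flat k p : flatfun p -> flatfun (fun x => flat k (p x)).

Lemma flatfun_is_derive k (p : V -> R) x v : differentiable p x ->
  differentiable (fun y => flat k (p y)) x /\
  'D_v (fun y => flat k (p y)) x = (flat k.+2 (p x) - k%:R * flat k.+1 (p x)) * 'D_v p x.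
Proof.
move=> dp; have D := is_derive_flat k (p x).
have df : differentiable (flat k) (p x) by apply/derivable1_diffP; case: D.
have dc : differentiable (flat k \o p) x by exact: differentiable_comp.
split => //; rewrite -[LHS]/('D_v (flat k \o p) x) deriveE // diff_comp //=.
rewrite -[X in 'd (flat k) _ X]deriveE //; set c := 'D_v p x.
have -> : 'd (flat k) (p x) c = c *: 'd (flat k) (p x) 1.
  by rewrite -linearZ -[c *: 1]/(c * 1) mulr1.
by rewrite -deriveE // (@derive_val _ _ _ _ _ _ _ D) -[LHS]/(c * _) mulrC.
Qed.

Lemma flatfun_diff p x : flatfun p -> differentiable p x.
Proof.
elim=> {p} [r|j|p q _ dp _ dq|p q _ dp _ dq|k p _ dp].
- exact: differentiable_cst.
- exact: differentiable_coord.
- exact: differentiableD.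
- exact: differentiableM.
- by have [] := flatfun_is_derive k 0 dp.
Qed.

Lemma flatfun_derive p v : flatfun p -> flatfun ('D_v p).
Proof.
elim=> {p} [r|j|p q pp dp pq dq|p q pp dp pq dq|k p pp dp].
- rewrite (_ : 'D_v _ = cst 0); first exact: flatfun_cst.
  by apply/funext => x; rewrite derive_cst.
- rewrite (_ : 'D_v _ = cst (v 0 j)); first exact: flatfun_cst.
  apply/funext => x; rewrite /derive; apply: cvg_lim => //.
  apply: cvg_near_cst; near=> t.
  rewrite /= !mxE addrK /GRing.scale /= mulrA mulVf ?mul1r//.
  by near: t; exact: nbhs_dnbhs_neq.
- rewrite (_ : 'D_v _ = 'D_v p + 'D_v q); first exact: flatfunD.
  by apply/funext => x; rewrite deriveD //; exact/diff_derivable/flatfun_diff.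
- rewrite (_ : 'D_v _ = p * 'D_v q + q * 'D_v p).
    by apply: flatfunD; apply: flatfunM.
  by apply/funext => x; rewrite deriveM //; exact/diff_derivable/flatfun_diff.
- rewrite (_ : 'D_v _ = ((fun x => flat k.+2 (p x)) + cst (- k%:R) * (fun x => flat k.+1 (p x))) * 'D_v p).
    apply: flatfunM => //; apply: flatfunD; first exact: flatfun_flat.
    by apply: flatfunM; [exact: flatfun_cst|exact: flatfun_flat].
  apply/funext => x.
  have [_ ->] := flatfun_is_derive k v (flatfun_diff x pp).
  by rewrite !fctE mulNr.
Unshelve. all: by end_near. Qed.

Lemma flatfun_smooth U p : open U -> flatfun p -> smooth_on U (fun x => (p x)%:C%C).
Proof.
move=> oU fp; apply: (@smooth_on_ind _ _ U
  (fun f => exists2 p, flatfun p & f = fun x => (p x)%:C%C)) => //.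
- move=> _ [q fq ->] x _; split; first exact: flatfun_diff.
  exact: differentiable_cst.
- move=> _ i [q fq ->]; exists (fun x => ('D_(delta_mx 0 i) q x)%:C%C).
    by exists ('D_(delta_mx 0 i) q) => //; exact: flatfun_derive.
  by move=> x _; rewrite /pderiv /= derive_cst.
- by exists p.
Qed.

(** For r > 0, positive exactly on the ball of centre a and radius r: in the
    maximum norm of row vectors balls are cubes, so a product over the
    coordinates does it. *)
Definition box_bump (r : R) a : V -> R :=
  fun x => \prod_(i < d) flat 0 (r ^+ 2 - (x 0 i - a 0 i) ^+ 2).

Lemma flatfun_box_bump r a : flatfun (box_bump r a).
Proof.
rewrite (_ : box_bump r a = \prod_(i < d) (fun x => flat 0 (r ^+ 2 - (x 0 i - a 0 i) ^+ 2))).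
  elim/big_ind: _ => [|p q|i _]; [exact: flatfun_cst|exact: flatfunM|].
  apply: flatfun_flat; set g := fun x : V => x 0 i - a 0 i.
  rewrite (_ : (fun _ => _) = cst (r ^+ 2) + cst (-1) * (g * g)).
    have fg : flatfun g by apply: flatfunD; [exact: flatfun_coord|exact: (flatfun_cst (- a 0 i))].
    by apply: flatfunD; [exact: flatfun_cst|apply: flatfunM; [exact: flatfun_cst|exact: flatfunM]].
  by apply/funext => x; rewrite !fctE /g mulN1r expr2.
apply/funext => x; rewrite /box_bump.
by elim/big_ind2: _ => // f1 x1 f2 x2 -> ->.
Qed.

Lemma box_bump_ge0 r a x : 0 <= box_bump r a x.
Proof. by apply: prodr_ge0 => i _; exact: flat_ge0. Qed.

Lemma box_bump_gt0 r a x : 0 < r -> (0 < box_bump r a x) = (`|x - a| < r).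
Proof.
move=> r0; have sq i : (0 < r ^+ 2 - (x 0 i - a 0 i) ^+ 2) = (`|(x - a) 0 i| < r).
  rewrite subr_gt0 !mxE -real_normK ?num_real// ltr_pXn2r// ?nnegrE//.
  exact: ltW.
apply/idP/idP => [xa|xa].
  apply: rV_norm_lt => // i; rewrite -sq ltNge; apply/negP => /(flat_le0 0) z.
  by move: xa; rewrite /box_bump (bigD1 i)//= z mul0r ltxx.
apply: prodr_gt0 => i _; rewrite flat_gt0 sq.
by apply: le_lt_trans xa; exact: rV_norm_ge.
Qed.

Definition bump_in U w := [/\ flatfun w, forall x, 0 <= w x &
  exists2 L, compact L /\ L `<=` U & forall x, ~ L x -> w x = 0].

(** Bumps around the points of K are added up over a finite subcover.  The
    filter of bumps that dominate a given one lets the near-covering form of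
    compactness choose the subcover. *)
Lemma bump_positive K U : compact K -> open U -> K `<=` U ->
  exists2 w, bump_in U w & forall x, K x -> 0 < w x.
Proof.
move=> /compact_near_coveringP cK oU KU.
pose F := filter_from (bump_in U) (fun u => [set w | bump_in U w /\ forall x, u x <= w x]).
have FF : Filter F.
  apply: filter_from_filter.
    exists (cst 0); split => //; first exact: flatfun_cst.
    by exists set0 => //; split => //; exact: compact0.
  move=> u v [fu u0 [Lu [cu uU] Lu0]] [fv v0 [Lv [cv vU] Lv0]].
  exists (u + v).
    split; first exact: flatfunD.
      by move=> x; rewrite !fctE addr_ge0.
    exists (Lu `|` Lv).
      by split; [exact: compactU|move=> x [/uU|/vU]].
    by move=> x /not_orP[x1 x2]; rewrite !fctE Lu0// Lv0// addr0.
  move=> w [bw uvw]; split; split => // x.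
    by apply: le_trans (uvw x); rewrite !fctE lerDl.
  by apply: le_trans (uvw x); rewrite !fctE lerDr.
have : \near F, K `<=` (fun w x => 0 < w x) F.
  apply: cK => a Ka.
  have : nbhs a U by apply: open_nbhs_nbhs; split => //; exact: KU.
  move=> /nbhs_closedballP[e' eU]; have e0 : 0 < e'%:num by []. set e := e'%:num in eU e0.
  exists ([set x | `|x - a| < e], [set w | bump_in U w /\ forall x, box_bump e a x <= w x]).
    split => /=.
      apply/nbhs_ballP; exists e => // y ay; rewrite -ball_normE in ay; rewrite /= distrC; exact: ay.
    exists (box_bump e a) => //; split.
    - exact: flatfun_box_bump.
    - exact: box_bump_ge0.
    - exists [set x : V | `|x - a| <= e].
        split; first exact: compact_closed_ball.
        by move=> x xa; apply: eU; rewrite closed_ballE// /closed_ball_ /mkset distrC.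
      move=> x /= /negP xa; apply/eqP; rewrite eq_le box_bump_ge0 andbT leNgt.
      by rewrite box_bump_gt0//; apply: contra xa; exact: ltW.
  move=> [x w] /= [xa [_ ww]]; apply: lt_le_trans (ww x).
  by rewrite box_bump_gt0.
case=> w bw wK; exists w => //; apply: wK; split => //.
Qed.

(** If w > c > 0 on K, then w is composed with the smooth function t |-> 1 -
    flat 0 (c - t) / flat 0 c, which is 1 for t >= c and 0 at t = 0. *)
Lemma cutoff K U : compact K -> open U -> K `<=` U ->
  exists chi : Cinf [set: V], [/\ set_nbhs K [set x | chi x = 1],
    compact (fsupp chi) & fsupp chi `<=` U].
Proof.
move=> cK oU KU; have [w [fw w0 [L [cL LU] wL]] wK] := bump_positive cK oU KU.
have cw x : {for x, continuous w} by exact/differentiable_continuous/flatfun_diff.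
have [c c0 cK'] : exists2 c : R, 0 < c & forall x, K x -> c < w x.
  have : \forall c \near (0 : R)^'+, K `<=` (fun x => c < w x).
    move/compact_near_coveringP : cK; apply => x Kx.
    have wx := wK x Kx; have wx2 : 0 < w x / 2 by exact: divr_gt0.
    exists ([set y | w x / 2 < w y], [set c : R | c < w x / 2]).
      split => /=; last exact: nbhs_right_lt.
      have := cw x; move/cvgrPdist_lt/(_ _ wx2); apply: filterS => y /= wxy.
      have := le_lt_trans (ler_norm _) wxy; lra.
    by move=> [y c] /= [h1 h2]; exact: lt_trans h1.
  move=> h; near ((0 : R)^'+) => c; exists c; last by near: c.
  by near: c; exact: nbhs_right_gt.
pose chi x := 1 - flat 0 (c - w x) / flat 0 c.
have fc0 : 0 < flat 0 c by rewrite flat_gt0.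
have fchi : flatfun chi.
  rewrite (_ : chi = cst 1 + cst (- (flat 0 c)^-1) * (fun x => flat 0 ((cst c + cst (-1) * w) x))).
    apply: flatfunD; first exact: flatfun_cst.
    apply: flatfunM; first exact: flatfun_cst.
    apply: flatfun_flat; apply: flatfunD; first exact: flatfun_cst.
    by apply: flatfunM => //; exact: flatfun_cst.
  by apply/funext => x; rewrite !fctE /chi mulN1r mulNr mulrC.
have schi := flatfun_smooth (@openT V) fchi.
pose X : Cinf [set: V] := Cinf_of setT (fun x => (chi x)%:C%C).
have XE x : X x = (chi x)%:C%C by exact: (Cinf_ofS openT).
have supp : fsupp X `<=` L.
  rewrite /fsupp; apply: subset_trans (_ : closure L `<=` L).
    apply: closureS => x /= Xx; apply: contrapT => nL.
    move: Xx; rewrite XE /chi wL// subr0 (divff (lt0r_neq0 fc0)).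
    by rewrite subrr eqxx.
  have /closure_id <- : closed L by apply: compact_closed => //; exact: norm_hausdorff.
  by [].
exists X; split.
- move=> x Kx; have : \forall y \near x, c < w y.
    exact: (@cvgr_gt _ _ _ _ w (w x) (cw x) c (cK' x Kx)).
  apply: filterS => y cy /=; rewrite XE /chi flat_le0 ?mul0r ?subr0//.
  by rewrite subr_le0 ltW.
- by apply: (subclosed_compact _ cL) => //; exact: closed_closure.
- exact: subset_trans LU.
Unshelve. all: by end_near. Qed.

End Cutoff.

(** * First-order Taylor formula, uniform in the base point *)

Lemma differentiable_littleo (K : numFieldType) (U W : normedModType K) (k : U -> W)
    (L : {linear U -> W}) (x : U) : continuous L ->
  (forall e, 0 < e -> \forall t \near 0, `|k (x + t) - k x - L t| <= e * `|t|) ->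
  differentiable k x /\ 'd k x = L :> (U -> W).
Proof.
move=> cL kL.
have E : k \o shift x = cst (k x) + L +o_ 0 id.
  apply/eqaddoP => e e0; have := kL e e0; apply: filterS => t.
  by rewrite /= !fctE /= opprD addrA (addrC t).
have U' := diff_unique cL E.
by split => //; apply/diff_locallyP; rewrite U'.
Qed.

Section Taylor.
Variables (R : realType) (n : nat).
Local Notation C := R[i].
Local Notation e_ i := (delta_mx 0 i : 'rV[R]_n).
Implicit Types (z v : 'rV[R]_n) (S : set 'rV[R]_n).

Definition lincomb (c : 'I_n -> R) v : R := \sum_j v 0 j * c j.

Lemma lincomb_linear c : linear (lincomb c).
Proof.
move=> a u v; rewrite /lincomb scaler_sumr -big_split /=; apply: eq_bigr => j _.
by rewrite !mxE mulrDl -mulrA.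
Qed.

HB.instance Definition _ c := GRing.isLinear.Build R 'rV[R]_n R _ (lincomb c) (lincomb_linear c).

Lemma lincomb_continuous c : continuous (lincomb c).
Proof.
move=> v; apply: differentiable_continuous.
rewrite (_ : lincomb c = \sum_(j < n) (fun v : 'rV[R]_n => v 0 j * c j)).
  apply: differentiable_sum => j; apply: differentiableM; last exact: differentiable_cst.
  exact: differentiable_coord.
by apply/funext => w; rewrite fct_sumE.
Qed.

Lemma differentiable_remainder (h : 'rV[R]_n -> R) z c :
  (forall e, 0 < e -> \forall t \near (0 : 'rV[R]_n), `|h (z + t) - h z - lincomb c t| <= e * `|t|) ->
  differentiable h z /\ forall i, 'D_(e_ i) h z = c i.
Proof.
move=> hr.
have [dh dE] := differentiable_littleo (L := lincomb c) (@lincomb_continuous c) hr.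
split => // i; rewrite deriveE // dE /= /lincomb (bigD1 i)//= !mxE !eqxx mul1r.
by rewrite big1 ?addr0// => j ji; rewrite !mxE (negbTE ji) mul0r.
Qed.

Lemma derive_lincomb (h : 'rV[R]_n -> R) z v : differentiable h z ->
  'D_v h z = lincomb (fun j => 'D_(e_ j) h z) v.
Proof.
move=> dh; rewrite deriveE // {1}(row_sum_delta v) linear_sum; apply: eq_bigr => j _.
by rewrite linearZ /= -deriveE.
Qed.

(** The mean value theorem on the segment from z to z + v, and continuity of the
    partial derivatives at z0 to compare both ends of the estimate with z0. *)
Lemma taylor_real S (h : 'rV[R]_n -> R) z0 (e : R) : open S -> rsmooth S h -> S z0 ->
  0 < e -> exists2 r, 0 < r & forall z v, `|z - z0| < r -> `|v| < r ->
    `|h (z + v) - h z - lincomb (fun j => 'D_(e_ j) h z) v| <= e * `|v|.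
Proof.
move=> oS sh Sz0 e0.
(* There are n coordinates; dividing by n + 1 also covers dimension 0. *)
pose e' := e / 2 / n.+1%:R.
have e'0 : 0 < e' by apply: divr_gt0; [exact: divr_gt0|rewrite ltr0n].
have : \forall z \near z0, S z /\ forall j, `|'D_(e_ j) h z0 - 'D_(e_ j) h z| < e'.
  apply: filterI; first exact: open_nbhs_nbhs.
  apply: (@filter_forall _ _ _ _ (nbhs_filter z0)) => j.
  by have /cvgrPdist_lt/(_ e' e'0) := differentiable_continuous (sh [:: j] z0 Sz0).
move=> /nbhs_ballP[r /= r0 rS].
exists (r / 2); first exact: divr_gt0.
move=> z v zz0 vr.
have inb (t : R) : 0 <= t <= 1 -> ball z0 r (z + t *: v).
  move=> /andP[t0 t1]; rewrite -ball_normE /= distrC addrAC.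
  apply: le_lt_trans (ler_normD _ _) _; rewrite [ltRHS]splitr ltrD//.
  rewrite normrZ ger0_norm//; apply: le_lt_trans vr.
  by rewrite -[leRHS]mul1r ler_wpM2r.
have dh (t : R) : 0 <= t <= 1 -> differentiable h (z + t *: v).
  by move=> t1; apply: (sh [::]); have [] := rS _ (inb t t1).
have [t t1] := line_mvt ltr01 dh.
rewrite scale1r mulr1 => ->; rewrite derive_lincomb; last exact: dh.
have [_ bt] := rS _ (inb t t1).
have [_ b0] : S z /\ forall j, `|'D_(e_ j) h z0 - 'D_(e_ j) h z| < e'.
  by have := rS _ (inb 0 _); rewrite scale0r addr0; apply; rewrite lexx ler01.
rewrite /lincomb -sumrB; apply: le_trans (ler_norm_sum _ _ _) _.
apply: (@le_trans _ _ (\sum_(j < n) (2 * e' * `|v|))).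
  apply: ler_sum => j _; rewrite -mulrBr normrM mulrC.
  apply: ler_pM => //; last exact: rV_norm_ge.
  have -> : 'D_(e_ j) h (z + t *: v) - 'D_(e_ j) h z =
    ('D_(e_ j) h z0 - 'D_(e_ j) h z) - ('D_(e_ j) h z0 - 'D_(e_ j) h (z + t *: v)) by ring.
  apply: le_trans (ler_normB _ _) _.
  by rewrite mulr_natl mulr2n; apply: lerD; apply: ltW.
rewrite sumr_const card_ord -[leLHS]mulr_natl mulrA; apply: ler_wpM2r => //.
have -> : n%:R * (2 * e') = e * (n%:R / n.+1%:R).
  have n0 : n.+1%:R != 0 :> R by rewrite pnatr_eq0.
  by rewrite /e'; move: n0; set N : R := n.+1%:R; move=> n0; field.
by rewrite -[leRHS]mulr1 ler_wpM2l ?(ltW e0)// ler_pdivrMr ?ltr0n// mul1r ler_nat.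
Qed.

Lemma taylor_complex S (f : 'rV[R]_n -> C) z0 (e : R) : open S -> smooth_on S f -> S z0 ->
  0 < e -> exists2 r, 0 < r & forall z v, `|z - z0| < r -> `|v| < r ->
    complex.Re `|f (z + v) - f z - \sum_j (v 0 j)%:C%C * pderiv j f z| <= e * `|v|.
Proof.
move=> oS sf Sz0 e0; have e20 : 0 < e / 2 by apply: divr_gt0.
have [r1 r10 h1] := taylor_real oS (smooth_Re sf) Sz0 e20.
have [r2 r20 h2] := taylor_real oS (smooth_Im sf) Sz0 e20.
exists (Num.min r1 r2); first by rewrite lt_min r10 r20.
move=> z v; rewrite !lt_min => /andP[z1 z2] /andP[v1 v2].
apply: le_trans (normc_le_ReIm _) _.
have -> : e * `|v| = e / 2 * `|v| + e / 2 * `|v| by rewrite -mulrDl -splitr.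
have S1 : complex.Re (\sum_j (v 0 j)%:C%C * pderiv j f z) =
    lincomb (fun j => 'D_(e_ j) (fun y => complex.Re (f y)) z) v.
  rewrite /lincomb; elim/big_rec2: _ => // j a b _ <-; rewrite /pderiv.
  by case: b => b1 b2 /=; rewrite mul0r subr0.
have S2 : complex.Im (\sum_j (v 0 j)%:C%C * pderiv j f z) =
    lincomb (fun j => 'D_(e_ j) (fun y => complex.Im (f y)) z) v.
  rewrite /lincomb; elim/big_rec2: _ => // j a b _ <-; rewrite /pderiv.
  by case: b => b1 b2 /=; rewrite mul0r addr0.
apply: lerD.
  have := h1 z v z1 v1; rewrite -S1; set q := \sum_j _.
  by case: (f (z + v)) (f z) q => [? ?] [? ?] [? ?].
have := h2 z v z2 v2; rewrite -S2; set q := \sum_j _.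
by case: (f (z + v)) (f z) q => [? ?] [? ?] [? ?].
Qed.

End Taylor.

(** * Differentiation under a distribution *)

Section Slices.
Variables (R : realType) (m d : nat).
Local Notation C := R[i].
Implicit Types (F : 'rV[R]_(m + d) -> C) (S : set 'rV[R]_(m + d)).

Lemma mpderiv_rslice s F (x : 'rV[R]_m) :
  mpderiv s (fun y : 'rV[R]_d => F (row_mx x y)) =
  fun y => mpderiv (map (@rshift m d) s) F (row_mx x y).
Proof.
elim: s => [//|i s /= ->]; apply/funext => y.
have E (u : 'rV[R]_(m + d) -> R) : 'D_(delta_mx 0 i) (fun y => u (row_mx x y)) y =
    'D_(delta_mx 0 (rshift m i)) u (row_mx x y).
  rewrite /derive; set g1 := fun t => t^-1 *: _; set g2 := fun t => t^-1 *: _.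
  suff -> : g1 = g2 by []; apply/funext => t; rewrite /g1 /g2 /=.
  congr (_ *: (u _ - _)); apply/rowP => j; rewrite !mxE.
  case: (split_ordP j) => k ->; rewrite ?row_mxEl ?row_mxEr ?mxE.
    by rewrite eq_lrshift andbF mulr0 add0r.
  by rewrite eq_rshift.
by rewrite /pderiv (E (fun z => complex.Re (mpderiv (map (@rshift m d) s) F z)))
  (E (fun z => complex.Im (mpderiv (map (@rshift m d) s) F z))).
Qed.

Lemma mpderiv_lslice s F (y : 'rV[R]_d) :
  mpderiv s (fun x : 'rV[R]_m => F (row_mx x y)) =
  fun x => mpderiv (map (@lshift m d) s) F (row_mx x y).
Proof.
elim: s => [//|i s /= ->]; apply/funext => x.
have E (u : 'rV[R]_(m + d) -> R) : 'D_(delta_mx 0 i) (fun x => u (row_mx x y)) x =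
    'D_(delta_mx 0 (lshift d i)) u (row_mx x y).
  rewrite /derive; set g1 := fun t => t^-1 *: _; set g2 := fun t => t^-1 *: _.
  suff -> : g1 = g2 by []; apply/funext => t; rewrite /g1 /g2 /=.
  congr (_ *: (u _ - _)); apply/rowP => j; rewrite !mxE.
  case: (split_ordP j) => k ->; rewrite ?row_mxEl ?row_mxEr ?mxE.
    by rewrite eq_lshift.
  by rewrite eq_rlshift andbF mulr0 add0r.
by rewrite /pderiv (E (fun z => complex.Re (mpderiv (map (@lshift m d) s) F z)))
  (E (fun z => complex.Im (mpderiv (map (@lshift m d) s) F z))).
Qed.

Lemma smooth_rslice S F (x : 'rV[R]_m) : smooth_on S F ->
  (forall y, S (row_mx x y)) -> smooth_on setT (fun y : 'rV[R]_d => F (row_mx x y)).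
Proof.
move=> sF Sx s y _; rewrite mpderiv_rslice.
apply: cdiff_comp; last exact: sF.
move=> j; case: (split_ordP j) => k ->.
  by under eq_fun do rewrite row_mxEl; exact: cdiff_cst.
under eq_fun do rewrite row_mxEr; exact: (@smooth_coord _ _ setT k openT [::]).
Qed.

Lemma row_mx_add (x t : 'rV[R]_m) (y : 'rV[R]_d) :
  row_mx (x + t) y = row_mx x y + row_mx t 0.
Proof. by rewrite add_row_mx addr0. Qed.

Lemma norm_row_mx0 (t : 'rV[R]_m) : `|row_mx t (0 : 'rV[R]_d)| <= `|t|.
Proof.
rewrite [leLHS]/Num.norm /= mx_normrE; apply/bigmax_leP; split => //.
move=> [k j] _ /=; rewrite ord1; case: (split_ordP j) => l ->.
  by rewrite row_mxEl; exact: rV_norm_ge.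
by rewrite row_mxEr mxE normr0.
Qed.

Lemma norm_row_mxB (x : 'rV[R]_m) (y z : 'rV[R]_d) :
  `|row_mx x y - row_mx x z| <= `|y - z|.
Proof.
rewrite opp_row_mx add_row_mx subrr [leLHS]/Num.norm /= mx_normrE.
apply/bigmax_leP; split => //.
move=> [k j] _ /=; rewrite ord1; case: (split_ordP j) => l ->.
  by rewrite row_mxEl mxE normr0.
by rewrite row_mxEr; exact: rV_norm_ge.
Qed.

End Slices.

Section UnderForm.
Variables (R : realType) (m d : nat).
Local Notation C := R[i].
Variable T : Cinf [set: 'rV[R]_d] -> R[i]^o.
Hypotheses (lT : linear T) (cT : continuous T).

Definition form_slice (F : 'rV[R]_(m + d) -> C) (x : 'rV[R]_m) : C :=
  T (Cinf_of setT (fun y => F (row_mx x y))).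

Variables (S : set 'rV[R]_(m + d)) (W : set 'rV[R]_m).
Hypotheses (oS : open S) (oW : open W) (WS : forall x y, W x -> S (row_mx x y)).
Implicit Type F : 'rV[R]_(m + d) -> C.

Let slice F x : Cinf [set: 'rV[R]_d] := Cinf_of setT (fun y => F (row_mx x y)).

Let mpderiv_slice F s x y : smooth_on S F -> W x ->
  mpderiv s (slice F x) y = mpderiv (map (@rshift m d) s) F (row_mx x y).
Proof.
move=> sF Wx; rewrite (mpderiv_Cinf_of openT)//; last first.
  by apply: (smooth_rslice sF) => z; exact: WS.
by rewrite mpderiv_rslice.
Qed.

(* The remainder of the first-order expansion of the slice in x, divided by the
   norm of the increment. *)
Let rest F x (t : 'rV[R]_m) : Cinf [set: 'rV[R]_d] :=
  (`|t|^-1)%:C%C *: (slice F (x + t) - slice F x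
     - \sum_(i < m) (t 0 i)%:C%C *: slice (pderiv (lshift d i) F) x).

(* Derivatives in y commute with derivatives in x, so a y-derivative of the
   remainder is the remainder of a y-derivative of F. *)
Let mpderiv_rest F x t s y : smooth_on S F -> W x -> W (x + t) ->
  let f := mpderiv (map (@rshift m d) s) F in
  mpderiv s (rest F x t) y = (`|t|^-1)%:C%C *
    (f (row_mx x y + row_mx t 0) - f (row_mx x y) -
     \sum_j (row_mx t (0 : 'rV[R]_d) 0 j)%:C%C * pderiv j f (row_mx x y)).
Proof.
move=> sF Wx Wxt f.
have s1 i : smooth_on S (pderiv (lshift d i) F) by exact: (smooth_on_mpderiv [:: lshift d i]).
have oT := @openT 'rV[R]_d; have sC (h : Cinf [set: 'rV[R]_d]) := smooth_Cinf oT h.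
have mB (g h : Cinf [set: 'rV[R]_d]) : mpderiv s (g - h) y = mpderiv s g y - mpderiv s h y.
  transitivity (mpderiv s (fun y => g y + (-1) * h y) y).
    by congr (mpderiv s _ y); apply/funext => z; rewrite CinfB mulN1r.
  rewrite (mpderivD s oT)//; first by rewrite (mpderivZ _ s oT)// mulN1r.
  exact: smooth_onZ.
transitivity (mpderiv s (fun y => (`|t|^-1)%:C%C * (slice F (x + t) - slice F x
     - \sum_(i < m) (t 0 i)%:C%C *: slice (pderiv (lshift d i) F) x : Cinf _) y) y) => //.
rewrite (mpderivZ _ s oT)//; congr (_ * _); rewrite !mB; congr (_ - _ - _).
- by rewrite mpderiv_slice// row_mx_add.
- by rewrite mpderiv_slice.
- transitivity (mpderiv s (fun y => \sum_(i < m) (t 0 i)%:C%C * slice (pderiv (lshift d i) F) x y) y).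
    by congr (mpderiv s _ y); apply/funext => z; rewrite Cinf_sum.
  rewrite (mpderiv_sum _ _ oT)//; last by move=> i _; exact: smooth_onZ.
  rewrite big_split_ord /= [X in _ = _ + X]big1 ?addr0; last first.
    by move=> j _; rewrite row_mxEr mxE mul0r.
  apply: eq_bigr => i _; rewrite row_mxEl (mpderivZ _ s oT)//; congr (_ * _).
  rewrite mpderiv_slice//.
  rewrite -[pderiv (lshift d i) F]/(mpderiv [:: lshift d i] F) -mpderiv_cat.
  rewrite -[pderiv _ f]/(mpderiv [:: lshift d i] f) -mpderiv_cat.
  by apply: (mpderiv_perm oS sF); [exact: WS|rewrite perm_catC].
Qed.

(* Uniformity of the Taylor formula in the base point (x, y) is precisely
   continuous convergence in y. *)
Let rest_cvg F x : smooth_on S F -> W x ->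
  rest F x @ (0 : 'rV[R]_m)^' --> (0 : Cinf [set: 'rV[R]_d]).
Proof.
move=> sF Wx; apply/(cinf_cvgP openT) => s y0 _.
have -> : mpderiv s (0 : Cinf [set: 'rV[R]_d]) y0 = 0.
  by case: s => [//|i s]; rewrite (@mpderiv_cst _ _ (i :: s) 0).
apply/cvgc_distP => e e0.
set f := mpderiv (map (@rshift m d) s) F.
have sf : smooth_on S f by exact: smooth_on_mpderiv.
have e20 : 0 < e / 2 by apply: divr_gt0 => //; exact: ltr0Sn.
have [r r0 hr] := taylor_complex oS sf (WS y0 Wx) e20.
exists ([set y | `|y - y0| < r], [set t | [/\ t != 0, `|t| < r & W (x + t)]]).
  split => /=.
    by apply/nbhs_ballP; exists r => // y; rewrite -ball_normE /= distrC.
  near=> t; split.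
  - by near: t; exact: nbhs_dnbhs_neq.
  - near: t; exact: dnbhs0_lt.
  - near: t; apply: nbhs_dnbhs.
    have c : (fun t => x + t) @ (0 : 'rV[R]_m) --> x.
      have := @cvgD R 'rV[R]_m _ (nbhs (0 : 'rV[R]_m)) _ (cst x) id x 0 (cvg_cst _) cvg_id.
      rewrite addr0; exact.
    by apply: c; exact: open_nbhs_nbhs.
move=> [y t] [/= yr [t0 tr Wxt]].
change (is_true (complex.Re `|0 - mpderiv s (rest F x t) y| < e)).
rewrite mpderiv_rest// -/f sub0r normrN.
set q := _ - _ - _.
have hq : complex.Re `|q| <= e / 2 * `|t|.
  apply: le_trans (hr _ _ _ _) _.
  - by apply: le_lt_trans yr; exact: norm_row_mxB.
  - by apply: le_lt_trans tr; exact: norm_row_mx0.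
  - by apply: ler_wpM2l; [exact: ltW|exact: norm_row_mx0].
have t1 : 0 < `|t| by rewrite normr_gt0.
rewrite -ltcR -normcR normrM.
have -> : `|(`|t|^-1)%:C%C : C| = (`|t|^-1)%:C%C.
  by rewrite ger0_norm// lecR invr_ge0.
rewrite (normcR q) -rmorphM ltcR.
rewrite mulrC ltr_pdivrMr//; apply: le_lt_trans hq _.
by rewrite ltr_pM2r// ltr_pdivrMr// ltr_pMr// ltr1n.
Unshelve. all: by end_near. Qed.

(** Differentiation under a distribution: Taylor's formula holds uniformly for
    all derivatives in y, so the difference quotients of the slices converge in
    the Frechet space. *)
Lemma form_slice_diff F x : smooth_on S F -> W x ->
  cdifferentiable (form_slice F) x /\
  forall i, pderiv i (form_slice F) x = form_slice (pderiv (lshift d i) F) x.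
Proof.
move=> sF Wx.
have c0 : (fun t => T (rest F x t)) @ (0 : 'rV[R]_m)^' --> (0 : R[i]^o).
  by rewrite -(linear_map0 lT); apply: (cvg_comp _ _ (rest_cvg sF Wx)); exact: cT.
have key e : 0 < e -> \forall t \near (0 : 'rV[R]_m),
   complex.Re `|form_slice F (x + t) - form_slice F x
     - \sum_i (t 0 i)%:C%C * form_slice (pderiv (lshift d i) F) x| <= e * `|t|.
  move=> e0.
  have h : \forall t \near (0 : 'rV[R]_m), t != 0 ->
      complex.Re `|0 - (T (rest F x t) : C)| < e by move/cvgc_distP/(_ e e0) : c0.
  apply: filterS h => t ht; have [->|/[dup] t0 /ht {}ht] := eqVneq t 0.
    rewrite addr0 subrr sub0r normrN big1 ?normr0 ?mulr0// => i _.
    by rewrite mxE mul0r.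
  have t1 : 0 < `|t| by rewrite normr_gt0.
  move: ht; rewrite sub0r normrN /rest (linear_mapZ lT) !(linear_mapB lT) (linear_map_sum lT).
  under eq_bigr do rewrite (linear_mapZ lT).
  rewrite -ltcR -normcR normrM.
  have -> : `|(`|t|^-1)%:C%C : C| = (`|t|^-1)%:C%C.
    by rewrite ger0_norm// lecR invr_ge0.
  set q := _ - _ - _; rewrite (normcR q) -rmorphM ltcR.
  by rewrite mulrC ltr_pdivrMr// => /ltW.
pose c i := form_slice (pderiv (lshift d i) F) x.
have [d1 E1] : differentiable (fun x => complex.Re (form_slice F x)) x /\
    forall i, 'D_(delta_mx 0 i) (fun x => complex.Re (form_slice F x)) x = complex.Re (c i).
  apply: differentiable_remainder => e e0; apply: filterS (key e e0) => t.
  apply: le_trans; have -> : lincomb (fun i => complex.Re (c i)) t =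
    complex.Re (\sum_i (t 0 i)%:C%C * c i).
    rewrite /lincomb; elim/big_rec2: _ => // j a b _ ->.
    by case: (c j) a => [? ?] [? ?] /=; rewrite mul0r subr0.
  rewrite -/(c _); set q := \sum_i _; apply: le_trans (ReIm_le_normc _).1.
  by case: (form_slice F (x + t)) (form_slice F x) q => [? ?] [? ?] [? ?].
have [d2 E2] : differentiable (fun x => complex.Im (form_slice F x)) x /\
    forall i, 'D_(delta_mx 0 i) (fun x => complex.Im (form_slice F x)) x = complex.Im (c i).
  apply: differentiable_remainder => e e0; apply: filterS (key e e0) => t.
  apply: le_trans; have -> : lincomb (fun i => complex.Im (c i)) t =
    complex.Im (\sum_i (t 0 i)%:C%C * c i).
    rewrite /lincomb; elim/big_rec2: _ => // j a b _ ->.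
    by case: (c j) a => [? ?] [? ?] /=; rewrite mul0r addr0.
  rewrite -/(c _); set q := \sum_i _; apply: le_trans (ReIm_le_normc _).2.
  by case: (form_slice F (x + t)) (form_slice F x) q => [? ?] [? ?] [? ?].
split=> [//|i]; rewrite /pderiv E1 E2; rewrite -/(c i).
by case: (c i).
Qed.

Lemma mpderiv_form_slice F s x : smooth_on S F -> W x ->
  mpderiv s (form_slice F) x = form_slice (mpderiv (map (@lshift m d) s) F) x.
Proof.
move=> sF; elim: s x => [//|i s IH] x Wx /=.
rewrite (@near_eq_pderiv _ _ _ _ (form_slice (mpderiv (map (@lshift m d) s) F))); last first.
  exact: (open_near oW Wx).
have [_ ->//] := form_slice_diff (smooth_on_mpderiv (map (@lshift m d) s) sF) Wx.
Qed.

Lemma smooth_form_slice F : smooth_on S F -> smooth_on W (form_slice F).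
Proof.
move=> sF s x Wx.
have [+ _] := form_slice_diff (smooth_on_mpderiv (map (@lshift m d) s) sF) Wx.
by apply: (eq_on_cdiff oW Wx) => y Wy; rewrite mpderiv_form_slice.
Qed.

End UnderForm.

(** * Germs along the support of a distribution *)

Section Products.
Variables (R : realType) (d : nat).
Local Notation V := 'rV[R]_d.
Local Notation C := R[i].
Implicit Types (f g phi : Cinf [set: V]) (U Z S K : set V).

(** Extension by zero: h has to be smooth only where a is not locally zero. *)
Lemma smooth_cut S Z U (a h : V -> C) : open S -> open Z -> open U ->
  smooth_on S a -> smooth_on U h -> (forall z, Z z -> a z = 0) ->
  (forall z, S z -> Z z \/ U z) -> smooth_on S (fun z => a z * h z).
Proof.
move=> oS oZ oU sa sh a0 ZU s x Sx; have [Zx|Ux] := ZU x Sx.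
  have E y : Z y -> 0 = mpderiv s (fun z => a z * h z) y.
    move=> Zy; have -> : mpderiv s (fun z => a z * h z) y = mpderiv s (fun=> 0) y.
      by apply: (eq_on_mpderiv oZ) => // z Zz; rewrite a0// mul0r.
    by case: (s) => [//|i t]; rewrite mpderiv_cst.
  exact: (eq_on_cdiff oZ Zx E (cdiff_cst 0 x)).
apply: (@smooth_onM _ _ (S `&` U)) => //; first exact: openI.
- exact: smooth_onS sa.
- exact: smooth_onS sh.
Qed.

Lemma open_fsuppC (f : V -> C) : open (~` fsupp f).
Proof. by apply: closed_openC; exact: closed_closure. Qed.

Lemma fsupp_out (f : V -> C) x : ~ fsupp f x -> f x = 0.
Proof.
move=> nx; apply/eqP/negP => /negP fx; apply: nx.
exact: subset_closure.
Qed.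

Lemma smooth_cutoff U phi (h : V -> C) : open U -> fsupp phi `<=` U ->
  smooth_on U h -> smooth_on setT (fun y => phi y * h y).
Proof.
move=> oU pU sh; apply: (@smooth_cut _ (~` fsupp phi) U) => //.
- exact: openT.
- exact: open_fsuppC.
- exact: smooth_Cinf openT _.
- by move=> z; exact: fsupp_out.
- by move=> z _; have [/pU|] := pselect (fsupp phi z); [right|left].
Qed.

Definition cmul phi f : Cinf [set: V] := Cinf_of setT (fun x => phi x * f x).

Lemma cmulE phi f x : cmul phi f x = phi x * f x.
Proof.
apply: (Cinf_ofS openT) => //.
by apply: smooth_onM => //; [exact: openT| |]; exact: smooth_Cinf openT _.
Qed.

Lemma cmulA f g h : cmul f (cmul g h) = cmul (cmul f g) h.
Proof. by apply: Cinf_ext => x _; rewrite !cmulE mulrA. Qed.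

Lemma cmul_linear phi : linear (cmul phi).
Proof.
move=> a f g; apply: Cinf_ext => x _.
by rewrite cmulE !CinfD !CinfZ !cmulE mulrDr mulrCA.
Qed.

Lemma fsupp_cmul phi f : fsupp (cmul phi f) `<=` fsupp phi.
Proof.
apply: closureS => x /=; rewrite cmulE; apply: contra => /eqP ->.
by rewrite mul0r.
Qed.

Lemma cmul_continuous phi : continuous (cmul phi).
Proof.
apply: (cinf_continuous openT) => f s x _.
have sC (h : Cinf [set: V]) : smooth_on setT h := smooth_Cinf openT h.
have E (g : Cinf [set: V]) y : mpderiv s (cmul phi g) y =
    \sum_(p <- splits s) mpderiv p.1 phi y * mpderiv p.2 g y.
  rewrite (mpderiv_Cinf_of openT)//; first exact: (@mpderivM _ _ setT _ _ s y openT).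
  by apply: smooth_onM => //; exact: openT.
rewrite E; under eq_fun do rewrite E.
apply: cvgc_sum => p; apply: cvgcM.
  have c := cdiff_continuous (sC phi p.1 x I).
  exact: (cvg_comp _ _ cvg_fst c).
exact: (mpderiv_joint openT).
Qed.

End Products.

Section Support.
Variables (R : realType) (d : nat).
Local Notation V := 'rV[R]_d.
Local Notation C := R[i].
Implicit Types (f g h phi : Cinf [set: V]) (U K : set V).
Variable T : Cinf [set: V] -> R[i]^o.
Hypotheses (lT : linear T) (cT : continuous T).

(** A partition of unity in multiplicative form: products of functions 1 - chi
    with chi supported where T vanishes do not change the value of T. *)
Definition neutral_factor phi := forall f, T (cmul phi f) = T f.

(** A cutoff that is 1 near a carrier replaces h by a function g with compact
    support.  A point of the support of g is not in the support of T, because h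
    vanishes near the latter; so near it some neutral factor vanishes.  By
    compactness the product of finitely many of them kills g. *)
Lemma form_vanish h : set_nbhs (dsupp T) [set x | h x = 0] -> T h = 0.
Proof.
move=> h0; have [K0 [cK0 _ K0T]] := form_carrier openT lT cT.
have [chi [chi1 cchi _]] := cutoff cK0 openT (@subsetT _ K0).
have -> : T h = T (cmul chi h).
  apply/eqP; rewrite -subr_eq0; apply/eqP; rewrite -(linear_mapB lT).
  apply: K0T; apply: filterS chi1 => x chix.
  by rewrite /mkset CinfB cmulE chix mul1r subrr.
set g := cmul chi h.
have cg : compact (fsupp g).
  by apply: (subclosed_compact _ cchi); [exact: closed_closure|exact: fsupp_cmul].
pose F := filter_from neutral_factor
  (fun u => [set w | neutral_factor w /\ forall x, u x = 0 -> w x = 0]).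
have FF : Filter F.
  apply: filter_from_filter.
    exists (Cinf_of setT (fun=> 1)) => f; congr T; apply: Cinf_ext => x _.
    by rewrite cmulE (Cinf_ofS openT) ?mul1r//; exact: smooth_cst.
  move=> u v nu nv; exists (cmul u v) => [f|w [nw uw]].
    by rewrite -cmulA nu nv.
  by split; split => // x x0; apply: uw; rewrite cmulE x0 ?mul0r ?mulr0.
have : \near F, fsupp g `<=` (fun (w : Cinf [set: V]) x => w x = 0) F.
  move/compact_near_coveringP : cg; apply => x gx.
  have [U [oU UT] Ux] : (\bigcup_(U in [set U | open U /\ vanishes_on T U]) U) x.
    apply: contrapT => nx; have := h0 x nx => hx0.
    have [y [gy hy]] := gx _ hx0.
    by move: gy; rewrite /= /g cmulE (hy : h y = 0) mulr0 eqxx.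
  have Kx : [set x] `<=` U by move=> _ ->.
  have [rho [rho1 crho rhoU]] := cutoff (@compact_set1 _ x) oU Kx.
  have [u uE] : exists u : Cinf [set: V], forall y, u y = 1 - rho y.
    exists (Cinf_of setT (fun=> 1) - rho) => y.
    by rewrite CinfB (Cinf_ofS openT)//; exact: smooth_cst.
  exists ([set y | rho y = 1], [set w | neutral_factor w /\ forall x, u x = 0 -> w x = 0]).
    split => /=; first exact: rho1.
    exists u => // f.
    have -> : cmul u f = f - cmul rho f.
      by apply: Cinf_ext => y _; rewrite cmulE uE CinfB cmulE mulrBl mul1r.
    rewrite (linear_mapB lT) (UT (cmul rho f)) ?subr0//.
      apply: (subclosed_compact _ crho); [exact: closed_closure|exact: fsupp_cmul].
    exact: subset_trans (@fsupp_cmul _ _ _ _) rhoU.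
  by move=> [y w] [/= rhoy [_ uw]]; apply: uw; rewrite uE rhoy subrr.
case=> u nu ug; rewrite -(nu g).
have -> : cmul u g = 0.
  apply: Cinf_ext => x _; rewrite cmulE.
  have [gx|/fsupp_out ->] := pselect (fsupp g x); last by rewrite mulr0.
  by rewrite (ug u _ x gx) ?mul0r.
exact: linear_map0.
Qed.

Lemma germ_ext_unique (k : V -> C) g h : germ_ext T k g -> germ_ext T k h -> T g = T h.
Proof.
move=> gk hk; apply/eqP; rewrite -subr_eq0; apply/eqP; rewrite -(linear_mapB lT).
apply: form_vanish => x Tx; apply: filterS2 (gk x Tx) (hk x Tx) => y gy hy.
by rewrite /mkset CinfB (gy : g y = k y) (hy : h y = k y) subrr.
Qed.

Lemma pairingE (k : V -> C) g : germ_ext T k g -> pairing T k = T g.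
Proof.
move=> gk; rewrite /pairing.
have : exists z, [set T g | g in germ_ext T k] z by exists (T g), g.
by move=> /(xgetPex 0)[h hk <-]; exact: germ_ext_unique hk gk.
Qed.

Lemma germ_ext_cut U (k : V -> C) (psi : Cinf [set: V]) : open U -> smooth_on U k ->
  set_nbhs (dsupp T) [set y | psi y = 1] -> fsupp psi `<=` U ->
  germ_ext T k (Cinf_of setT (fun y => psi y * k y)).
Proof.
move=> oU sk psi1 psiU x Tx; apply: filterS (psi1 x Tx) => y /= psiy.
rewrite (Cinf_ofS openT)//; last exact: (smooth_cutoff oU psiU sk).
by rewrite psiy mul1r.
Qed.

Lemma open_dsuppC : open (~` dsupp T).
Proof. by rewrite /dsupp setCK; apply: bigcup_open => U []. Qed.

Lemma closed_dsupp : closed (dsupp T).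
Proof. by rewrite -[dsupp T]setCK; apply: open_closedC; exact: open_dsuppC. Qed.

Lemma dsupp_sub K : closed K -> (vanishes_on T (~` K)) -> dsupp T `<=` K.
Proof.
move=> cK vK x Tx; apply: contrapT => nK; apply: Tx.
by exists (~` K) => //; split => //; exact: closed_openC.
Qed.

End Support.

(** * The operator of a distribution supported in the dilation set *)

Section DilationKernel.
Variables (R : realType) (d : nat) (Omega : set 'rV[R]_d).
Local Notation V := 'rV[R]_d.
Local Notation C := R[i].
Implicit Types (x y : V) (f : V -> C) (psi : Cinf [set: V]).
Hypothesis oO : open Omega.

(** The integrand psi(y) f(xy) as a function on R^(d+d), the shape to which
    differentiation under T applies; the cutoff psi makes it defined for all y.
    *)
Definition kernel psi f (z : 'rV[R]_(d + d)) : C :=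
  psi (rsubmx z) * f (hprod (lsubmx z) (rsubmx z)).

Definition kernel_dom psi : set 'rV[R]_(d + d) :=
  [set z | ~ fsupp psi (rsubmx z) \/ Omega (hprod (lsubmx z) (rsubmx z))].

Definition dilation_dom psi : set V :=
  [set x | forall y, fsupp psi y -> Omega (hprod x y)].

Lemma cvg_rsubmx (z : 'rV[R]_(d + d)) : rsubmx w @[w --> z] --> rsubmx z.
Proof.
apply: (@cvg_coords _ _ _ (nbhs z) (nbhs_filter z)) => j; rewrite mxE; under eq_fun do rewrite mxE.
exact: coord_continuous.
Qed.

Lemma cvg_lsubmx (z : 'rV[R]_(d + d)) : lsubmx w @[w --> z] --> lsubmx z.
Proof.
apply: (@cvg_coords _ _ _ (nbhs z) (nbhs_filter z)) => j; rewrite mxE; under eq_fun do rewrite mxE.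
exact: coord_continuous.
Qed.

Lemma open_rsubmx (U : set V) : open U -> open [set z : 'rV[R]_(d + d) | U (rsubmx z)].
Proof. by move=> oU; apply: (open_comp _ oU) => z _; exact: cvg_rsubmx. Qed.

Lemma open_mul : open [set z : 'rV[R]_(d + d) | Omega (hprod (lsubmx z) (rsubmx z))].
Proof.
apply: (@open_comp _ _ (fun z : 'rV[R]_(d + d) => hprod (lsubmx z) (rsubmx z)) _ _ oO) => z _.
have := @cvg_hprod R d _ (nbhs z) (nbhs_filter z) _ _ _ _ (@cvg_lsubmx z) (@cvg_rsubmx z).
exact.
Qed.

Lemma open_kernel_dom psi : open (kernel_dom psi).
Proof. by apply: openU; [exact: (open_rsubmx (@open_fsuppC _ _ psi))|exact: open_mul]. Qed.

Lemma open_dilation_dom psi : compact (fsupp psi) -> open (dilation_dom psi).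
Proof.
move=> /compact_near_coveringP cp; rewrite openE => x px.
have : \forall x' \near x, fsupp psi `<=` (fun y => Omega (hprod x' y)).
  apply: (cp _ (nbhs x) (fun x' y => Omega (hprod x' y)) (nbhs_filter x)) => y /px Oxy.
  have c : (fun p : V * V => hprod p.2 p.1) @ filter_prod (nbhs y) (nbhs x) --> hprod x y.
    by apply: cvg_hprod; [exact: cvg_snd|exact: cvg_fst].
  by apply: c; exact: open_nbhs_nbhs.
by apply: filterS.
Qed.

Lemma smooth_kernel psi f : smooth_on Omega f -> smooth_on (kernel_dom psi) (kernel psi f).
Proof.
move=> sf; apply: (@smooth_cut _ _ _ [set z | ~ fsupp psi (rsubmx z)]
    [set z | Omega (hprod (lsubmx z) (rsubmx z))]) => //.
- exact: open_kernel_dom.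
- exact: (open_rsubmx (@open_fsuppC _ _ psi)).
- exact: open_mul.
- apply: (smooth_comp (U := setT)) => //; first exact: open_kernel_dom.
    move=> j; have -> : (fun z : 'rV[R]_(d + d) => (rsubmx z 0 j)%:C%C) =
      (fun z => (z 0 (rshift d j))%:C%C) by apply/funext => z; rewrite mxE.
    by apply: smooth_coord; exact: open_kernel_dom.
  exact: smooth_Cinf openT _.
- apply: (smooth_comp (U := Omega)) => //; first exact: open_mul.
  move=> j; have -> : (fun z : 'rV[R]_(d + d) => (hprod (lsubmx z) (rsubmx z) 0 j)%:C%C) =
    (fun z => (z 0 (lshift d j))%:C%C * (z 0 (rshift d j))%:C%C).
    by apply/funext => z; rewrite !mxE rmorphM.
  by apply: smooth_onM; [exact: open_mul|apply: smooth_coord; exact: open_mul..].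
- by move=> z; exact: fsupp_out.
Qed.

Lemma kernel_row psi f x y : kernel psi f (row_mx x y) = psi y * f (hprod x y).
Proof. by rewrite /kernel row_mxKl row_mxKr. Qed.

Lemma dilation_dom_kernel psi x y : dilation_dom psi x -> kernel_dom psi (row_mx x y).
Proof.
move=> px; rewrite /kernel_dom /mkset row_mxKl row_mxKr.
by have [/px|] := pselect (fsupp psi y); [right|left].
Qed.

Lemma mpderiv_kernel psi f s x y : smooth_on Omega f -> dilation_dom psi x ->
  mpderiv (map (@lshift d d) s) (kernel psi f) (row_mx x y) =
  psi y * (wmono y s * mpderiv s f (hprod x y)).
Proof.
move=> sf px.
have -> : mpderiv (map (@lshift d d) s) (kernel psi f) (row_mx x y) =
    mpderiv s (fun x => kernel psi f (row_mx x y)) x by rewrite mpderiv_lslice.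
have -> : (fun x => kernel psi f (row_mx x y)) = (fun x => psi y * f (hprod y x)).
  by apply/funext => x'; rewrite kernel_row hprodC.
have [py|py] := pselect (fsupp psi y).
  have Oxy := px y py; rewrite hprodC in Oxy.
  rewrite (@mpderivZ _ _ [set x | Omega (hprod y x)])//.
  - by rewrite (mpderiv_hprod s oO sf Oxy) (hprodC x).
  - exact: open_hprod.
  - exact: smooth_on_hprod.
have -> : (fun x => psi y * f (hprod y x)) = (fun=> 0).
  by apply/funext => x'; rewrite (fsupp_out py) mul0r.
rewrite (fsupp_out py) mul0r; case: (s) => [//|i t]; exact: mpderiv_cst.
Qed.

Lemma smooth_wmono s : smooth_on setT (fun y : V => wmono y s).
Proof.
elim: s => [|i s IH].
  have -> : (fun y : V => wmono y [::]) = fun=> 1.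
    by apply/funext => y; rewrite /wmono big_nil.
  exact: smooth_cst.
have -> : (fun y : V => wmono y (i :: s)) = fun y => (y 0 i)%:C%C * wmono y s.
  by apply/funext => y; rewrite /wmono big_cons rmorphM.
by apply: smooth_onM => //; [exact: openT|apply: smooth_coord; exact: openT].
Qed.

End DilationKernel.

Section DilationOperator.
Variables (R : realType) (d : nat) (Omega : set 'rV[R]_d).
Local Notation V := 'rV[R]_d.
Local Notation C := R[i].
Implicit Types (x y : V) (f : Cinf Omega) (psi g : Cinf [set: V]).
Hypothesis oO : open Omega.
Variable T : Cinf [set: V] -> R[i]^o.
Hypothesis ET : Edist (dilation_set Omega) T.

Let lT : linear T. Proof. by case: ET. Qed.
Let cT : continuous T. Proof. by case: ET. Qed.
Let kT : compact (dsupp T). Proof. by case: ET. Qed.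
Let sT : dsupp T `<=` dilation_set Omega. Proof. by case: ET. Qed.

Let good psi := set_nbhs (dsupp T) [set y | psi y = 1] /\ compact (fsupp psi).

Lemma dsupp_dilation x y : Omega x -> dsupp T y -> Omega (hprod x y).
Proof. by move=> Ox /sT; rewrite hprodC; apply. Qed.

Lemma local_cutoff x : Omega x -> exists psi, good psi /\ dilation_dom Omega psi x.
Proof.
move=> Ox; have KU : dsupp T `<=` [set y | Omega (hprod x y)].
  by move=> y; exact: dsupp_dilation.
have [psi [p1 cp pU]] := cutoff kT (open_hprod (x := x) oO) KU.
by exists psi.
Qed.

Let slice psi (f : V -> C) x : Cinf [set: V] :=
  Cinf_of setT (fun y => psi y * f (hprod x y)).

Lemma germ_slice psi f x : good psi -> dilation_dom Omega psi x ->
  germ_ext T (fun y => f (hprod x y)) (slice psi f x).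
Proof.
move=> [p1 cp] px; apply: (germ_ext_cut (open_hprod (x := x) oO)) => //.
exact: smooth_on_hprod oO (smooth_Cinf oO f).
Qed.

Let pre f x := pairing T (fun y => f (hprod x y)).

Let pre_slice psi f x : good psi -> dilation_dom Omega psi x ->
  pre f x = form_slice T (kernel psi f) x.
Proof.
move=> gp px; rewrite /pre (pairingE lT cT (germ_slice f gp px)).
by rewrite /form_slice; congr (T (Cinf_of _ _)); apply/funext => y; rewrite kernel_row.
Qed.

Let dom psi := Omega `&` dilation_dom Omega psi.
Let oD psi : good psi -> open (dom psi).
Proof. by move=> [_ cp]; apply: openI => //; exact: open_dilation_dom. Qed.

Let smooth_pre f : smooth_on Omega (pre f).
Proof.
move=> s x Ox; have [psi [gp px]] := local_cutoff Ox.
have oW := open_dilation_dom oO (proj2 gp).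
have h : smooth_on (dilation_dom Omega psi) (form_slice T (kernel psi f)).
  apply: (smooth_form_slice lT cT (@open_kernel_dom _ _ _ oO psi) oW).
    by move=> y z; exact: dilation_dom_kernel.
  by apply: smooth_kernel => //; exact: smooth_Cinf.
have E y : dom psi y -> form_slice T (kernel psi f) y = pre f y.
  by move=> [Oy py]; rewrite -(pre_slice f gp py).
have h' : smooth_on (dom psi) (form_slice T (kernel psi f)) by apply: smooth_onS h => y [].
exact: (eq_smooth_on (oD gp) E h' s (conj Ox px)).
Qed.

Lemma Mop_pairing f x : Omega x -> Mop Omega T f x = pairing T (fun y => f (hprod x y)).
Proof. by move=> Ox; rewrite /Mop (Cinf_ofS oO)//; exact: smooth_pre. Qed.

Lemma Mop_germ f x g : Omega x -> germ_ext T (fun y => f (hprod x y)) g ->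
  Mop Omega T f x = T g.
Proof. by move=> Ox fg; rewrite Mop_pairing// (pairingE lT cT fg). Qed.

Lemma germ_ext_exists f x : Omega x -> germ_ext T (fun y => f (hprod x y)) !=set0.
Proof.
move=> Ox; have [psi [gp px]] := local_cutoff Ox.
by exists (slice psi f x); exact: germ_slice.
Qed.

Lemma Mop_wd : Mop_well_defined Omega T.
Proof. by move=> f x Ox; split; [exact: germ_ext_exists|move=> g; exact: Mop_germ]. Qed.

Lemma Mop_linear : linear (Mop Omega T).
Proof.
move=> a f g; apply: Cinf_ext => x Ox.
have [k kf] := germ_ext_exists f Ox; have [l lg] := germ_ext_exists g Ox.
rewrite CinfD CinfZ (Mop_germ Ox kf) (Mop_germ Ox lg) -[RHS]lT.
apply: Mop_germ => // y Ty; apply: filterS2 (kf y Ty) (lg y Ty) => z kz lz.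
by rewrite /mkset CinfD CinfZ (kz : k z = _) (lz : l z = _).
Qed.

Lemma mpderiv_Mop psi f s x : good psi -> Omega x -> dilation_dom Omega psi x ->
  mpderiv s (Mop Omega T f) x =
  T (Cinf_of setT (fun y => psi y * (wmono y s * mpderiv s f (hprod x y)))).
Proof.
move=> gp Ox px.
transitivity (mpderiv s (form_slice T (kernel psi f)) x).
  apply: (eq_on_mpderiv (oD gp)) => // y [Oy py].
  by rewrite Mop_pairing// -(pre_slice f gp py).
have oW := open_dilation_dom oO (proj2 gp).
rewrite (@mpderiv_form_slice _ _ _ T lT cT _ _ (@open_kernel_dom _ _ _ oO psi) oW) //; last first.
- by apply: smooth_kernel => //; exact: smooth_Cinf.
- by move=> y z; exact: dilation_dom_kernel.
rewrite /form_slice; congr (T (Cinf_of _ _)); apply/funext => y.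
exact: (@mpderiv_kernel _ _ Omega oO psi f s x y (smooth_Cinf oO f) px).
Qed.

(** Multiplying by a cutoff makes the dilated derivatives depend continuously
    on the dilation and on the function jointly, which is the continuity of
    the dilation operator. *)
Lemma Mop_continuous : continuous (Mop Omega T).
Proof.
apply: (cinf_continuous oO) => f s x0 Ox0.
have [psi [gp px0]] := local_cutoff Ox0.
have sA : smooth_on setT (fun y => psi y * wmono y s).
  apply: smooth_onM; [exact: openT|exact: smooth_Cinf openT _|exact: smooth_wmono].
set A := fun y => psi y * wmono y s in sA.
(* The derivative of M_T g at x is T (H (x, g)), and H is jointly continuous
   with values in the smooth functions on R^d. *)
pose H (p : V * Cinf Omega) : Cinf [set: V] :=
  Cinf_of setT (fun y => A y * mpderiv s p.2 (hprod p.1 y)).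
have HE x (g : Cinf Omega) : Omega x -> dilation_dom Omega psi x ->
    mpderiv s (Mop Omega T g) x = T (H (x, g)).
  move=> Ox px; rewrite (mpderiv_Mop g s gp Ox px); congr (T (Cinf_of _ _)).
  by apply/funext => y; rewrite /A mulrA.
have sg x (g : Cinf Omega) : smooth_on [set y | Omega (hprod x y)] (fun y => mpderiv s g (hprod x y)).
  exact: smooth_on_hprod oO (smooth_on_mpderiv s (smooth_Cinf oO g)).
have zA y : ~ fsupp psi y -> A y = 0 by move=> /fsupp_out; rewrite /A => ->; rewrite mul0r.
have sH x (g : Cinf Omega) : dilation_dom Omega psi x ->
    smooth_on setT (fun y => A y * mpderiv s g (hprod x y)).
  move=> px; apply: (@smooth_cut _ _ _ (~` fsupp psi) [set y | Omega (hprod x y)]) => //.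
  - exact: openT.
  - exact: open_fsuppC.
  - exact: open_hprod.
  - by move=> y _; have [/px|] := pselect (fsupp psi y); [right|left].
have cH : H @ filter_prod (nbhs x0) (nbhs f) --> H (x0, f).
  apply/(cinf_cvgP openT) => t y0 _.
  have npx : nbhs x0 (dilation_dom Omega psi).
    have oWd := open_dilation_dom oO (proj2 gp).
    by apply: open_nbhs_nbhs; split.
  have [py0|py0] := pselect (fsupp psi y0); last first.
    have z x (g : Cinf Omega) y : ~ fsupp psi y -> dilation_dom Omega psi x -> mpderiv t (H (x, g)) y = 0.
      move=> py px; rewrite (mpderiv_Cinf_of openT)//; last exact: sH.
      have -> : mpderiv t (fun y => A y * mpderiv s g (hprod x y)) y = mpderiv t (fun=> 0) y.
        by apply: (eq_on_mpderiv (@open_fsuppC _ _ psi)) => // w /zA ->; rewrite mul0r.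
      by case: (t) => [//|i t']; rewrite mpderiv_cst.
    rewrite z//; apply: cvg_near_cst.
    exists (~` fsupp psi, [set p | dilation_dom Omega psi p.1]).
      split; first by apply: open_nbhs_nbhs; split => //; exact: open_fsuppC.
      by exists (dilation_dom Omega psi, setT); [split => //; exact: filterT|move=> p []].
    by move=> [y [x g]] [/= py px]; rewrite z.
  have Oxy0 := px0 y0 py0.
  have E x (g : Cinf Omega) y : dilation_dom Omega psi x -> Omega (hprod x y) -> mpderiv t (H (x, g)) y =
      \sum_(p <- splits t) mpderiv p.1 A y * (wmono x p.2 * mpderiv (p.2 ++ s) g (hprod x y)).
    move=> px Oxy; rewrite (mpderiv_Cinf_of openT)//; last exact: sH.
    rewrite (@mpderivM _ _ [set y | Omega (hprod x y)])//.
    - apply: eq_bigr => p _.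
      rewrite (mpderiv_hprod _ oO (smooth_on_mpderiv s (smooth_Cinf oO g)) Oxy).
      by rewrite -mpderiv_cat.
    - exact: open_hprod.
    - exact: smooth_onS sA.
  rewrite E//.
  pose G := filter_prod (nbhs y0) (filter_prod (nbhs x0) (nbhs f)).
  have c1 : (fun q : V * (V * Cinf Omega) => q.1) @ G --> y0 by exact: cvg_fst.
  have c2 : (fun q : V * (V * Cinf Omega) => q.2.1) @ G --> x0.
    exact: (cvg_comp _ _ cvg_snd cvg_fst).
  have c3 : (fun q : V * (V * Cinf Omega) => q.2.2) @ G --> f.
    exact: (cvg_comp _ _ cvg_snd cvg_snd).
  have c4 := cvg_hprod c2 c1.
  have h : (fun q : V * (V * Cinf Omega) => \sum_(p <- splits t)
      mpderiv p.1 A q.1 * (wmono q.2.1 p.2 * mpderiv (p.2 ++ s) q.2.2 (hprod q.2.1 q.1)) : R[i]^o) @ G -->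
     (\sum_(p <- splits t) mpderiv p.1 A y0 *
       (wmono x0 p.2 * mpderiv (p.2 ++ s) f (hprod x0 y0)) : R[i]^o).
    apply: cvgc_sum => p; apply: cvgcM.
      exact: (cvg_comp _ _ c1 (cdiff_continuous (sA p.1 y0 I))).
    apply: cvgcM.
      exact: (cvg_comp _ _ c2 (cdiff_continuous (@smooth_wmono _ _ p.2 [::] x0 I))).
    have c5 := @mpderiv_joint _ _ _ oO (p.2 ++ s) _ f Oxy0.
    apply: (cvg_comp (fun q : V * (V * Cinf Omega) => (hprod q.2.1 q.1, q.2.2)) _ _ c5).
    move=> B [[N W'] [/= nN nW] sub].
    have h1 : G [set q | N (hprod q.2.1 q.1)] by exact: c4 nN.
    have h2 : G [set q | W' q.2.2] by exact: c3 nW.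
    by apply: filterS2 h1 h2 => q Nq Wq; apply: sub.
  apply: cvg_trans h; apply: near_eq_cvg.
  have n1 : G [set q | Omega (hprod q.2.1 q.1)].
    by apply: c4; exact: open_nbhs_nbhs.
  have n2 : G [set q | dilation_dom Omega psi q.2.1] by exact: c2 npx.
  by apply: filterS2 n1 n2 => -[y [x g]] /= Oxy px; rewrite E.
rewrite HE//.
have cTH : (fun p => T (H p)) @ filter_prod (nbhs x0) (nbhs f) --> (T (H (x0, f)) : R[i]^o).
  by apply: (cvg_comp _ _ cH); exact: cT.
apply: cvg_trans cTH; apply: near_eq_cvg.
exists (dom psi, setT).
  by split; [apply: open_nbhs_nbhs; split => //; exact: oD|exact: filterT].
by move=> [x g] [[/= Ox px] _]; rewrite HE.
Qed.

Lemma monomial_hprod alpha x y :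
  monomial alpha (hprod x y) = monomial alpha x * monomial alpha y.
Proof.
rewrite /monomial -rmorphM -big_split /=; congr (_%:C%C).
by apply: eq_bigr => i _; rewrite mxE exprMn.
Qed.

Lemma smooth_monomial_on (U : set V) alpha : open U -> smooth_on U (@monomial R d alpha).
Proof. by move=> oU; apply/smooth_onP => // x _; exact: smooth_monomial. Qed.

Lemma Mop_monomial alpha :
  Mop Omega T (Cinf_of Omega (monomial alpha)) =
  T (Cinf_of setT (monomial alpha)) *: Cinf_of Omega (monomial alpha).
Proof.
have oT := @openT V.
apply: Cinf_ext => x Ox; rewrite CinfZ (Cinf_ofS oO)//; last exact: smooth_monomial_on.
rewrite mulrC -[RHS]/(monomial alpha x *: (T _ : C^o)) -(linear_mapZ lT).
apply: Mop_germ => // y Ty.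
have : \forall z \near y, Omega (hprod x z).
  by apply: open_nbhs_nbhs; split; [exact: open_hprod|exact: dsupp_dilation].
apply: filterS => z Oz; rewrite /mkset CinfZ !Cinf_ofS//; try exact: smooth_monomial_on.
by rewrite monomial_hprod.
Qed.

Lemma Mop_Hadamard : Hadamard Omega (Mop Omega T).
Proof.
split; first by split; [exact: Mop_linear|exact: Mop_continuous].
by move=> alpha; exists (T (Cinf_of setT (monomial alpha))); exact: Mop_monomial.
Qed.

End DilationOperator.

(** * Multiplicative convolution *)

Section DistributionAlgebra.
Variables (R : realType) (d : nat).
Local Notation V := 'rV[R]_d.
Local Notation C := R[i].
Local Notation form := (Cinf [set: V] -> R[i]^o).
Implicit Types (T S : form) (f g : Cinf [set: V]) (A K N U : set V) (x y z : V).

Lemma dsupp_lin a T S : dsupp (a *: T + S) `<=` dsupp T `|` dsupp S.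
Proof.
move=> x; apply: contraPP => /not_orP[/contrapT[U [oU UT] Ux] /contrapT[N [oN NS] Nx]].
apply; exists (U `&` N) => //; split; first exact: openI.
move=> phi cphi pUN; rewrite !fctE UT// ?NS ?scaler0 ?addr0//.
- by move=> y /pUN[].
- by move=> y /pUN[].
Qed.

Lemma form_lin a T S : linear T -> continuous T -> linear S -> continuous S ->
  linear (a *: T + S) /\ continuous (a *: T + S).
Proof.
move=> lT cT lS cS; split.
  move=> b f g; rewrite !fctE lT lS scalerDr addrACA scalerDr; congr (_ + _).
  by rewrite addrC !scalerA mulrC addrC.
move=> f; apply: (@cvgcD R _ (nbhs f) (nbhs_filter f) (fun g => a * T g) S _ _ _ (cS f)).
exact: (@cvgcM R _ (nbhs f) (nbhs_filter f) (fun=> a) T a _ (cvg_cst _) (cT f)).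
Qed.

Lemma Edist_lin A a T S : Edist A T -> Edist A S -> Edist A (a *: T + S).
Proof.
move=> [lT cT kT TA] [lS cS kS SA]; have [lD cD] := form_lin a lT cT lS cS.
split => //.
- apply: (subclosed_compact _ (compactU kT kS)); [exact: closed_dsupp|exact: dsupp_lin].
- by move=> x /dsupp_lin[/TA|/SA].
Qed.

Lemma Edist0 A : Edist A (0 : form).
Proof.
have s0 : dsupp (0 : form) = set0.
  rewrite -subset0 => x; apply.
  by exists setT => //; split => //; exact: openT.
split; rewrite ?s0//; last exact: compact0.
- by move=> a f g; have z h : (0 : form) h = 0 by []; rewrite !z scaler0 addr0.
- by move=> f; have := @cvg_cst R[i]^o (0 : R[i]^o) _ (nbhs f) (nbhs_filter f); exact.
Qed.

Lemma EdistT A T : Edist A T -> Edist (dilation_set setT) T.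
Proof. by case. Qed.

Lemma Mop_setT S f x : Edist (dilation_set setT) S ->
  Mop setT S f x = S (Cinf_of setT (fun y => f (hprod x y))).
Proof.
move=> ES; apply: (Mop_germ openT ES) => // y _; apply: filterE => z.
by apply: (Cinf_ofE openT) => // w _; exact: smooth_hprod.
Qed.

(** On the whole space germs disappear: the convolution is T composed with the
    operator of S and inherits its continuity. *)
Lemma starE T S f : Edist (dilation_set setT) S -> star T S f = T (Mop setT S f).
Proof.
move=> ES; rewrite /star.
have -> : (fun x => S (Cinf_of setT (fun y => f (hprod x y)))) = Mop setT S f.
  by apply/funext => x; rewrite Mop_setT.
congr T; apply: Cinf_ext => x _; apply: (Cinf_ofS openT) => //.
exact: smooth_Cinf openT _.
Qed.

Lemma star_wd T S : Edist (dilation_set setT) S -> star_well_defined T S.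
Proof.
by move=> ES f; exists (Mop setT S f); [move=> x; exact: Mop_setT|exact: starE].
Qed.

(** The tube lemma for multiplication. *)
Lemma tube (K1 K2 N : set V) : compact K2 -> open N ->
  (forall y z, K1 y -> K2 z -> N (hprod y z)) ->
  set_nbhs K1 [set y | forall z, K2 z -> N (hprod y z)].
Proof.
move=> /compact_near_coveringP cK oN KN y Ky.
have := cK _ (nbhs y) (fun y' z => N (hprod y' z)) (nbhs_filter y).
apply => z Kz.
have c : (fun p : V * V => hprod p.2 p.1) @ filter_prod (nbhs z) (nbhs y) --> hprod y z.
  by apply: cvg_hprod; [exact: cvg_snd|exact: cvg_fst].
by apply: c; apply: open_nbhs_nbhs; split => //; exact: KN.
Qed.

Definition hprod_set (K1 K2 : set V) : set V :=
  [set hprod p.1 p.2 | p in K1 `*` K2].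

Lemma compact_hprod_set K1 K2 : compact K1 -> compact K2 -> compact (hprod_set K1 K2).
Proof.
move=> c1 c2; apply: continuous_compact; last exact: compact_setX.
apply: continuous_subspaceT => p.
by apply: (@cvg_hprod _ _ _ (nbhs p) (nbhs_filter p)); [exact: cvg_fst|exact: cvg_snd].
Qed.

Lemma closed_hprod_set K1 K2 : compact K1 -> compact K2 -> closed (hprod_set K1 K2).
Proof.
by move=> c1 c2; apply: compact_closed; [exact: norm_hausdorff|exact: compact_hprod_set].
Qed.

(** If phi is supported off supp T supp S, then by the tube lemma y |-> S_z
    phi(yz) vanishes near supp T. *)
Lemma dsupp_star A T S : Edist A T -> Edist A S ->
  dsupp (star T S) `<=` hprod_set (dsupp T) (dsupp S).
Proof.
move=> ET ES; have [lT cT kT _] := ET; have [lS cS kS _] := ES.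
have ES' := EdistT ES.
apply: dsupp_sub; first exact: closed_hprod_set.
move=> phi _ phiP; rewrite starE//; apply: (form_vanish lT cT).
have : set_nbhs (dsupp T) [set y | forall z, dsupp S z -> ~ fsupp phi (hprod y z)].
  apply: (@tube _ _ (~` fsupp phi)) => //; first exact: open_fsuppC.
  by move=> y z Ty Sz /phiP; apply; exists (y, z).
move=> h v /h; apply: filterS => y yS; rewrite /mkset Mop_setT//; apply: (form_vanish lS cS) => z Sz.
have : \forall w \near z, ~ fsupp phi (hprod y w).
  apply: open_nbhs_nbhs; split; last exact: yS.
  exact: (open_hprod (x := y) (@open_fsuppC _ _ phi)).
apply: filterS => w nw; rewrite /mkset (Cinf_ofE openT)//; first exact: fsupp_out.
by move=> u _; exact: smooth_hprod.
Qed.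

Lemma Edist_star (Omega : set V) T S : Edist (dilation_set Omega) T ->
  Edist (dilation_set Omega) S -> Edist (dilation_set Omega) (star T S).
Proof.
move=> ET ES; have [lT cT kT TO] := ET; have [lS cS kS SO] := ES.
have ES' := EdistT ES.
have E : star T S = T \o Mop setT S by apply/funext => f; rewrite starE.
have sP := dsupp_star ET ES.
split.
- by move=> a f g; rewrite E /= (Mop_linear openT ES') lT.
- move=> f; rewrite E; apply: (cvg_comp _ _ (@Mop_continuous _ _ _ openT _ ES' f)).
  exact: cT.
- by apply: (subclosed_compact _ (compact_hprod_set kT kS)); [exact: closed_dsupp|].
- move=> _ /sP[[y z] [/= Ty Sz] <-] x Ox; rewrite -hprodA.
  by apply: TO => //; exact: SO.
Qed.

(** Given x in Omega, a cutoff replaces f(x .) by a smooth function g on R^d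
    that equals it near supp T supp S; associativity of the product turns both
    sides into T_y S_z g(yz). *)
Lemma Mop_star (Omega : set V) T S : open Omega -> Edist (dilation_set Omega) T ->
  Edist (dilation_set Omega) S -> Mop Omega (star T S) = Mop Omega T \o Mop Omega S.
Proof.
move=> oO ET ES; have [lT cT kT TO] := ET; have [lS cS kS SO] := ES.
have ES' := EdistT ES; have sP := dsupp_star ET ES.
apply/funext => f; apply: Cinf_ext => x Ox /=.
set P := hprod_set (dsupp T) (dsupp S) in sP.
have PU : P `<=` [set w | Omega (hprod x w)].
  move=> _ [[y z] [/= Ty Sz] <-]; rewrite /mkset hprodA.
  exact/(dsupp_dilation ES)/Sz/(dsupp_dilation ET).
have oU := open_hprod (x := x) oO.
have [psi [p1 _ pU]] := cutoff (compact_hprod_set kT kS) oU PU.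
pose g : Cinf [set: V] := Cinf_of setT (fun w => psi w * f (hprod x w)).
have gP : set_nbhs P [set w | g w = f (hprod x w)].
  move=> v Kv; apply: filterS (p1 v Kv) => w pw; rewrite /mkset /g (Cinf_ofS openT)//.
    by rewrite (pw : psi w = 1) mul1r.
  exact: (smooth_cutoff oU pU (smooth_on_hprod oO (smooth_Cinf oO f))).
have [N [oN PN Ng]] := iffLR (set_nbhsP _ _) gP.
rewrite (@Mop_germ _ _ _ oO _ (Edist_star ET ES) f x g)//; last first.
  by move=> w /sP Pw; exact: gP.
rewrite starE//; symmetry; apply: (Mop_germ oO ET Ox).
have n1 : set_nbhs (dsupp T) [set y | Omega (hprod x y)].
  by move=> y Ty; apply: open_nbhs_nbhs; split; [exact: oU|exact: (dsupp_dilation ET Ox Ty)].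
have n2 : set_nbhs (dsupp T) [set y | forall z, dsupp S z -> N (hprod y z)].
  by apply: tube => // y z Ty Sz; apply: PN; exists (y, z).
move=> v Tv; apply: filterS2 (n1 v Tv) (n2 v Tv) => y Oxy yS; rewrite /mkset Mop_setT//; symmetry.
apply: (Mop_germ oO ES (_ : Omega (hprod x y))) => // z Sz.
have : \forall w \near z, N (hprod y w).
  by apply: open_nbhs_nbhs; split; [exact: (open_hprod (x := y) oN)|exact: yS].
apply: filterS => w Nw; rewrite /mkset (Cinf_ofE openT)//.
  by rewrite (Ng _ Nw : g _ = _) hprodA.
by move=> u _; exact: smooth_hprod.
Qed.

Lemma Mop_lin (Omega : set V) a T S : open Omega -> Edist (dilation_set Omega) T ->
  Edist (dilation_set Omega) S -> Mop Omega (a *: T + S) = a *: Mop Omega T + Mop Omega S.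
Proof.
move=> oO ET ES; have [lT cT kT TO] := ET; have [lS cS kS SO] := ES.
apply/funext => f; apply: Cinf_ext => x Ox.
have oU := open_hprod (x := x) oO.
have KU : dsupp T `|` dsupp S `<=` [set w | Omega (hprod x w)].
  by move=> y [Ty|Sy]; [exact: (dsupp_dilation ET Ox Ty)|exact: (dsupp_dilation ES Ox Sy)].
have [psi [p1 _ pU]] := cutoff (compactU kT kS) oU KU.
pose g : Cinf [set: V] := Cinf_of setT (fun w => psi w * f (hprod x w)).
have gP : set_nbhs (dsupp T `|` dsupp S) [set w | g w = f (hprod x w)].
  move=> v Kv; apply: filterS (p1 v Kv) => w pw; rewrite /mkset /g (Cinf_ofS openT)//.
    by rewrite (pw : psi w = 1) mul1r.
  exact: (smooth_cutoff oU pU (smooth_on_hprod oO (smooth_Cinf oO f))).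
rewrite (@Mop_germ _ _ _ oO _ (Edist_lin a ET ES) f x g)//; last first.
  by move=> w /dsupp_lin Kw; exact: gP.
rewrite !fctE CinfD CinfZ (@Mop_germ _ _ _ oO _ ET f x g)//; last first.
  by move=> w Tw; apply: gP; left.
rewrite (@Mop_germ _ _ _ oO _ ES f x g)//.
by move=> w Sw; apply: gP; right.
Qed.

End DistributionAlgebra.

(** * Bernstein polynomials in one of several variables *)

Section DeCasteljau.
Variable R : realType.
Implicit Types (w v : nat -> R) (p c : R).

(** The value at p of the Bernstein polynomial with coefficients w_0 .. w_n. *)
Fixpoint casteljau n w p : R :=
  if n is n'.+1 then
    (1 - p) * casteljau n' w p + p * casteljau n' (fun k => w k.+1) p
  else w 0%N.

Lemma casteljau_lin n w v c p :
  casteljau n (fun k => w k + c * v k) p = casteljau n w p + c * casteljau n v p.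
Proof. by elim: n w v => [//|n IH] w v /=; rewrite !IH; ring. Qed.

Lemma casteljau_cst n c p : casteljau n (fun=> c) p = c.
Proof. by elim: n => [//|n /= ->]; ring. Qed.

Lemma casteljau_le n w v p : 0 <= p <= 1 -> (forall k, (k <= n)%N -> `|w k| <= v k) ->
  `|casteljau n w p| <= casteljau n v p.
Proof.
move=> /andP[p0 p1]; elim: n w v => [|n IH] w v wv /=; first exact: wv.
apply: le_trans (ler_normD _ _) _; apply: lerD; rewrite normrM ger0_norm ?subr_ge0//.
  apply: ler_wpM2l; first by rewrite subr_ge0.
  by apply: IH => k kn; apply: wv; exact: leqW.
by apply: ler_wpM2l => //; apply: IH => k kn; exact: wv.
Qed.

(** The second moment about c of the binomial law with parameters n and p. *)
Lemma casteljau_variance n c p :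
  casteljau n (fun k => (k%:R - c) ^+ 2) p = n%:R * (p * (1 - p)) + (n%:R * p - c) ^+ 2.
Proof.
elim: n c => [|n IH] c /=; first by ring.
rewrite IH.
have -> : (fun k => (k.+1%:R - c) ^+ 2) = (fun k => (k%:R - (c - 1)) ^+ 2) :> (nat -> R).
  by apply/funext => k; rewrite -natr1; congr (_ ^+ 2); ring.
by rewrite IH -natr1; ring.
Qed.

End DeCasteljau.

Section PartialBernstein.
Variables (R : realType) (d : nat) (i : 'I_d) (a : R).
Local Notation V := 'rV[R]_d.
Local Notation C := R[i].
Implicit Types (u : nat -> V -> C) (f g : V -> C) (x : V) (h t : R) (j : 'I_d).
Hypothesis a0 : 0 < a.

Definition barycentric x : R := (x 0 i + a) / (2 * a).

(** The Bernstein polynomial of degree n in the i-th coordinate, rescaled to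
    [-a, a]; its coefficients u_k may themselves depend on x. *)
Fixpoint bernstein n u : V -> C :=
  if n is n'.+1 then fun x =>
    (1 - (barycentric x)%:C%C) * bernstein n' u x
    + (barycentric x)%:C%C * bernstein n' (fun k => u k.+1) x
  else u 0%N.

Lemma Re_bernstein n u x :
  complex.Re (bernstein n u x) = casteljau n (fun k => complex.Re (u k x)) (barycentric x).
Proof.
elim: n u => [//|n IH] u /=; rewrite -(IH u) -(IH (fun k => u k.+1)).
case: (bernstein n u x) (bernstein n (fun k => u k.+1) x) => [? ?] [? ?] /=.
by ring.
Qed.

Lemma Im_bernstein n u x :
  complex.Im (bernstein n u x) = casteljau n (fun k => complex.Im (u k x)) (barycentric x).
Proof.
elim: n u => [//|n IH] u /=; rewrite -(IH u) -(IH (fun k => u k.+1)).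
case: (bernstein n u x) (bernstein n (fun k => u k.+1) x) => [? ?] [? ?] /=.
by ring.
Qed.

Lemma barycentricE : (fun x : V => (barycentric x)%:C%C) =
  (fun x => ((2 * a)^-1)%:C%C * (x 0 i)%:C%C + (a / (2 * a))%:C%C).
Proof.
by apply/funext => x; rewrite -rmorphM -rmorphD /barycentric mulrDl mulrC.
Qed.

Lemma smooth_barycentric : smooth_on setT (fun x : V => (barycentric x)%:C%C).
Proof.
rewrite barycentricE; have oT := @openT V.
apply: smooth_onD => //; last exact: smooth_cst.
by apply: smooth_onZ => //; exact: smooth_coord.
Qed.

Lemma pderiv_barycentric j x : pderiv j (fun x : V => (barycentric x)%:C%C) x =
  ((j == i)%:R / (2 * a))%:C%C.
Proof.
rewrite barycentricE; have sc := @smooth_coord R d setT i openT [::] x I.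
rewrite pderivD; [|by apply: cdiffM => //; exact: cdiff_cst|exact: cdiff_cst].
by rewrite pderiv_cst addr0 pderivZ// pderiv_coord -rmorphM mulrC.
Qed.

Lemma smooth_bernstein n u : (forall k, smooth_on setT (u k)) ->
  smooth_on setT (bernstein n u).
Proof.
have oT := @openT V.
elim: n u => [|n IH] u su; first exact: su.
apply: (@smooth_onD _ _ setT (fun x => (1 - (barycentric x)%:C%C) * bernstein n u x)
  (fun x => (barycentric x)%:C%C * bernstein n (fun k => u k.+1) x)) => //; apply: smooth_onM => //.
- have -> : (fun y : V => 1 - (barycentric y)%:C%C) = (fun y => 1 + (-1) * (barycentric y)%:C%C).
    by apply/funext => y; rewrite mulN1r.
  by apply: smooth_onD => //; [exact: smooth_cst|apply: smooth_onZ => //; exact: smooth_barycentric].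
- exact: IH.
- exact: smooth_barycentric.
- by apply: IH => k; exact: su.
Qed.

Lemma bernstein_lin n u (v : nat -> V -> C) (c : C) x :
  bernstein n (fun k y => u k y + c * v k y) x = bernstein n u x + c * bernstein n v x.
Proof. by elim: n u v => [//|n IH] u v /=; rewrite !IH; ring. Qed.

Lemma bernstein0 n x : bernstein n (fun _ _ => 0) x = 0.
Proof. by elim: n => [//|n IH] /=; rewrite !IH !mulr0 addr0. Qed.

(** Derivative of a Bernstein polynomial: differentiate the coefficients, and in
    the direction i of the barycentric variable take their differences. *)
Lemma pderiv_bernstein n u j x : (forall k, smooth_on setT (u k)) ->
  pderiv j (bernstein n u) x = bernstein n (fun k => pderiv j (u k)) x +
  ((j == i)%:R / (2 * a) * n%:R)%:C%C * bernstein n.-1 (fun k y => u k.+1 y + (-1) * u k y) x.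
Proof.
elim: n u => [|n IH] u su; first by rewrite mulr0 mul0r addr0.
have oT := @openT V.
have d1 : cdifferentiable (bernstein n u) x by exact: (smooth_bernstein n su [::]).
have d2 : cdifferentiable (bernstein n (fun k => u k.+1)) x.
  by apply: (smooth_bernstein n _ [::]) => // k; exact: su.
have dp : cdifferentiable (fun x => (barycentric x)%:C%C) x by exact: (smooth_barycentric [::]).
have E1 : (fun y : V => 1 - (barycentric y)%:C%C) = (fun y => (-1) * (barycentric y)%:C%C + 1).
  by apply/funext => y; rewrite mulN1r addrC.
have dq : cdifferentiable (fun x => 1 - (barycentric x)%:C%C) x.
  by rewrite E1; apply: cdiffD; [apply: cdiffM => //; exact: cdiff_cst|exact: cdiff_cst].
rewrite /= pderivD; [|exact: cdiffM|exact: cdiffM].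
rewrite !pderivM// !IH//.
rewrite E1 pderivD; [|by apply: cdiffM => //; exact: cdiff_cst|exact: cdiff_cst].
rewrite pderiv_cst addr0 pderivZ// pderiv_barycentric.
rewrite bernstein_lin.
set c := (j == i)%:R / (2 * a).
have cn k : (c * k%:R)%:C%C = c%:C%C * k%:R :> C by rewrite rmorphM rmorph_nat.
rewrite !cn mulN1r.
case: n {IH d1 d2} => [|n]; first by rewrite /=; ring.
rewrite /= !bernstein_lin -(natr1 n.+1); ring.
Qed.

Definition update x t : V := \row_j (if j == i then t else x 0 j).

Lemma smooth_update g t : smooth_on setT g -> smooth_on setT (fun x => g (update x t)).
Proof.
move=> sg; have oT := @openT V; apply: (smooth_comp (U := setT)) => // j.
have [->|ji] := eqVneq j i.
  have -> : (fun z : V => (update z t 0 i)%:C%C) = fun=> t%:C%C.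
    by apply/funext => z; rewrite mxE eqxx.
  exact: smooth_cst.
have -> : (fun z : V => (update z t 0 j)%:C%C) = fun z => (z 0 j)%:C%C.
  by apply/funext => z; rewrite mxE (negbTE ji).
exact: smooth_coord.
Qed.

Lemma pderiv_update g t j x :
  pderiv j (fun x => g (update x t)) x = (j != i)%:R * pderiv j g (update x t).
Proof.
have [->|ji] := eqVneq j i.
  rewrite mul0r.
  have E (v : V -> R) : 'D_(delta_mx 0 i) (fun y => v (update y t)) x = 0.
    rewrite /derive; set g1 := fun s => s^-1 *: _.
    suff -> : g1 = fun=> 0 by apply: cvg_lim => //; exact: cvg_cst.
    apply/funext => s; rewrite /g1 /=.
    have -> : update (s *: delta_mx 0 i + x) t = update x t.
      by apply/rowP => k; rewrite !mxE; case: eqP => // ki; rewrite andbF mulr0 add0r.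
    by rewrite subrr scaler0.
  by rewrite /pderiv (E (fun y => complex.Re (g y))) (E (fun y => complex.Im (g y))).
rewrite mul1r.
have E (v : V -> R) : 'D_(delta_mx 0 j) (fun y => v (update y t)) x =
    'D_(delta_mx 0 j) v (update x t).
  rewrite /derive; set g1 := fun s => s^-1 *: _; set g2 := fun s => s^-1 *: _.
  suff -> : g1 = g2 by []; apply/funext => s; rewrite /g1 /g2 /=.
  congr (_ *: (v _ - _)); apply/rowP => k; rewrite !mxE.
  by case: eqP => // ->; rewrite eq_sym (negbTE ji) andbF mulr0 add0r.
by rewrite /pderiv (E (fun y => complex.Re (g y))) (E (fun y => complex.Im (g y))).
Qed.

Definition sample h g k : V -> C := fun x => g (update x (- a + k%:R * h)).

Definition diff_quotient h g : V -> C := fun x =>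
  (h^-1)%:C%C * (g (x + h *: delta_mx 0 i) - g x).

Lemma sample_diff h g k x : h != 0 ->
  sample h g k.+1 x + (-1) * sample h g k x = h%:C%C * sample h (diff_quotient h g) k x.
Proof.
move=> h0; rewrite /sample /diff_quotient mulrA -rmorphM divff// mul1r mulN1r.
congr (g _ - _); apply/rowP => j; rewrite !mxE.
by case: eqP => _; rewrite /= ?mulr1 ?mulr0 ?addr0// -natr1 mulrDl mul1r addrA.
Qed.

Lemma smooth_diff_quotient h g : smooth_on setT g -> smooth_on setT (diff_quotient h g).
Proof.
move=> sg; have oT := @openT V; apply: smooth_onZ => //.
have -> : (fun x => g (x + h *: delta_mx 0 i) - g x) =
    (fun x => g (x + h *: delta_mx 0 i) + (-1) * g x) by apply/funext => x; rewrite mulN1r.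
apply: smooth_onD => //; last exact: smooth_onZ.
apply: (smooth_comp (U := setT)) => // j.
have -> : (fun z : V => ((z + h *: delta_mx 0 i) 0 j)%:C%C) =
    (fun z => (z 0 j)%:C%C + ((h *: delta_mx 0 i : V) 0 j)%:C%C).
  by apply/funext => z; rewrite mxE rmorphD.
by apply: smooth_onD => //; [exact: smooth_coord|exact: smooth_cst].
Qed.

Lemma pderiv_diff_quotient h g j : smooth_on setT g ->
  pderiv j (diff_quotient h g) = diff_quotient h (pderiv j g).
Proof.
move=> sg; apply/funext => x; have dg y : cdifferentiable g y by exact: (sg [::]).
have dgs : cdifferentiable (fun x => g (x + h *: delta_mx 0 i)) x.
  by have [h1 h2] := dg (x + h *: delta_mx 0 i); split; [exact: (diff_shift h1)|exact: (diff_shift h2)].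
rewrite /diff_quotient pderivM; [|exact: cdiff_cst|].
  rewrite pderiv_cst mul0r add0r; congr (_ * _).
  have -> : (fun x => g (x + h *: delta_mx 0 i) - g x) =
    (fun x => g (x + h *: delta_mx 0 i) + (-1) * g x) by apply/funext => y; rewrite mulN1r.
  rewrite pderivD//; last by apply: cdiffM => //; exact: cdiff_cst.
  rewrite pderivZ// mulN1r; congr (_ - _).
  rewrite /pderiv (derive_shift (fun y => complex.Re (g y))).
  by rewrite (derive_shift (fun y => complex.Im (g y))).
have -> : (fun x => g (x + h *: delta_mx 0 i) - g x) =
    (fun x => g (x + h *: delta_mx 0 i) + (-1) * g x) by apply/funext => y; rewrite mulN1r.
by apply: cdiffD => //; apply: cdiffM => //; exact: cdiff_cst.
Qed.

(** The factor n (n - 1) ... (n - l + 1) (h / 2a)^l produced by l derivatives in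
    the direction i.  It tends to 1 when nh = 2a and n grows. *)
Definition bernstein_coef n h l : R := \prod_(r < l) ((n - r)%N%:R * h / (2 * a)).

Lemma smooth_iter_diff_quotient h l g : smooth_on setT g ->
  smooth_on setT (iter l (diff_quotient h) g).
Proof. by move=> sg; elim: l => [//|l IH] /=; exact: smooth_diff_quotient. Qed.

(** A derivative in the direction i lowers the degree and replaces the sampled
    function by its difference quotient; any other derivative acts on the
    sampled function. *)
Lemma mpderiv_bernstein n h s f : h != 0 -> smooth_on setT f ->
  mpderiv s (bernstein n (sample h f)) = fun x =>
    (bernstein_coef n h (count_mem i s))%:C%C *
    bernstein (n - count_mem i s)
      (sample h (iter (count_mem i s) (diff_quotient h) (mpderiv [seq j <- s | j != i] f))) x.
Proof.
move=> h0 sf; elim: s => [|j s IH].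
  by apply/funext => x; rewrite /= subn0 /bernstein_coef big_ord0 mul1r.
rewrite [LHS]/= IH; set l := count_mem i s; set g := iter l _ _.
have sg : smooth_on setT g by apply: smooth_iter_diff_quotient; exact: smooth_on_mpderiv.
have ss k : smooth_on setT (sample h g k) by exact: smooth_update.
apply/funext => x; rewrite pderivZ; last exact: (smooth_bernstein _ ss [::]).
rewrite pderiv_bernstein//=.
have -> : (fun k => pderiv j (sample h g k)) =
    (fun k y => 0 + (j != i)%:R * sample h (pderiv j g) k y).
  by apply/funext => k; apply/funext => y; rewrite add0r /sample pderiv_update.
rewrite bernstein_lin bernstein0 add0r.
have -> : (fun k y => sample h g k.+1 y + (-1) * sample h g k y) =
    (fun k y => 0 + h%:C%C * sample h (diff_quotient h g) k y).
  by apply/funext => k; apply/funext => y; rewrite add0r sample_diff.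
rewrite bernstein_lin bernstein0 add0r.
have [ji|ji] := eqVneq j i.
  rewrite /= mul0r add0r add1n -/l subnS /bernstein_coef big_ord_recr /= !rmorphM /= mul1r -/g.
  by ring.
rewrite /= add0n !mul0r mul1r addr0 -/l.
congr (_ * bernstein _ (sample _ _) _).
rewrite /g; elim: (l) => [//|l' IHl] /=.
by rewrite pderiv_diff_quotient ?IHl//; apply: smooth_iter_diff_quotient; exact: smooth_on_mpderiv.
Qed.

End PartialBernstein.

(** * Convergence of Bernstein polynomials with all derivatives *)

Section BernsteinConvergence.
Variables (R : realType) (d : nat) (i : 'I_d) (a : R).
Local Notation V := 'rV[R]_d.
Local Notation C := R[i].
Implicit Types (f g : V -> C) (x z : V) (u : V -> R) (l n : nat).
Hypothesis a0 : 0 < a.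

(** The step for degree n + 1, so that degree 0 does not occur. *)
Definition mesh n : R := 2 * a / n.+1%:R.

Lemma mesh_gt0 n : 0 < mesh n.
Proof. by rewrite divr_gt0 ?mulr_gt0 ?ltr0n. Qed.

Lemma mesh_cvg : mesh n @[n --> \oo] --> (0 : R).
Proof.
rewrite -(mulr0 (2 * a)); apply: cvgM; first exact: cvg_cst.
exact: cvg_harmonic.
Qed.

Lemma fdiffs_cvg s u z : rsmooth setT u ->
  (fun p : V * nat => fdiffs (mesh p.2) s u p.1) @ filter_prod (nbhs z) \oo -->
    rderivs (rev s) u z.
Proof.
move=> su; apply/cvgrPdist_lt => e e0.
have /cvgrPdist_lt/(_ e e0)/nbhs_ballP[r /= r0 hr] := differentiable_continuous (su (rev s) z I).
have r20 : 0 < r / 2 by exact: divr_gt0.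
have nm : \forall n \near \oo, mesh n *+ size s < r / 2.
  have c : mesh n *+ size s @[n --> \oo] --> (0 : R).
    by rewrite -(mul0rn R (size s)); apply: cvgMn; exact: mesh_cvg.
  exact: (cvgr_lt _ c).
exists ([set x | `|x - z| < r / 2], [set n | mesh n *+ size s < r / 2]).
  split => //=; apply/nbhs_ballP; exists (r / 2) => // y.
  by rewrite -ball_normE /= distrC.
move=> [x n] /= [xz hn].
have rm : room setT (size s) (mesh n) x by [].
have [y yx ->] := fdiffs_mvt su (mesh_gt0 n) rm.
apply: hr; rewrite -ball_normE /= distrC.
have -> : y - z = (y - x) + (x - z) by rewrite addrA subrK.
apply: le_lt_trans (ler_normD _ _) _; rewrite [ltRHS]splitr ltrD//.
exact: le_lt_trans hn.
Qed.

Lemma Re_diff_quotient h l g x : complex.Re (iter l (diff_quotient i h) g x) =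
  fdiffs h (nseq l i) (fun y => complex.Re (g y)) x.
Proof.
elim: l x => [//|l IH] x /=; rewrite /fdiff -!IH /diff_quotient.
by case: (iter _ _ _ _) (iter _ _ _ _) => [? ?] [? ?] /=; rewrite mul0r subr0.
Qed.

Lemma Im_diff_quotient h l g x : complex.Im (iter l (diff_quotient i h) g x) =
  fdiffs h (nseq l i) (fun y => complex.Im (g y)) x.
Proof.
elim: l x => [//|l IH] x /=; rewrite /fdiff -!IH /diff_quotient.
by case: (iter _ _ _ _) (iter _ _ _ _) => [? ?] [? ?] /=; rewrite mul0r addr0.
Qed.

Lemma bernstein_coef_cvg l : bernstein_coef a n.+1 (mesh n) l @[n --> \oo] --> (1 : R).
Proof.
rewrite /bernstein_coef; elim: l => [|l IH].
  by under eq_fun do rewrite big_ord0; exact: cvg_cst.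
under eq_fun do rewrite big_ord_recr /=.
have cl : (n.+1 - l)%N%:R * mesh n / (2 * a) @[n --> \oo] --> (1 : R).
  have c : 1 - l%:R * harmonic n @[n --> \oo] --> (1 - l%:R * 0 : R).
    by apply: cvgB; [exact: cvg_cst|apply: cvgM; [exact: cvg_cst|exact: cvg_harmonic]].
  rewrite mulr0 subr0 in c; apply: cvg_trans c; apply: near_eq_cvg.
  near=> n; have ln : (l <= n.+1)%N.
    by near: n; exists l => // n /= ln; exact: leqW.
  rewrite /harmonic /mesh natrB//=.
  have n0 : n.+1%:R != 0 :> R by rewrite pnatr_eq0.
  have an : a != 0 by rewrite gt_eqF.
  by move: n0; move: (n.+1%:R : R) => N n0; field; rewrite n0 an.
by have := cvgM IH cl; rewrite mulr1; exact.
Unshelve. all: by end_near. Qed.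

Lemma cvg_update (I : Type) (F : set_system I) {FF : Filter F} (v : I -> V) (t : I -> R)
    (x : V) (s : R) : v @ F --> x -> t @ F --> s ->
  (fun k => update i (v k) (t k)) @ F --> update i x s.
Proof.
move=> vx ts; apply: cvg_coords => j; rewrite mxE.
have [ji|ji] := eqVneq j i.
  by under eq_fun do rewrite mxE ji eqxx.
under eq_fun do rewrite mxE (negbTE ji).
exact: (cvg_comp _ _ vx (@coord_continuous _ _ _ 0 j x)).
Qed.

Lemma update_id x : update i x (x 0 i) = x.
Proof. by apply/rowP => j; rewrite mxE; case: eqP => [->|]. Qed.

(** Korovkin-type argument: near x0 every sampled value differs from the limit
    by at most e plus a multiple of the squared distance of the node, and the
    mean of that square is the variance. *)
Lemma quadratic_control (w : nat -> V -> R) (W : V -> R) (x0 : V) (e : R) : 0 < e ->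
  (forall z, (fun p : V * nat => w p.2 p.1) @ filter_prod (nbhs z) \oo --> W z) ->
  exists2 c : R, 0 < c & \forall p \near filter_prod (nbhs x0) \oo,
    forall t, - a <= t <= a ->
      `|w p.2 (update i p.1 t) - W x0| <= e + c * (t - p.1 0 i) ^+ 2.
Proof.
move=> e0 wW.
pose G := filter_prod (nbhs x0) (\oo : set_system nat).
(* Letting the constant c tend to infinity as a third variable, compactness of
   [-a, a] selects one c for all t. *)
pose F := filter_prod G (pinfty_nbhs R).
have : \forall q \near F, `[- a, a]%classic `<=` (fun t =>
    `|w q.1.2 (update i q.1.1 t) - W x0| <= e + q.2 * (t - q.1.1 0 i) ^+ 2).
  have /compact_near_coveringP cK : compact `[- a, a]%classic by exact: segment_compact.
  apply: (cK _ F (fun (q : (V * nat) * R) t => 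
    `|w q.1.2 (update i q.1.1 t) - W x0| <= e + q.2 * (t - q.1.1 0 i) ^+ 2)) => t0 _.
  pose H := filter_prod (nbhs t0) F.
  have ct : (fun r : R * ((V * nat) * R) => r.1) @ H --> t0 by exact: cvg_fst.
  have cG : (fun r : R * ((V * nat) * R) => r.2.1) @ H --> G.
    exact: (cvg_comp _ _ cvg_snd cvg_fst).
  have cx : (fun r : R * ((V * nat) * R) => r.2.1.1) @ H --> x0.
    exact: (cvg_comp _ _ cG cvg_fst).
  have cn : (fun r : R * ((V * nat) * R) => r.2.1.2) @ H --> (\oo : set_system nat).
    exact: (cvg_comp _ _ cG cvg_snd).
  have cc : (fun r : R * ((V * nat) * R) => r.2.2) @ H --> pinfty_nbhs R.
    exact: (cvg_comp _ _ cvg_snd cvg_snd).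
  have cu := cvg_update cx ct.
  have cw : (fun r : R * ((V * nat) * R) => w r.2.1.2 (update i r.2.1.1 r.1)) @ H -->
      W (update i x0 t0).
    apply: (cvg_comp (fun r : R * ((V * nat) * R) => (update i r.2.1.1 r.1, r.2.1.2)) _ _ (wW _)).
    move=> B [[N M] [/= nN nM] sub].
    have h1 : H [set r : R * ((V * nat) * R) | N (update i r.2.1.1 r.1)] by exact: cu nN.
    have h2 : H [set r : R * ((V * nat) * R) | M r.2.1.2] by exact: cn nM.
    by apply: filterS2 h1 h2 => r Nr Mr; apply: sub.
  have cxi : (fun r : R * ((V * nat) * R) => r.2.1.1 0 i) @ H --> x0 0 i.
    exact: (cvg_comp _ _ cx (@coord_continuous _ _ _ 0 i x0)).
  (* At the node t0 = x0_i the values converge to W x0; elsewhere the squared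
     distance is bounded below near t0, and a large c makes the right-hand side
     exceed the bound B of the left-hand side. *)
  have [t0x|t0x] := eqVneq t0 (x0 0 i).
    rewrite t0x update_id in cw.
    have h1 : H [set r : R * ((V * nat) * R) | `|W x0 - w r.2.1.2 (update i r.2.1.1 r.1)| < e].
      by move/cvgrPdist_lt/(_ e e0) : cw.
    have h2 : H [set r : R * ((V * nat) * R) | 0 < r.2.2].
      by apply: (cc [set c | 0 < c]); exact: nbhs_pinfty_gt.
    apply: filterS2 h1 h2 => r /= h1 h2; rewrite distrC.
    by apply: (le_trans (ltW h1)); rewrite lerDl mulr_ge0 ?sqr_ge0// ltW.
  pose B := `|W (update i x0 t0) - W x0| + 1.
  have B0 : 0 < B by rewrite ltr_wpDl.
  pose c := (t0 - x0 0 i) ^+ 2.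
  have c0 : 0 < c by rewrite exprn_even_gt0//= subr_eq0.
  have h1 : H [set r : R * ((V * nat) * R) | `|W (update i x0 t0) - w r.2.1.2 (update i r.2.1.1 r.1)| < 1].
    by move/cvgrPdist_lt/(_ 1 ltr01) : cw.
  have cq : (fun r : R * ((V * nat) * R) => (r.1 - r.2.1.1 0 i) ^+ 2) @ H --> c.
    rewrite /c expr2; under eq_fun do rewrite expr2.
    by apply: cvgM; [exact: (cvgB ct cxi)|exact: (cvgB ct cxi)].
  have c20 : c / 2 < c by lra.
  have h2 : H [set r : R * ((V * nat) * R) | c / 2 < (r.1 - r.2.1.1 0 i) ^+ 2] by exact: (@cvgr_gt _ _ _ _ _ _ cq _ c20).
  have h3 : H [set r : R * ((V * nat) * R) | B / (c / 2) < r.2.2].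
    by apply: (cc [set s | B / (c / 2) < s]); apply: nbhs_pinfty_gt; exact: num_real.
  apply: filterS3 h1 h2 h3 => r /= h1 h2 h3.
  apply: (@le_trans _ _ B).
    set v := w _ _ in h1 *.
    have -> : v - W x0 = (W (update i x0 t0) - W x0) - (W (update i x0 t0) - v) by ring.
    by apply: le_trans (ler_normB _ _) _; rewrite lerD2l ltW.
  have c2 : 0 < c / 2 by exact: divr_gt0.
  have -> : B = B / (c / 2) * (c / 2) by rewrite divfK// gt_eqF.
  apply: (@le_trans _ _ (r.2.2 * (r.1 - r.2.1.1 0 i) ^+ 2)); last by rewrite lerDr ltW.
  by apply: ler_pM; rewrite ?ltW// divr_gt0.
case=> -[A B] /= [GA pB] AB.
have [c c0 Bc] : exists2 c : R, 0 < c & B c.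
  near (pinfty_nbhs R) => c; exists c; last by near: c.
  by near: c; exact: nbhs_pinfty_gt.
exists c => //; apply: filterS GA => p Ap t /andP[t1 t2].
by apply: (AB (p, c)) => //=; rewrite in_itv /= t1 t2.
Unshelve. all: by end_near. Qed.

(** After l derivatives the degree has dropped to n + 1 - l while the nodes
    still have the mesh of degree n + 1.  This shifts the mean by at most l
    steps of the mesh, which is negligible in the limit. *)
Lemma casteljau_cvg (w : nat -> V -> R) (W : V -> R) (x0 : V) l : `|x0 0 i| < a ->
  (forall z, (fun p : V * nat => w p.2 p.1) @ filter_prod (nbhs z) \oo --> W z) ->
  (fun p : V * nat => casteljau (p.2.+1 - l)
     (fun k => w p.2 (update i p.1 (- a + k%:R * mesh p.2))) (barycentric i a p.1))
    @ filter_prod (nbhs x0) \oo --> W x0.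
Proof.
move=> x0a wW; apply/cvgrPdist_le => e e0.
have e20 : 0 < e / 2 by exact: divr_gt0.
have [c c0 hc] := quadratic_control x0 e20 wW.
pose G := filter_prod (nbhs x0) (\oo : set_system nat).
have cx : (fun p : V * nat => p.1 0 i) @ G --> x0 0 i.
  have cx0 : (fun p : V * nat => p.1) @ G --> x0 by exact: cvg_fst.
  exact: (cvg_comp _ _ cx0 (@coord_continuous _ _ _ 0 i x0)).
have h1 : G [set p : V * nat | `|p.1 0 i| < a].
  have cn : (fun p : V * nat => `|p.1 0 i|) @ G --> `|x0 0 i| by exact: cvg_norm.
  exact: (cvgr_lt _ cn).
have h2 : G [set p : V * nat | c * (2 * a * mesh p.2 + mesh p.2 * mesh p.2 * l%:R ^+ 2) < e / 2].
  have cm : (fun p : V * nat => mesh p.2) @ G --> (0 : R).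
    exact: (cvg_comp _ _ cvg_snd mesh_cvg).
  have cb : (fun p : V * nat => c * (2 * a * mesh p.2 + mesh p.2 * mesh p.2 * l%:R ^+ 2)) @ G -->
      c * (2 * a * 0 + 0 * 0 * l%:R ^+ 2).
    apply: cvgM; first exact: cvg_cst.
    apply: cvgD; first by apply: cvgM => //; exact: cvg_cst.
    by apply: cvgM; [exact: cvgM|exact: cvg_cst].
  rewrite !mulr0 mul0r addr0 mulr0 in cb.
  exact: (@cvgr_lt _ _ _ _ _ _ cb _ e20).
apply: filterS3 hc h1 h2 => -[x n] /= hx xa hn.
rewrite -expr2 in hn.
set m := (n.+1 - l)%N; set p := barycentric i a x; set h := mesh n in hn *.
have h0 : 0 < h := mesh_gt0 n.
have N0 : 0 < n.+1%:R :> R by rewrite ltr0n.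
have p01 : 0 <= p <= 1.
  move: xa; rewrite ltr_norml => /andP[x1 x2]; rewrite /p /barycentric.
  rewrite divr_ge0 ?mulr_ge0 ?(ltW a0)//=; last by rewrite -lerBlDr sub0r ltW.
  by rewrite ler_pdivrMr ?mulr_gt0// mul1r mulr_natl mulr2n lerD2r ltW.
have mn : (m <= n.+1)%N by exact: leq_subr.
have hN : h * n.+1%:R = 2 * a by rewrite /h /mesh divfK// gt_eqF.
have xi : x 0 i = - a + n.+1%:R * p * h.
  have -> : n.+1%:R * p * h = h * n.+1%:R * p by ring.
  by rewrite hN /p /barycentric mulrC divfK ?gt_eqF ?mulr_gt0//; ring.
pose wk k := w n (update i x (- a + k%:R * h)).
have -> : casteljau m (fun k => w n (update i x (- a + k%:R * h))) p = 
    W x0 + casteljau m (fun k => wk k - W x0) p.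
  have -> : (fun k => wk k - W x0) = (fun k => wk k + (-1) * W x0).
    by apply/funext => k; rewrite mulN1r.
  by rewrite casteljau_lin casteljau_cst mulN1r addrC subrK.
rewrite opprD addrA subrr sub0r normrN.
apply: (@le_trans _ _ (casteljau m (fun k => e / 2 + (c * h ^+ 2) * (k%:R - n.+1%:R * p) ^+ 2) p)).
  apply: casteljau_le => // k km.
  have kn : k%:R <= n.+1%:R :> R by rewrite ler_nat (leq_trans km).
  have := hx (- a + k%:R * h); rewrite xi => hk.
  apply: le_trans (hk _) _.
    apply/andP; split; first by rewrite lerDl mulr_ge0// ltW.
    have : k%:R * h <= 2 * a by rewrite -hN mulrC ler_wpM2l// ltW.
    by lra.
  by rewrite lerD2l le_eqVlt; apply/orP; left; apply/eqP; ring.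
rewrite casteljau_lin casteljau_cst casteljau_variance.
rewrite [leRHS]splitr lerD2l; apply: le_trans (ltW hn).
rewrite -mulrA ler_wpM2l ?(ltW c0)//.
rewrite mulrDr; apply: lerD.
  have -> : 2 * a * h = h ^+ 2 * n.+1%:R by rewrite -hN; ring.
  apply: ler_wpM2l; first exact: sqr_ge0.
  apply: (@le_trans _ _ (n.+1%:R * 1)); last by rewrite mulr1.
  move/andP : p01 => [p0 p1].
  have pq : p * (1 - p) <= 1 by move: p0 p1; clear; nra.
  by apply: ler_pM => //; [rewrite mulr_ge0// subr_ge0|rewrite ler_nat].
apply: ler_wpM2l; first exact: sqr_ge0.
rewrite -mulrBl exprMn -[leRHS]mulr1.
move/andP : p01 => [p0 p1].
apply: ler_pM; rewrite ?sqr_ge0 ?exprn_ile1//.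
rewrite -sqrrN opprB lerXn2r ?nnegrE ?subr_ge0 ?ler_nat//.
by rewrite lerBlDr -natrD ler_nat /m -leq_subLR.
Qed.

End BernsteinConvergence.

(** * Density of polynomials *)

Section Density.
Variables (R : realType) (d : nat).
Local Notation V := 'rV[R]_d.
Local Notation C := R[i].
Local Notation form := (Cinf [set: V] -> R[i]^o).
Implicit Types (f g : Cinf [set: V]) (x y z : V) (T : form).

Let oT := @openT V.

Lemma filter_pred1_nseq (s : seq 'I_d) i : [seq j <- s | j == i] = nseq (count_mem i s) i.
Proof. by elim: s => [//|j s IH] /=; have [->|_] := eqVneq j i; rewrite /= IH. Qed.

(** The letters i of s, moved to the front, turn into difference quotients of
    the derivative g along the other letters; these converge to derivatives of
    g. *)
Lemma bernstein_cvg i (a : R) (f : V -> C) s x0 : 0 < a -> smooth_on setT f ->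
  `|x0 0 i| < a ->
  (fun p : V * nat => mpderiv s (bernstein i a p.2.+1 (sample i a (mesh a p.2) f)) p.1 : R[i]^o)
    @ filter_prod (nbhs x0) \oo --> (mpderiv s f x0 : R[i]^o).
Proof.
move=> a0 sf x0a; set l := count_mem i s.
pose g := mpderiv [seq j <- s | j != i] f.
have sg : smooth_on setT g by exact: smooth_on_mpderiv.
have E1 : mpderiv s f x0 = mpderiv (nseq l i) g x0.
  rewrite /g -mpderiv_cat; apply: (mpderiv_perm oT sf) => //.
  by rewrite -filter_pred1_nseq perm_sym; have /permPl := perm_filterC (pred1 i) s; exact.
have E2 p : mpderiv s (bernstein i a p.2.+1 (sample i a (mesh a p.2) f)) p.1 =
    (bernstein_coef a p.2.+1 (mesh a p.2) l)%:C%C *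
    bernstein i a (p.2.+1 - l) (sample i a (mesh a p.2) (iter l (diff_quotient i (mesh a p.2)) g)) p.1.
  by rewrite mpderiv_bernstein// gt_eqF// mesh_gt0.
under eq_fun do rewrite E2.
rewrite E1.
pose G := filter_prod (nbhs x0) (\oo : set_system nat).
have h1 : (fun p : V * nat => (bernstein_coef a p.2.+1 (mesh a p.2) l)%:C%C : R[i]^o) @ G --> (1 : R[i]^o).
  apply/cvg_complex; split; last exact: cvg_cst.
  exact: (cvg_comp _ _ cvg_snd (bernstein_coef_cvg a0 l)).
have h2 : (fun p : V * nat => bernstein i a (p.2.+1 - l)
    (sample i a (mesh a p.2) (iter l (diff_quotient i (mesh a p.2)) g)) p.1 : R[i]^o) @ G -->
    (mpderiv (nseq l i) g x0 : R[i]^o).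
  apply/cvg_complex; split.
    under eq_fun do rewrite Re_bernstein.
    rewrite -[complex.Re _]/((fun y => complex.Re (mpderiv (nseq l i) g y)) x0) Re_mpderiv.
    apply: (@casteljau_cvg R d i a a0
      (fun n y => complex.Re (iter l (diff_quotient i (mesh a n)) g y)) _ x0 l x0a) => z.
    under eq_fun do rewrite Re_diff_quotient.
    have := @fdiffs_cvg R d a a0 (nseq l i) _ z (smooth_Re sg).
    by rewrite rev_nseq.
  under eq_fun do rewrite Im_bernstein.
  rewrite -[complex.Im _]/((fun y => complex.Im (mpderiv (nseq l i) g y)) x0) Im_mpderiv.
  apply: (@casteljau_cvg R d i a a0
    (fun n y => complex.Im (iter l (diff_quotient i (mesh a n)) g y)) _ x0 l x0a) => z.
  under eq_fun do rewrite Im_diff_quotient.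
  have := @fdiffs_cvg R d a a0 (nseq l i) _ z (smooth_Im sg).
  by rewrite rev_nseq.
have h3 := cvgcM h1 h2; rewrite mul1r in h3; exact: h3.
Qed.

(** Density in dual form.  This class of forms is stable under multiplication by
    a coordinate, so that products of polynomials never have to be expanded into
    monomials. *)
Definition kills_polynomials T := [/\ linear T, continuous T &
  forall alpha, T (Cinf_of setT (monomial alpha)) = 0].

Definition coord i : Cinf [set: V] := Cinf_of setT (fun x : V => (x 0 i)%:C%C).

Lemma coordE i x : coord i x = (x 0 i)%:C%C.
Proof. by apply: (Cinf_ofS oT) => //; exact: smooth_coord. Qed.

Lemma kills_coord T i : kills_polynomials T -> kills_polynomials (fun f => T (cmul (coord i) f)).
Proof.
move=> [lT cT T0]; split.
- by move=> b f g; rewrite (cmul_linear (coord i)) lT.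
- by move=> f; apply: (cvg_comp _ _ (@cmul_continuous _ _ (coord i) f)); exact: cT.
- move=> alpha; rewrite -[RHS](T0 (fun j => (alpha j + (j == i))%N)); congr T.
  apply: Cinf_ext => x _; rewrite cmulE coordE !(Cinf_ofS oT) //; try exact: smooth_monomial_on.
  rewrite /monomial -rmorphM; congr (_%:C%C).
  under [in RHS]eq_bigr do rewrite exprD.
  rewrite big_split /= mulrC; congr (_ * _).
  rewrite (bigD1 i)//= eqxx expr1 big1 ?mulr1// => j ji.
  by rewrite (negbTE ji) expr0.
Qed.

(** Induction on the degree: the barycentric variable is affine in x_i, and
    multiplication by x_i stays within the class of forms. *)
Lemma kills_bernstein i a n (u : nat -> V -> C) : 0 < a ->
  (forall k, smooth_on setT (u k)) ->
  (forall T k, kills_polynomials T -> T (Cinf_of setT (u k)) = 0) ->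
  forall T, kills_polynomials T -> T (Cinf_of setT (bernstein i a n u)) = 0.
Proof.
move=> a0; elim: n u => [|n IH] u su u0 T kT; first exact: u0.
have [lT _ _] := kT.
have su' k : smooth_on setT (u k.+1) by exact: su.
pose B1 := Cinf_of setT (bernstein i a n u).
pose B2 := Cinf_of setT (bernstein i a n (fun k => u k.+1)).
have B10 S : kills_polynomials S -> S B1 = 0 by exact: IH.
have B20 S : kills_polynomials S -> S B2 = 0 by apply: IH => // S' k; exact: u0.
have -> : Cinf_of setT (bernstein i a n.+1 u) =
    (2 * a)^-1%:C%C *: cmul (coord i) (B2 - B1) + ((a / (2 * a))%:C%C *: (B2 - B1) + B1).
  apply: Cinf_ext => x _; rewrite !CinfD !CinfZ cmulE coordE CinfB.
  rewrite (Cinf_ofS oT)//; last exact: smooth_bernstein.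
  rewrite /B1 /B2 !(Cinf_ofS oT)//; try exact: smooth_bernstein.
  have Ex := congr1 (fun h => h x) (barycentricE i a); rewrite /= in Ex.
  by rewrite /= Ex; ring.
rewrite lT !(linear_mapD lT) (linear_mapZ lT) !(linear_mapB lT).
have := B10 _ (kills_coord i kT); have := B20 _ (kills_coord i kT).
rewrite /= (linear_mapB (cmul_linear (coord i))) (linear_mapB lT) => -> ->.
by rewrite (B10 _ kT) (B20 _ kT) !subr0 !scaler0 !addr0.
Qed.

Definition depends_below m (f : V -> C) :=
  forall x y, (forall j : 'I_d, (j < m)%N -> x 0 j = y 0 j) -> f x = f y.

(** Polynomials are dense: one variable after the other is made polynomial by
    partial Bernstein operators, whose coefficients do not involve it. *)
Lemma kills_below m : (m <= d)%N -> forall f T, depends_below m f ->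
  kills_polynomials T -> T f = 0.
Proof.
elim: m => [|m IH] md f T df kT.
  have [lT _ T0] := kT.
  have -> : f = f 0 *: Cinf_of setT (monomial (fun=> 0%N)).
    apply: Cinf_ext => x _; rewrite CinfZ (Cinf_ofS oT)//; last exact: smooth_monomial_on.
    by rewrite /monomial big1 ?mulr1; [exact: df|move=> j _; rewrite expr0].
  by rewrite (linear_mapZ lT) T0 scaler0.
pose i := Ordinal md; have [lT cT T0] := kT.
have [K [cK _ KT]] := form_carrier oT lT cT.
have [a a0 Ka] : exists2 a : R, 0 < a & K `<=` [set x : V | `|x| < a].
  have [M [Mr MK]] := compact_bounded cK.
  exists (Num.max M 0 + 2).
    by rewrite ltr_wpDl// le_max lexx orbT.
  move=> x Kx /=; apply: (@le_lt_trans _ _ (Num.max M 0 + 1)).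
    by apply: MK => //; rewrite ltr_pwDr// le_max lexx.
  by rewrite ltrD2l ltr1n.
have oU : open [set x : V | `|x| < a].
  have -> : [set x : V | `|x| < a] = ball (0 : V) a.
    by rewrite -ball_normE; apply/seteqP; split => x /=; rewrite sub0r normrN.
  exact: ball_open.
have [chi [chi1 _ chiU]] := cutoff cK oU Ka.
pose B n : Cinf [set: V] := Cinf_of setT (bernstein i a n.+1 (sample i a (mesh a n) f)).
have sf : smooth_on setT f := smooth_Cinf oT f.
have ss n k : smooth_on setT (sample i a (mesh a n) f k) by exact: smooth_update.
(* The samples of f no longer depend on the i-th coordinate, so the induction
   hypothesis applies to the coefficients. *)
have TB n : T (B n) = 0.
  apply: kills_bernstein => // S k kS; apply: (IH (ltnW md)) => // x y xy.
  rewrite !(Cinf_ofS oT)//; apply: df => j jm; rewrite !mxE.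
  case: eqP => // ji; apply: xy.
  by rewrite ltn_neqAle -ltnS jm andbT; apply/eqP => jE; apply: ji; apply/val_inj.
have Tchi h : T (cmul chi h) = T h.
  apply/eqP; rewrite -subr_eq0; apply/eqP; rewrite -(linear_mapB lT).
  apply: KT => x Kx; apply: filterS (chi1 x Kx) => y chiy.
  by rewrite /mkset CinfB cmulE (chiy : chi y = 1) mul1r subrr.
(* The polynomials in x_i approximate f on the box only; chi, which T does not
   see, confines the comparison to it. *)
have c0 : (fun n => cmul chi (f - B n)) @ \oo --> (0 : Cinf [set: V]).
  apply/(cinf_cvgP oT) => s x0 _.
  have z : mpderiv s (0 : Cinf [set: V]) x0 = 0.
    by case: s => [//|j s]; rewrite (@mpderiv_cst _ _ (j :: s) 0).
  rewrite z.
  have [ux|ux] := pselect (fsupp chi x0); last first.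
    apply: cvg_near_cst; exists (~` fsupp chi, setT).
      by split; [apply: open_nbhs_nbhs; split => //; exact: open_fsuppC|exact: filterT].
    move=> [x n] [/= nx _].
    have -> : mpderiv s (cmul chi (f - B n)) x = mpderiv s (fun=> 0) x.
      apply: (eq_on_mpderiv (@open_fsuppC _ _ chi)) => // y /fsupp_out cy.
      by rewrite cmulE cy mul0r.
    by case: (s) => [//|j t]; rewrite mpderiv_cst.
  have x0a : `|x0 0 i| < a by apply: le_lt_trans (chiU _ ux); exact: rV_norm_ge.
  have sC (g : Cinf [set: V]) : smooth_on setT g := smooth_Cinf oT g.
  have E n x : mpderiv s (cmul chi (f - B n)) x =
      \sum_(p <- splits s) mpderiv p.1 chi x * (mpderiv p.2 f x +
       (-1) * mpderiv p.2 (bernstein i a n.+1 (sample i a (mesh a n) f)) x).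
    rewrite (mpderiv_Cinf_of oT)//; last first.
      by apply: smooth_onM => //; exact: sC.
    rewrite (@mpderivM _ _ setT _ _ s x oT)//; apply: eq_bigr => p _; congr (_ * _).
    have sb : smooth_on setT (bernstein i a n.+1 (sample i a (mesh a n) f)) by exact: smooth_bernstein.
    have -> : Cinf_fun (f - B n) =
        (fun y => f y + (-1) * bernstein i a n.+1 (sample i a (mesh a n) f) y).
      by apply/funext => y; rewrite CinfB mulN1r (Cinf_ofS oT).
    rewrite (@mpderivD _ _ setT)//; first by rewrite (@mpderivZ _ _ setT).
    exact: smooth_onZ.
  pose G := filter_prod (nbhs x0) (\oo : set_system nat).
  have h : (fun q : V * nat => \sum_(p <- splits s) mpderiv p.1 chi q.1 * (mpderiv p.2 f q.1 +
       (-1) * mpderiv p.2 (bernstein i a q.2.+1 (sample i a (mesh a q.2) f)) q.1) : R[i]^o) @ G -->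
      (\sum_(p <- splits s) mpderiv p.1 chi x0 *
         (mpderiv p.2 f x0 + (-1) * mpderiv p.2 f x0) : R[i]^o).
    apply: cvgc_sum => p; apply: cvgcM.
      exact: (cvg_comp _ _ cvg_fst (cdiff_continuous (sC chi p.1 x0 I))).
    apply: cvgcD.
      exact: (cvg_comp _ _ cvg_fst (cdiff_continuous (sC f p.2 x0 I))).
    by apply: cvgcM; [exact: cvg_cst|exact: bernstein_cvg].
  have s0 : \sum_(p <- splits s) mpderiv p.1 chi x0 *
      (mpderiv p.2 f x0 + (-1) * mpderiv p.2 f x0) = 0 :> C.
    by rewrite big1// => p _; rewrite mulN1r subrr mulr0.
  rewrite s0 in h; apply: cvg_trans h; apply: near_eq_cvg.
  by apply: nearW => -[x n]; rewrite E.
have cT0 : (fun n => T (cmul chi (f - B n))) @ \oo --> (0 : R[i]^o).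
  by rewrite -(linear_map0 lT); apply: (cvg_comp _ _ c0); exact: cT.
have E : (fun n => T (cmul chi (f - B n))) = fun=> T f.
  by apply/funext => n; rewrite Tchi (linear_mapB lT) TB subr0.
rewrite E in cT0.
by apply: (cvg_unique _ (cvg_cst (T f)) cT0); exact: norm_hausdorff.
Qed.

Lemma polynomials_dense T : kills_polynomials T -> forall f, T f = 0.
Proof.
move=> kT f; apply: (@kills_below d (leqnn d)) => // x y xy.
by congr (f _); apply/rowP => j; exact: xy.
Qed.

End Density.

(** * The closed algebra of Hadamard operators *)

Section OperatorAlgebra.
Variables (R : realType) (d : nat) (Omega : set 'rV[R]_d).
Local Notation V := 'rV[R]_d.
Local Notation C := R[i].
Implicit Types (f g p : Cinf Omega) (M N : Cinf Omega -> Cinf Omega) (x y : V).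
Hypothesis oO : open Omega.

Lemma Lcont_lin a M N : Lcont Omega M -> Lcont Omega N -> Lcont Omega (a *: M + N).
Proof.
move=> [lM cM] [lN cN]; split.
  move=> b f g; rewrite !fctE lM lN scalerDr addrACA scalerDr; congr (_ + _).
  by rewrite addrC !scalerA mulrC addrC.
move=> f; apply: (@cinf_cvg_lin _ _ _ oO _ (nbhs f) (nbhs_filter f) M N _ _ (fun=> a) a).
- exact: cvg_cst.
- exact: cM.
- exact: cN.
Qed.

Lemma Lcont_comp M N : Lcont Omega M -> Lcont Omega N -> Lcont Omega (M \o N).
Proof.
move=> [lM cM] [lN cN]; split; first by move=> a f g; rewrite /= lN lM.
by move=> f; apply: (cvg_comp _ _ (cN f)); exact: cM.
Qed.

Lemma Hadamard_subalgebra : subalgebra_of_L (Hadamard Omega).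
Proof.
split.
- by move=> M [].
- split; first by split => //; move=> f; exact: cvg_id.
  by move=> alpha; exists 1; rewrite scale1r.
- move=> a M N [LM hM] [LN hN]; split; first exact: Lcont_lin.
  move=> alpha; have [m mE] := hM alpha; have [n nE] := hN alpha.
  by exists (a * m + n); rewrite !fctE mE nE scalerA scalerDl.
- move=> M N [LM hM] [LN hN]; split; first exact: Lcont_comp.
  move=> alpha; have [m mE] := hM alpha; have [n nE] := hN alpha.
  by exists (n * m); rewrite /= nE (linear_mapZ LM.1) mE scalerA.
Qed.

Lemma bounded_set1 p : @tvs_bounded C (Cinf Omega) [set p].
Proof.
move=> W nW.
have c : (fun b : R[i]^o => (b : C) *: p) @ (0 : R[i]^o) --> (0 : Cinf Omega).
  have := @cinf_cvg_lin _ _ _ oO R[i]^o (nbhs (0 : R[i]^o)) (nbhs_filter _)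
    (fun=> p) (fun=> 0) p 0 (fun b => b) 0 cvg_id (cvg_cst p) (cvg_cst 0).
  rewrite scale0r addr0.
  have -> : (fun b : C => b *: p + 0) = (fun b => b *: p) by apply/funext => b; rewrite addr0.
  exact.
have /nbhs_ballP[e /= e0 eW] := c W nW.
exists (2 / e); first by rewrite divr_gt0.
move=> b eb _ ->; have b0 : b != 0.
  rewrite -normr_gt0; apply: lt_le_trans eb; exact: divr_gt0.
exists (b^-1 *: p); last by rewrite scalerA divff// scale1r.
apply: eW; rewrite -ball_normE /= sub0r normrN normfV.
rewrite invf_plt ?posrE ?normr_gt0//; apply: lt_le_trans eb.
by rewrite ltr_pMl ?invr_gt0// ltr1n.
Qed.

Lemma Lb_eval_continuous p x : Omega x ->
  continuous (fun N : Lb_ambient Omega => (N p x : R[i]^o)).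
Proof.
move=> Ox N; apply: (@cvg_comp _ _ _ (fun N : Lb_ambient Omega => N p)
  (fun f : Cinf Omega => f x : R[i]^o) _ (nbhs (N p))); last first.
  exact: (@cinf_cvg_eval _ _ _ oO _ (nbhs (N p)) (nbhs_filter _) id).
move=> W; rewrite /= -nbhs_entourageE => -[E entE EW].
apply: filterS (fam_nbhs (N : Lb_ambient Omega) entE (bounded_set1 p)) => N' h.
by apply: EW; apply/xsectionP; exact: h.
Qed.

(** Points of Omega with no zero coordinate: there dilation is invertible and
    monomials do not vanish; they are dense in Omega. *)
Definition regular x := forall j, x 0 j != 0.

Lemma near_regular x : \forall t \near (0 : R)^'+, regular (x + const_mx t).
Proof.
rewrite /regular; apply: (@filter_forall _ _ _ _ (at_right_proper_filter 0)) => j.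
have [x0|x0] := eqVneq (x 0 j) 0.
  near=> t; rewrite !mxE x0 add0r gt_eqF//; near: t; exact: nbhs_right_gt.
near=> t; rewrite !mxE; apply/eqP => xt.
have t0 : 0 < t by near: t; exact: nbhs_right_gt.
have : t < `|x 0 j| by near: t; apply: nbhs_right_lt; rewrite normr_gt0.
by rewrite (_ : x 0 j = - t) ?normrN ?gtr0_norm ?ltxx//; apply/eqP; rewrite -addr_eq0 xt.
Unshelve. all: by end_near. Qed.

Lemma cvg_regular x : (fun t : R => x + const_mx t) @ 0^'+ --> x.
Proof.
apply: cvg_coords => j; under eq_fun do rewrite !mxE.
have c : (fun t : R => t) @ 0^'+ --> (0 : R) by apply: cvg_at_right_filter; exact: cvg_id.
have h := cvgD (cvg_cst (x 0 j)) c; rewrite addr0 in h; exact: h.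
Qed.

Lemma regular_near x (P : set V) : nbhs x P -> exists2 y, P y & regular y.
Proof.
move=> nP; have h : \forall t \near (0 : R)^'+, P (x + const_mx t) by exact: cvg_regular nP.
have g := near_regular x; near ((0 : R)^'+) => t.
by exists (x + const_mx t); near: t.
Unshelve. all: by end_near. Qed.

Lemma monomial_neq0 alpha x : regular x -> monomial alpha x != 0.
Proof.
move=> rx; rewrite /monomial eq_complex /= eqxx andbT.
by apply/prodf_neq0 => j _; exact: expf_neq0.
Qed.

(** With x0 regular, p is an eigenvector of N iff N p(x) p(x0) = N p(x0) p(x)
    for all x.  Both sides are continuous in N, because singletons are bounded.
    *)
Lemma Hadamard_closed : Omega !=set0 -> closed_in_Lb (Hadamard Omega).
Proof.
move=> [x1 Ox1]; have [x0 Ox0 rx0] := regular_near (open_nbhs_nbhs (conj oO Ox1)).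
pose D : set (Lb_ambient Omega) := [set N | forall alpha x, Omega x ->
  let p := Cinf_of Omega (monomial alpha) in N p x * p x0 - N p x0 * p x = 0].
have cD : closed D.
  pose e (q : ('I_d -> nat) * V) (N : Lb_ambient Omega) : R[i]^o :=
    let p := Cinf_of Omega (monomial q.1) in N p q.2 * p x0 - N p x0 * p q.2.
  have -> : D = \bigcap_(q in [set q | Omega q.2]) (e q @^-1` [set 0]).
    apply/seteqP; split => [N DN [alpha x] /= Ox|N DN alpha x Ox]; first exact: DN.
    exact: (DN (alpha, x) Ox).
  apply: closed_bigI => -[alpha x] /= Ox; apply: preimage_closed.
    move=> N _; set p := Cinf_of Omega (monomial alpha).
    have c1 : (fun N : Lb_ambient Omega => (N p x : R[i]^o)) @ nbhs N --> (N p x : R[i]^o).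
      exact: Lb_eval_continuous.
    have c2 : (fun N : Lb_ambient Omega => (N p x0 : R[i]^o)) @ nbhs N --> (N p x0 : R[i]^o).
      exact: Lb_eval_continuous.
    have FN := @nbhs_filter _ (N : Lb_ambient Omega).
    have h := cvgcD (cvgcM c1 (cvg_cst (p x0 : R[i]^o)))
      (cvgcM (cvg_cst ((-1 : C) : R[i]^o)) (cvgcM c2 (cvg_cst (p x : R[i]^o)))).
    have -> : e (alpha, x) = (fun N' => N' p x * p x0 + (-1) * (N' p x0 * p x)).
      by apply/funext => N'; rewrite /e mulN1r.
    exact: h.
  exact: accessible_closed_set1 (hausdorff_accessible (@norm_hausdorff _ R[i]^o)) _.
apply/closed_subspaceP; exists D => //; apply/seteqP; split => M [].
  move=> DM LM; split => //; split => // alpha.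
  set p := Cinf_of Omega (monomial alpha).
  have px0 : p x0 != 0.
    by rewrite (Cinf_ofE oO)//; [exact: monomial_neq0|move=> *; exact: smooth_monomial].
  exists (M p x0 / p x0); apply: Cinf_ext => x Ox; rewrite CinfZ.
  apply: (mulIf px0); rewrite mulrAC divfK//.
  by apply/eqP; rewrite -subr_eq0; apply/eqP; exact: DM.
move=> [LM HM] _; split => // alpha x Ox p; have [m mE] := HM alpha.
by rewrite mE !CinfZ; ring.
Qed.

End OperatorAlgebra.

(** * The distribution of a Hadamard operator *)

Section Representation.
Variables (R : realType) (d : nat) (Omega : set 'rV[R]_d).
Local Notation V := 'rV[R]_d.
Local Notation C := R[i].
Local Notation form := (Cinf [set: V] -> R[i]^o).
Implicit Types (f g : Cinf [set: V]) (x y z : V).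
Hypotheses (oO : open Omega) (Omega_neq0 : Omega !=set0).

Let oT := @openT V.

(** The eigenvalues of the operator are the moments of the distribution, and
    these determine it by density of the polynomials. *)
Lemma Mop_inj (T S : form) : Edist (dilation_set Omega) T -> Edist (dilation_set Omega) S ->
  Mop Omega T = Mop Omega S -> T = S.
Proof.
move=> ET ES TS; have [x1 Ox1] := Omega_neq0.
have [x0 Ox0 rx0] := regular_near (open_nbhs_nbhs (conj oO Ox1)).
have TSm alpha : T (Cinf_of setT (monomial alpha)) = S (Cinf_of setT (monomial alpha)).
  have := Mop_monomial oO ET alpha; rewrite TS (Mop_monomial oO ES) => E.
  have := congr1 (fun h : Cinf Omega => h x0) E; rewrite !CinfZ.
  move/mulIf => -> //; rewrite (Cinf_ofS oO)//; first exact: monomial_neq0.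
  exact: smooth_monomial_on.
have [lD cD _ _] := Edist_lin (-1) ET ES.
have kD : kills_polynomials ((-1) *: T + S).
  by split => // alpha; rewrite !fctE scaleN1r TSm addNr.
apply/funext => f; have := polynomials_dense kD f; rewrite !fctE scaleN1r.
by move=> /eqP; rewrite addrC subr_eq0 => /eqP.
Qed.

Definition hinv x : V := \row_j (x 0 j)^-1.

Lemma hprodV x y : regular x -> hprod x (hprod (hinv x) y) = y.
Proof. by move=> rx; apply/rowP => j; rewrite !mxE mulrA divff ?mul1r. Qed.

Lemma hprodVK x y : regular x -> hprod (hinv x) (hprod x y) = y.
Proof. by move=> rx; apply/rowP => j; rewrite !mxE mulrA mulVf ?mul1r. Qed.

Definition restr_dil x f : Cinf Omega := Cinf_of Omega (fun y => f (hprod x y)).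

Lemma smooth_dil x f : smooth_on setT (fun y => f (hprod x y)).
Proof. exact: (smooth_on_hprod oT (smooth_Cinf oT f)). Qed.

Lemma restr_dilE x f y : Omega y -> restr_dil x f y = f (hprod x y).
Proof.
by move=> Oy; apply: (Cinf_ofS oO) => //; apply: smooth_onS (smooth_dil x f).
Qed.

Lemma restr_dil_linear x : linear (restr_dil x).
Proof. by move=> a f g; apply: Cinf_ext => y Oy; rewrite CinfD CinfZ !restr_dilE. Qed.

Lemma restr_dil_continuous x : continuous (restr_dil x).
Proof.
apply: (cinf_continuous oO) => f s y Oy.
have E z g : Omega z -> mpderiv s (restr_dil x g) z = wmono x s * mpderiv s g (hprod x z).
  move=> Oz; rewrite (mpderiv_Cinf_of oO)//; last exact: smooth_onS (smooth_dil x g).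
  exact: (mpderiv_hprod s oT (smooth_Cinf oT g)).
rewrite E//; pose G := filter_prod (nbhs y) (nbhs f).
have c1 : (fun p : V * Cinf [set: V] => p.1) @ G --> y by exact: cvg_fst.
have c2 : (fun p : V * Cinf [set: V] => p.2) @ G --> f by exact: cvg_snd.
have c3 := cvg_hprod (@cvg_cst _ x _ G _) c1.
have h : (fun p : V * Cinf [set: V] => wmono x s * mpderiv s p.2 (hprod x p.1) : R[i]^o) @ G -->
    (wmono x s * mpderiv s f (hprod x y) : R[i]^o).
  apply: cvgcM; first exact: cvg_cst.
  apply: (cvg_comp (fun p : V * Cinf [set: V] => (hprod x p.1, p.2)) _ _
    (@mpderiv_joint _ _ _ oT s (hprod x y) f I)).
  move=> B [[N W] [/= nN nW] sub].
  have h1 : G [set q | N (hprod x q.1)] by exact: c3 nN.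
  have h2 : G [set q | W q.2] by exact: c2 nW.
  by apply: filterS2 h1 h2 => q Nq Wq; apply: sub.
apply: cvg_trans h; apply: near_eq_cvg.
exists (Omega, setT); first by split; [exact: open_nbhs_nbhs|exact: filterT].
by move=> [z g] [/= Oz _]; rewrite E.
Qed.

Section Symbol.
Variable M : Cinf Omega -> Cinf Omega.
Hypothesis HM : Hadamard Omega M.

Let lM : linear M. Proof. by case: HM => -[]. Qed.
Let cM : continuous M. Proof. by case: HM => -[]. Qed.

(** If M is the operator of a distribution T, then f(./x) is mapped by M to T f
    at x, whatever the regular point x is. *)
Definition symbol x : form := fun f => M (restr_dil (hinv x) f) x.

Lemma symbol_linear x : Omega x -> linear (symbol x).
Proof. by move=> Ox a f g; rewrite /symbol restr_dil_linear lM. Qed.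

Lemma symbol_continuous x : Omega x -> continuous (symbol x).
Proof.
move=> Ox f.
apply: (@cinf_cvg_eval _ _ _ oO _ (nbhs f) (nbhs_filter f)
  (fun g => M (restr_dil (hinv x) g)) _ x _ Ox).
by apply: (cvg_comp _ _ (@restr_dil_continuous (hinv x) f)); exact: cM.
Qed.

Lemma symbol_monomial x alpha (m : C) : Omega x -> regular x ->
  M (Cinf_of Omega (monomial alpha)) = m *: Cinf_of Omega (monomial alpha) ->
  symbol x (Cinf_of setT (monomial alpha)) = m.
Proof.
move=> Ox rx mE; rewrite /symbol.
have -> : restr_dil (hinv x) (Cinf_of setT (monomial alpha)) =
    monomial alpha (hinv x) *: Cinf_of Omega (monomial alpha).
  apply: Cinf_ext => y Oy; rewrite restr_dilE// CinfZ !Cinf_ofS//; try exact: smooth_monomial_on.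
  exact: monomial_hprod.
rewrite (linear_mapZ lM) mE !CinfZ (Cinf_ofS oO)//; last exact: smooth_monomial_on.
rewrite mulrCA -monomial_hprod -[RHS]mulr1; congr (_ * _).
rewrite /monomial big1// => j _; rewrite !mxE mulVf ?expr1n//; exact: rx.
Qed.

(** The moments of the symbol are the eigenvalues of M, hence the same at x and
    at y. *)
Lemma symbol_indep x y f : Omega x -> regular x -> Omega y -> regular y ->
  symbol x f = symbol y f.
Proof.
move=> Ox rx Oy ry.
have [lD cD] := form_lin (-1) (symbol_linear Ox) (@symbol_continuous _ Ox)
  (symbol_linear Oy) (@symbol_continuous _ Oy).
have kD : kills_polynomials ((-1) *: symbol x + symbol y).
  split => // alpha; have [m mE] := HM.2 alpha.
  by rewrite !fctE (symbol_monomial Ox rx mE) (symbol_monomial Oy ry mE) scaleN1r addNr.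
have := polynomials_dense kD f; rewrite !fctE scaleN1r => /eqP.
by rewrite addrC subr_eq0 => /eqP.
Qed.

(** If phi is supported off x^-1 K, then phi(./x) vanishes near K. *)
Lemma symbol_supp x (K : set V) : Omega x -> regular x -> compact K ->
  (forall h : Cinf Omega, set_nbhs K [set z | h z = 0] -> M h x = 0) ->
  dsupp (symbol x) `<=` [set y | K (hprod x y)].
Proof.
move=> Ox rx cK KM.
have clK : closed K by apply: compact_closed => //; exact: norm_hausdorff.
apply: dsupp_sub.
  rewrite -openC; exact: (open_hprod (x := x) (closed_openC clK)).
move=> phi _ phiK; apply: KM => k Kk.
have nphi : ~ fsupp phi (hprod (hinv x) k).
  by move/phiK; apply; rewrite /mkset hprodV.
have : \forall z \near k, ~ fsupp phi (hprod (hinv x) z).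
  apply: open_nbhs_nbhs; split => //.
  exact: (open_hprod (x := hinv x) (@open_fsuppC _ _ phi)).
apply: filterS => z nz; rewrite /mkset.
have [Oz|/Cinf_out ->//] := pselect (Omega z).
by rewrite restr_dilE// fsupp_out.
Qed.

(** Near any x0 in Omega one carrier K inside Omega serves all points x.  For
    the regular ones x supp T lies in K, and since K is closed x0 supp T lies in
    K as well; this is the inclusion of supp T in the dilation set. *)
Lemma symbol_Edist x : Omega x -> regular x -> Edist (dilation_set Omega) (symbol x).
Proof.
move=> Ox rx; split; [exact: symbol_linear|exact: symbol_continuous| |].
- have [K [cK KO nK]] := operator_carrier oO lM cM Ox.
  have sK := symbol_supp Ox rx cK (nbhs_singleton nK).
  have cI : compact (hprod_set [set hinv x] K).
    by apply: compact_hprod_set => //; exact: compact_set1.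
  apply: (subclosed_compact _ cI); first exact: closed_dsupp.
  by move=> y /sK Ky; exists (hinv x, hprod x y) => //=; rewrite hprodVK.
- move=> y Ty x0 Ox0.
  have [K [cK KO nK]] := operator_carrier oO lM cM Ox0.
  have clK : closed K by apply: compact_closed => //; exact: norm_hausdorff.
  have sub x' : Omega x' -> regular x' ->
     (forall h : Cinf Omega, set_nbhs K [set z | h z = 0] -> M h x' = 0) -> K (hprod x' y).
    move=> Ox' rx' h; apply: (symbol_supp Ox' rx' cK h).
    suff <- : symbol x = symbol x' by [].
    by apply/funext => f; exact: symbol_indep.
  apply: KO; rewrite hprodC; apply: contrapT => nKxy.
  have n1 : \forall z \near x0, ~ K (hprod z y).
    apply: open_nbhs_nbhs; split; last by [].
    have := open_hprod (x := y) (closed_openC clK).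
    by congr open; apply/seteqP; split => z /=; rewrite hprodC.
  have n2 : nbhs x0 Omega by exact: open_nbhs_nbhs.
  have [x' [[nx' Ox'] hx'] rx'] := regular_near (filterI (filterI n1 n2) nK).
  by apply: nx'; exact: sub.
Qed.

(** At a regular y, a cutoff near both the carrier of M at y and y supp T
    replaces f by a function defined on R^d, for which both sides are the symbol
    at y by definition.  Regular points are dense and both sides are continuous.
    *)
Lemma Mop_symbol x : Omega x -> regular x -> Mop Omega (symbol x) = M.
Proof.
move=> Ox rx; have ET := symbol_Edist Ox rx.
apply/funext => f.
have reg y : Omega y -> regular y -> Mop Omega (symbol x) f y = M f y.
  move=> Oy ry; have [K [cK KO nK]] := operator_carrier oO lM cM Oy.
  have kT : compact (dsupp (symbol x)) by case: ET.
  have cL : compact (hprod_set [set y] (dsupp (symbol x))).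
    by apply: compact_hprod_set => //; exact: compact_set1.
  have KL : K `|` hprod_set [set y] (dsupp (symbol x)) `<=` Omega.
    move=> z [/KO//|[[_ t] [/= -> Tt] <-]].
    exact: (dsupp_dilation ET Oy Tt).
  have [psi [p1 _ pO]] := cutoff (compactU cK cL) oO KL.
  have sf := smooth_cutoff oO pO (smooth_Cinf oO f).
  pose k : Cinf [set: V] := Cinf_of setT (fun z => psi z * f z).
  have kE z : k z = psi z * f z by exact: (Cinf_ofS oT).
  pose g : Cinf [set: V] := Cinf_of setT (fun z => k (hprod y z)).
  have gE z : g z = psi (hprod y z) * f (hprod y z).
    by have sd := smooth_dil y k; rewrite (Cinf_ofS oT)// kE.
  rewrite (@Mop_germ _ _ _ oO _ ET f y g)//; last first.
    move=> t Tt.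
    have : set_nbhs (K `|` hprod_set [set y] (dsupp (symbol x))) [set z | psi z = 1] by [].
    move=> /set_nbhsP[N [oN KN N1]].
    have : \forall z \near t, N (hprod y z).
      apply: open_nbhs_nbhs; split; first exact: (open_hprod (x := y) oN).
      by apply: KN; right; exists (y, t).
    by apply: filterS => z /N1 pz; rewrite /mkset gE (pz : psi _ = 1) mul1r.
  rewrite (symbol_indep g Ox rx Oy ry) /symbol.
  apply/eqP; rewrite -subr_eq0; apply/eqP; rewrite -CinfB -(linear_mapB lM).
  apply: (nbhs_singleton nK) => z Kz.
  have : \forall w \near z, psi w = 1 by apply: p1; left.
  apply: filterS => w pw; rewrite /mkset CinfB.
  have [Ow|nOw] := pselect (Omega w); last by rewrite !Cinf_out// subrr.
  by rewrite restr_dilE// gE hprodV// pw mul1r subrr.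
apply: Cinf_ext => y Oy.
apply/eqP; rewrite -subr_eq0; apply/eqP.
pose D := Mop Omega (symbol x) f - M f.
have c : (fun t : R => D (y + const_mx t) : R[i]^o) @ 0^'+ --> (D y : R[i]^o).
  exact: (cvg_comp _ _ (@cvg_regular _ _ y) (cdiff_continuous (smooth_Cinf oO D [::] Oy))).
have z : (fun t : R => D (y + const_mx t) : R[i]^o) @ 0^'+ --> (0 : R[i]^o).
  apply: cvg_near_cst.
  have nO : \forall t \near (0 : R)^'+, Omega (y + const_mx t).
    by apply: (@cvg_regular _ _ y); exact: open_nbhs_nbhs.
  apply: filterS2 nO (near_regular y) => t Ot rt.
  by rewrite /D CinfB reg// subrr.
by rewrite -CinfB; apply: (cvg_unique _ c z); exact: norm_hausdorff.
Qed.

End Symbol.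

End Representation.

Theorem mainTheorem3 (R : realType) (d : nat) (Omega : set 'rV[R]_d)
    (Omega_open : open Omega) (Omega_neq0 : Omega !=set0) :
  (* M(Omega) is a closed subalgebra of L_b(C^oo(Omega)) *)
  (subalgebra_of_L (Hadamard Omega) /\ closed_in_Lb (Hadamard Omega)) /\
  (* (E'(V(Omega)), star) is an algebra and T |-> M_T is an isomorphism from it
     onto M(Omega) *)
  let E' := Edist (dilation_set Omega) in
  ([/\ E' 0,
       (forall (a : R[i]) T S, E' T -> E' S -> E' (a *: T + S)),
       (forall T S, E' T -> E' S -> star_well_defined T S) &
       (forall T S, E' T -> E' S -> E' (star T S))] /\
   [/\ (forall T, E' T -> Mop_well_defined Omega T),
       (forall (a : R[i]) T S, E' T -> E' S ->
          Mop Omega (a *: T + S) = a *: Mop Omega T + Mop Omega S),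
       (forall T S, E' T -> E' S ->
          Mop Omega (star T S) = Mop Omega T \o Mop Omega S) &
       set_bij E' (Hadamard Omega) (Mop Omega)]).
Proof.
split; first by split; [exact: Hadamard_subalgebra|exact: Hadamard_closed].
move=> E'; split; split.
- exact: Edist0.
- by move=> a T S; exact: Edist_lin.
- by move=> T S _ /EdistT; exact: star_wd.
- by move=> T S; exact: Edist_star.
- by move=> T; exact: Mop_wd.
- by move=> a T S; exact: Mop_lin.
- by move=> T S; exact: Mop_star.
- split.
  + by move=> T ET; exact: Mop_Hadamard.
  + by move=> T S /set_mem ET /set_mem ES; exact: Mop_inj.
  + move=> M HM; have [x1 Ox1] := Omega_neq0.
    have [x0 Ox0 rx0] := regular_near (open_nbhs_nbhs (conj Omega_open Ox1)).
    exists (symbol M x0); first exact: symbol_Edist.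
    exact: Mop_symbol.
Qed.
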